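(* For every fixed $h>0$, $\tau>0$, and old state $(\rho_h^n,\theta_h^n,\eta_h^n)\in V_h^3$ with $\theta_h^n>0$ on $\overline\Omega$, the fully discrete problem (stated in the context) has at least one solution $(\rho_h^{n+1},\mu_{\rho,h}^{n+1},\theta_h^{n+1},\eta_h^{n+1},\mu_{\eta,h}^{n+1})\in V_h^5$ with $\theta_h^{n+1}>0$ on $\overline\Omega$.
   Context: $\Omega=\mathbb T^d$, $1\le d\le3$, flat torus, $z=(\rho,\eta)\in\mathbb R^2$, $(\cdot,\cdot)$ exact $L^2(\Omega)$ pairing. Potential: fix $q>1$ with $q\ge d$, constants $\varepsilon_1,\varepsilon_q,\gamma_\rho,\gamma_\eta>0$, and non-negative polynomials $F_0,F_1$ on $\mathbb R^2$ of degree at most four with $|DF_j(z)|\le C(1+|z|^3)$, $|D^2F_j(z)|\le C(1+|z|^2)$, such that for some $a>0$, $c_a,C_a>0$: $aF_1(z)-F_0(z)\ge c_a|z|^4-C_a$. For $\theta>0$, $$\psi(z,\theta)=\ln\theta-\varepsilon_1\theta(\ln\theta-1)-\tfrac{\varepsilon_q}{q-1}\theta^{1-q}-F_0(z)+\theta F_1(z),\quad e=\partial_\theta\psi .$$ Splitting: $\psi_{\rm vex}(z,\theta)=\psi(z,\theta)+M(1+\theta)(1+|z|^2)^2$, $\psi_{\rm cav}(z,\theta)=-M(1+\theta)(1+|z|^2)^2$, with a fixed constant $M>0$ such that for every $\theta>0$ $\psi_{\rm vex}(\cdot,\theta)$ is convex and $\psi_{\rm cav}(\cdot,\theta)$ is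 concave (such $M$ exists). Mobility: $\mathbf L(z,\theta)\in\mathbb R^{(2d+1)\times(2d+1)}$ is continuous, bounded, symmetric, $\lambda_0|\zeta|^2\le\zeta^\top\mathbf L\zeta\le\lambda_1|\zeta|^2$ with $0<\lambda_0\le\lambda_1$, with blocks $\mathbf L_{11},\mathbf L_{12},\mathbf L_{22}\in\mathbb R^{d\times d}$, $\mathbf L_{13},\mathbf L_{23}\in\mathbb R^d$, $\mathbf L_{33}\in\mathbb R$ (rows $(\mathbf L_{11},\mathbf L_{12},\mathbf L_{13})$, $(\mathbf L_{12}^\top,\mathbf L_{22},\mathbf L_{23})$, $(\mathbf L_{13}^\top,\mathbf L_{23}^\top,\mathbf L_{33})$). $V_h$: continuous piecewise affine periodic finite-element space on a periodic simplicial mesh $\mathcal T_h$ of $\Omega$ (from a shape-regular, quasi-uniform family). Put $\delta_\tau v^{n+1}=(v^{n+1}-v^n)/\tau$, $e_h^n=e(z_h^n,\theta_h^n)$, $\mathbf L_h^n=\mathbf L(z_h^n,\theta_h^n)$ (blocks $\mathbf L_{ij,h}^n$), $(G_{\rho,h}^{n+1},G_{\eta,h}^{n+1})=D_z\psi_{\rm vex}(z_h^{n+1},\theta_h^{n+1})+D_z\psi_{\rm cav}(z_h^n,\theta_h^{n+1})$. Fully discrete problem: given $(\rho_h^n,\theta_h^n,\eta_h^n)\in V_h^3$ with $\theta_h^n>0$, find $(\rho_h^{n+1},\mu_{\rho,h}^{n+1},\theta_h^{n+1},\eta_h^{n+1},\mu_{\eta,h}^{n+1})\in V_h^5$ with $\theta_h^{n+1}>0$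 on $\overline\Omega$ such that for all $(v_h,\zeta_h,\xi_h,w_h,\chi_h)\in V_h^5$ $$(\delta_\tau\rho_h^{n+1},v_h)+(\mathbf L_{11,h}^n\nabla\mu_{\rho,h}^{n+1}-\mathbf L_{12,h}^n\nabla\theta_h^{n+1}+\mathbf L_{13,h}^n\mu_{\eta,h}^{n+1},\nabla v_h)=0,$$ $$(\mu_{\rho,h}^{n+1},\zeta_h)=\gamma_\rho(\nabla\rho_h^{n+1},\nabla\zeta_h)+(G_{\rho,h}^{n+1},\zeta_h),$$ $$(\delta_\tau e_h^{n+1},\xi_h)+((\mathbf L_{12,h}^n)^\top\nabla\mu_{\rho,h}^{n+1}-\mathbf L_{22,h}^n\nabla\theta_h^{n+1}+\mathbf L_{23,h}^n\mu_{\eta,h}^{n+1},\nabla\xi_h)=0,$$ $$(\delta_\tau\eta_h^{n+1},w_h)+(\mathbf L_{13,h}^n\cdot\nabla\mu_{\rho,h}^{n+1}-\mathbf L_{23,h}^n\cdot\nabla\theta_h^{n+1}+\mathbf L_{33,h}^n\mu_{\eta,h}^{n+1},w_h)=0,$$ $$(\mu_{\eta,h}^{n+1},\chi_h)=\gamma_\eta(\nabla\eta_h^{n+1},\nabla\chi_h)+(G_{\eta,h}^{n+1},\chi_h).$$ *)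

(* Defs.v *)
From HB Require Import structures.
From mathcomp Require Import all_boot all_order all_algebra.
From mathcomp Require Import all_classical all_reals all_analysis.

Set Implicit Arguments.
Unset Strict Implicit.
Unset Printing Implicit Defensive.

Import Order.TTheory GRing.Theory Num.Theory numFieldNormedType.Exports.

Local Open Scope classical_set_scope.
Local Open Scope ring_scope.

Section LebesgueTuple.
Variable R : realType.
Local Notation MR := (measurableTypeR R).

Definition tuple_cons n (p : MR * n.-tuple MR) : n.+1.-tuple MR :=
  [tuple of p.1 :: p.2].

Lemma measurable_tuple_cons n : measurable_fun setT (@tuple_cons n).
Proof. exact: measurable_cons. Qed.

Section Step.
Variables (n : nat) (mu : {sigma_finite_measure set (n.-tuple MR) -> \bar R}).

Definition lebesgue_step : set (n.+1.-tuple MR) -> \bar R :=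
  pushforward (@lebesgue_measure R \x mu)%E (@tuple_cons n).

Let step0 : lebesgue_step set0 = 0%E.
Proof. by rewrite /lebesgue_step /pushforward preimage_set0 measure0. Qed.

Let step_ge0 A : (0 <= lebesgue_step A)%E.
Proof. by rewrite /lebesgue_step /pushforward; apply: integral_ge0. Qed.

Let step_additive : semi_sigma_additive lebesgue_step.
Proof. 
apply: (@measure_semi_sigma_additive _ _ _ (pushforward (@lebesgue_measure R \x mu)%E (@tuple_cons n))).
exact: measurable_tuple_cons.
Qed.

HB.instance Definition _ :=
  isMeasure.Build _ _ _ lebesgue_step step0 step_ge0 step_additive.

Let step_sigma_finite : sigma_finite setT lebesgue_step.
Proof.
have /sigma_finiteP[F [FT ndF Ffin]] := sigma_finiteT (@lebesgue_measure R).
have /sigma_finiteP[G [GT ndG Gfin]] := sigma_finiteT mu.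
have mH k : measurable ((fun t : n.+1.-tuple MR => [tuple of behead t]) @^-1` G k).
  rewrite -[X in measurable X]setTI.
  by apply: measurable_behead => //; exact: (Gfin k).1.
have mK k : measurable ((fun t : n.+1.-tuple MR => tnth t ord0) @^-1` F k).
  rewrite -[X in measurable X]setTI.
  by apply: measurable_tnth => //; exact: (Ffin k).1.
exists (fun k => (fun t : n.+1.-tuple MR => tnth t ord0) @^-1` F k `&`
                 (fun t : n.+1.-tuple MR => [tuple of behead t]) @^-1` G k).
  apply/seteqP; split=> // t _.
  have [i _ Fi] : (\bigcup_i F i) (tnth t ord0) by rewrite -FT.
  have [j _ Gj] : (\bigcup_i G i) [tuple of behead t] by rewrite -GT.
  exists (maxn i j) => //; split => /=.
    by move: Fi; apply/subsetPset/ndF/leq_maxl.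
  by move: Gj; apply/subsetPset/ndG/leq_maxr.
move=> k; split; first exact: measurableI.
rewrite /lebesgue_step /pushforward.
have -> : @tuple_cons n @^-1` ((fun t : n.+1.-tuple MR => tnth t ord0) @^-1` F k
    `&` (fun t : n.+1.-tuple MR => [tuple of behead t]) @^-1` G k) = F k `*` G k.
  have E (x : MR) (y : n.-tuple MR) : [tuple of behead (tuple_cons (x, y))] = y.
    exact/val_inj.
  by apply/seteqP; split=> -[x y] [] /=; rewrite E.
rewrite product_measure1E; [|exact: (Ffin k).1|exact: (Gfin k).1].
by rewrite lte_mul_pinfty// ?ge0_fin_numE// ?(Ffin k).2 ?(Gfin k).2.
Qed.

HB.instance Definition _ :=
  Measure_isSigmaFinite.Build _ _ _ lebesgue_step step_sigma_finite.
End Step.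

(* Lebesgue measure on R^n, points of R^n being n-tuples: the pushforward of
   lebesgue_measure \x lebesgue_tuple n.-1 under (x, t) |-> x :: t. *)
Fixpoint lebesgue_tuple n :
    {sigma_finite_measure set (n.-tuple MR) -> \bar R} :=
  match n return {sigma_finite_measure set (n.-tuple MR) -> \bar R} with
  | 0 => [the {sigma_finite_measure set (0.-tuple MR) -> \bar R} of
          \d_([tuple] : 0.-tuple MR)]
  | m.+1 => [the {sigma_finite_measure set (m.+1.-tuple MR) -> \bar R} of
          lebesgue_step (lebesgue_tuple m)]
  end.
End LebesgueTuple.

Section EuclideanNorm.
Variable R : realType.

(* The library norm on matrices is the max norm, hence these. *)
Definition dot m n (A B : 'M[R]_(m, n)) : R := \sum_i \sum_j A i j * B i j.
Definition enorm m n (A : 'M[R]_(m, n)) : R := Num.sqrt (dot A A).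

Definition znorm (z : R * R) : R := Num.sqrt (z.1 ^+ 2 + z.2 ^+ 2).

End EuclideanNorm.

(* The torus is R^d / Z^d. Functions on it are the Z^d-periodic functions on
   R^d (row vectors), integrated over the fundamental domain [0, 1[^d. *)
Section Torus.
Variables (R : realType) (d : nat).
Implicit Types u v : 'rV[R]_d -> R.

Definition int_vec (k : 'rV[int]_d) : 'rV[R]_d := map_mx (fun m => m%:~R) k.

Definition periodic u := forall (k : 'rV[int]_d) x, u (x + int_vec k) = u x.

Definition unit_cube : set (d.-tuple (measurableTypeR R)) :=
  [set t | forall i, 0 <= tnth t i < 1].

Definition torus_integral u : R :=
  \int[lebesgue_tuple R d]_(t in unit_cube) u (\row_i tnth t i).

Definition L2 u v : R := torus_integral (fun x => u x * v x).

Definition L2v (F G : 'rV[R]_d -> 'cV[R]_d) : R :=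
  torus_integral (fun x => dot (F x) (G x)).

(* For continuous piecewise affine u this is the broken gradient off the mesh
   faces. Where a partial derivative does not exist (a subset of the faces, hence
   Lebesgue-null) 'D_ takes a default value, which the integrals do not see. *)
Definition grad u (x : 'rV[R]_d) : 'cV[R]_d :=
  \col_(i < d) 'D_(delta_mx 0 i) u x.

End Torus.

Section Mesh.
Variables (R : realType) (d : nat).

Definition simplex (v : 'I_d.+1 -> 'rV[R]_d) : set 'rV[R]_d :=
  [set x | exists w : 'I_d.+1 -> R,
    [/\ forall i, 0 <= w i, \sum_i w i = 1 & x = \sum_i w i *: v i]].

Definition face (v : 'I_d.+1 -> 'rV[R]_d) (J : pred 'I_d.+1) : set 'rV[R]_d :=
  [set x | exists w : 'I_d.+1 -> R,
    [/\ forall i, 0 <= w i, forall i, ~~ J i -> w i = 0,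
        \sum_i w i = 1 & x = \sum_i w i *: v i]].

(* A Z^d-periodic conforming triangulation of R^d: finitely many simplices,
   each listed by its vertices, whose integer translates cover R^d and meet in
   the (possibly empty) face spanned by their common vertices. *)
Record mesh := Mesh {
  cell : finType;
  vertex : cell -> 'I_d.+1 -> 'rV[R]_d;
  mesh_nondegenerate : forall K,
    (\matrix_(i < d) (vertex K (lift ord0 i) - vertex K ord0)) \in unitmx;
  mesh_cover : forall x, exists K (k : 'rV[int]_d),
    simplex (vertex K) (x - int_vec R k);
  mesh_conforming : forall K K' (k : 'rV[int]_d),
    let v' i := vertex K' i + int_vec R k in
    simplex (vertex K) `&` simplex v' =
    face (vertex K) (fun i => [exists j, vertex K i == v' j]);
  mesh_distinct : forall K K' (k : 'rV[int]_d),
    (forall i, exists j, vertex K i = vertex K' j + int_vec R k) -> K = K' }.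

Definition diam (T : mesh) (K : cell T) : R :=
  \big[Num.max/0]_(i < d.+1) \big[Num.max/0]_(j < d.+1)
    enorm (vertex K i - vertex K j).

Definition shape_regular (H : set R) (T : R -> mesh) :=
  exists2 sigma : R, 0 < sigma & forall h, H h -> forall K : cell (T h),
    exists x, [set y | enorm (y - x) <= sigma * diam K] `<=` simplex (vertex K).

Definition quasi_uniform (H : set R) (T : R -> mesh) :=
  exists2 c : R, 0 < c & forall h, H h -> forall K : cell (T h),
    c * h <= diam K <= h.

Definition affine_on (A : set 'rV[R]_d) (u : 'rV[R]_d -> R) :=
  exists (g : 'rV[R]_d) (c : R), forall x, A x -> u x = dot g x + c.

Definition fe_space (T : mesh) : set ('rV[R]_d -> R) :=
  [set u | [/\ continuous u, periodic u &
    forall K : cell T, affine_on (simplex (vertex K)) u]].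

End Mesh.

Section Potential.
Variable R : realType.

(* F0 and F1 are polynomials in (rho, eta): rho is the outer variable and eta the
   inner one, so that F`_i`_j is the coefficient of rho^i eta^j. *)
Record potential := Potential {
  qexp : R; eps1 : R; epsq : R; F0 : {poly {poly R}}; F1 : {poly {poly R}} }.

Definition eval2 (F : {poly {poly R}}) (z : R * R) : R := F.[z.1%:P].[z.2].

Definition d_rho (f : R * R -> R) (z : R * R) : R :=
  derive1 (fun r => f (r, z.2)) z.1.
Definition d_eta (f : R * R -> R) (z : R * R) : R :=
  derive1 (fun s => f (z.1, s)) z.2.

Definition Dnorm (f : R * R -> R) (z : R * R) : R :=
  znorm (d_rho f z, d_eta f z).
Definition D2norm (f : R * R -> R) (z : R * R) : R :=
  znorm (Dnorm (d_rho f) z, Dnorm (d_eta f) z).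

Definition psi (P : potential) (z : R * R) (theta : R) : R :=
  ln theta - eps1 P * theta * (ln theta - 1)
  - epsq P / (qexp P - 1) * theta `^ (1 - qexp P)
  - eval2 (F0 P) z + theta * eval2 (F1 P) z.

Definition e_pot (P : potential) (z : R * R) (theta : R) : R :=
  derive1 (psi P z) theta.

Definition quartic (M : R) (z : R * R) (theta : R) : R :=
  M * (1 + theta) * (1 + znorm z ^+ 2) ^+ 2.
Definition psi_vex P M z theta : R := psi P z theta + quartic M z theta.
Definition psi_cav M z theta : R := - quartic M z theta.

Record admissible_poly (C : R) (F : {poly {poly R}}) : Prop := {
  poly_degree : forall i j, (4 < i + j)%N -> F`_i`_j = 0;
  poly_ge0 : forall z, 0 <= eval2 F z;
  poly_growth1 : forall z, Dnorm (eval2 F) z <= C * (1 + znorm z ^+ 3);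
  poly_growth2 : forall z, D2norm (eval2 F) z <= C * (1 + znorm z ^+ 2) }.

Record admissible_potential (d : nat) (P : potential) : Prop := {
  q_gt1 : 1 < qexp P;
  q_ge_dim : d%:R <= qexp P;
  eps1_gt0 : 0 < eps1 P;
  epsq_gt0 : 0 < epsq P;
  growth : exists C : R, admissible_poly C (F0 P) /\ admissible_poly C (F1 P);
  coercive : exists a c C : R, [/\ 0 < a, 0 < c, 0 < C &
    forall z, c * znorm z ^+ 4 - C <= a * eval2 (F1 P) z - eval2 (F0 P) z] }.

Definition convex_R2 (f : R * R -> R) :=
  convex_function (E := (R^o * R^o)%type) setT f.

Record admissible_splitting (P : potential) (M : R) : Prop := {
  M_gt0 : 0 < M;
  vex_convex : forall theta, 0 < theta -> convex_R2 (psi_vex P M ^~ theta);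
  cav_concave : forall theta, 0 < theta ->
    convex_R2 (fun z => - psi_cav M z theta) }.

End Potential.

Section Mobility.
Variables (R : realType) (d : nat).

Record admissible_mobility (lambda0 lambda1 : R)
    (L : R * R -> R -> 'M[R]_(d + d + 1)) : Prop := {
  lambda0_gt0 : 0 < lambda0;
  lambda0_le1 : lambda0 <= lambda1;
  mob_continuous : {within [set p : (R * R) * R | 0 < p.2],
    continuous (fun p => L p.1 p.2)};
  mob_bounded : exists B : R, forall z theta, 0 < theta ->
    enorm (L z theta) <= B;
  mob_symmetric : forall z theta, 0 < theta -> (L z theta)^T = L z theta;
  mob_elliptic : forall z theta (zeta : 'cV[R]_(d + d + 1)), 0 < theta ->
    lambda0 * enorm zeta ^+ 2 <= (zeta^T *m L z theta *m zeta) 0 0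
      <= lambda1 * enorm zeta ^+ 2 }.

Implicit Type A : 'M[R]_(d + d + 1).
Definition blk11 A : 'M[R]_d := ulsubmx (ulsubmx A).
Definition blk12 A : 'M[R]_d := ursubmx (ulsubmx A).
Definition blk22 A : 'M[R]_d := drsubmx (ulsubmx A).
Definition blk13 A : 'cV[R]_d := usubmx (ursubmx A).
Definition blk23 A : 'cV[R]_d := dsubmx (ursubmx A).
Definition blk33 A : R := drsubmx A 0 0.

End Mobility.

Section Scheme.
Variables (R : realType) (d : nat).
Variables (P : potential R) (M gamma_rho gamma_eta : R).
Variables (L : R * R -> R -> 'M[R]_(d + d + 1)) (T : mesh R d) (tau : R).
Local Notation V := (fe_space T).

(* Suffix 0: time level n; suffix 1: time level n+1. *)
Definition discrete_step
    (rho0 theta0 eta0 rho1 murho1 theta1 eta1 mueta1 : 'rV[R]_d -> R) : Prop :=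
  let z0 x := (rho0 x, eta0 x) in
  let z1 x := (rho1 x, eta1 x) in
  let Lh x := L (z0 x) (theta0 x) in
  let delta (f0 f1 : 'rV[R]_d -> R) x := (f1 x - f0 x) / tau in
  let e0 x := e_pot P (z0 x) (theta0 x) in
  let e1 x := e_pot P (z1 x) (theta1 x) in
  let Grho x := d_rho (psi_vex P M ^~ (theta1 x)) (z1 x)
                + d_rho (psi_cav M ^~ (theta1 x)) (z0 x) in
  let Geta x := d_eta (psi_vex P M ^~ (theta1 x)) (z1 x)
                + d_eta (psi_cav M ^~ (theta1 x)) (z0 x) in
  forall v zeta xi w chi, V v -> V zeta -> V xi -> V w -> V chi ->
  [/\ L2 (delta rho0 rho1) v
        + L2v (fun x => blk11 (Lh x) *m grad murho1 x
                        - blk12 (Lh x) *m grad theta1 x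
                        + mueta1 x *: blk13 (Lh x)) (grad v) = 0,
      L2 murho1 zeta = gamma_rho * L2v (grad rho1) (grad zeta) + L2 Grho zeta,
      L2 (delta e0 e1) xi
        + L2v (fun x => (blk12 (Lh x))^T *m grad murho1 x
                        - blk22 (Lh x) *m grad theta1 x
                        + mueta1 x *: blk23 (Lh x)) (grad xi) = 0,
      L2 (delta eta0 eta1) w
        + L2 (fun x => dot (blk13 (Lh x)) (grad murho1 x)
                       - dot (blk23 (Lh x)) (grad theta1 x)
                       + blk33 (Lh x) * mueta1 x) w = 0
    & L2 mueta1 chi = gamma_eta * L2v (grad eta1) (grad chi) + L2 Geta chi].

End Scheme.

(* Main.v *)
(* In coordinates with respect to a basis of V_h, the scheme asks for a zero of a
   continuous map F on R^(5n). On the compact convex set K of coefficient vectors with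
   entries bounded by Rb and theta >= ka > 0, the Hartman-Stampacchia theorem (hence
   Brouwer, obtained here from Scarf's lemma) gives x in K with <F x, y - x> >= 0 for
   all y in K. It remains to see that x is an interior point of K when Rb is large and
   ka is small.
   Take y = (rho^n, 0, a, eta^n, 0), with a constant a for which a F_1 - F_0 is coercive.
   The convex splitting in z, the concavity of psi in theta and zeta^T L zeta >= 0 turn
   <F x, x - y> <= 0 into an entropy inequality bounding the integral of
   |z|^4 + theta + theta^(-q) independently of Rb and ka. In the finite-dimensional space
   V_h this bounds rho, theta, eta; and since theta is Lipschitz near a vertex where it is
   minimal and q >= d, the integral of theta^(-q) bounds theta from below. So the rows of
   F paired with rho and eta vanish; these are the equations defining mu_rho and mu_eta,
   which are therefore bounded as well. *)
Require Import Defs.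
From HB Require Import structures.
From mathcomp Require Import all_boot.
Set Implicit Arguments.
Unset Strict Implicit.
Unset Printing Implicit Defensive.

(** * Scarf's lemma *)

(** The energy density e is singular at theta = 0, so F is continuous only where theta stays
    positive: this is why a variational inequality on a set with theta >= ka is solved instead of an
    equation on the whole space. Interiority is tested one coordinate at a time, by moving the
    solution both ways along a coordinate vector. This only asks that this coordinate be off the
    faces of the box and that theta exceed ka, so the rows paired with rho and eta can be treated
    while nothing is known yet about mu_rho and mu_eta. Every bound has to be free of Rb and ka,
    which are fixed last. The equation defining mu_rho is divided by tau and paired with rho, the
    balance of rho is paired with mu_rho, likewise for eta, and the energy balance enters with a
    minus sign: then the products of the potentials with the increments cancel and the fluxes add up
    to the mobility form. The constant temperature a in y has zero gradient, so the energy flux is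
    tested with grad theta alone, and it leaves a F_1 - F_0 in the entropy. *)

Lemma imset_drop_dup (A B : finType) (f : A -> B) (S : {set A}) :
  #|S| = #|f @: S|.+1 ->
  exists x y, x != y /\
    [set z in S | f @: (S :\ z) == f @: S] = [set x; y].
Proof.
move=> card.
have : ~~ [forall i in S, forall j in S, (f i == f j) ==> (i == j)].
  apply/negP => /forall_inP H.
  have /card_in_imset : {in S &, injective f}.
    by move=> i j iC jC e; have /forall_inP/(_ j jC)/implyP := H i iC;
      move/(_ (introT eqP e))/eqP.
  by rewrite card => /eqP; rewrite ltn_eqF.
rewrite negb_forall_in => /exists_inP[x xS].
rewrite negb_forall_in => /exists_inP[y yS].
rewrite negb_imply => /andP[/eqP e xy]; exists x, y; split=> //.
have drop (D : {set A}) u v : u != v -> f u = f v -> v \in D -> f @: (D :\ u) = f @: D.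
  move=> uv euv vD; apply/eqP; rewrite eqEsubset imsetS ?subsetDl//=.
  apply/subsetP => _ /imsetP[k kC ->]; have [->|ki] := eqVneq k u.
    by rewrite euv; apply: imset_f; rewrite !inE eq_sym uv.
  by apply: imset_f; rewrite 2!inE ki.
apply/setP => z; rewrite !inE; apply/andP/orP => [[zS /eqP ez]|]; last first.
  case=> /eqP->; split=> //; apply/eqP; first exact: drop e _.
  by apply: drop (esym e) _; rewrite // eq_sym.
have [zx|zx] := eqVneq z x; first by left.
have [zy|zy] := eqVneq z y; first by right.
(* A third removable element z could be dropped together with x, leaving #|S| - 2 elements to cover
   an image of size #|S| - 1. *)
have : f @: (S :\ z :\ x) = f @: S.
  by rewrite -ez; apply: drop e _; rewrite // !inE eq_sym zy.
move=> e2; have := leq_imset_card f (mem (S :\ z :\ x)); rewrite e2 => le.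
have := cardsD1 x (S :\ z); have := cardsD1 z S.
rewrite zS card !inE xS (eq_sym x z) zx /= add1n => -[<-] e3.
by move: le; rewrite e3 add1n ltnn.
Qed.

Section Scarf.
Variables (T I : finType) (r : I -> T -> nat).
Hypothesis r_inj : forall i, injective (r i).

(** Each [r i] is injective, hence a linear order on T. A pair is dominant when no point of T lies
    above the [r i]-minimum of s for every i in C at once. Dominant pairs play the role of a
    triangulation: rooms are its full cells, doors their walls, and a room is reached from a door by
    dropping an index or by adding a point. *)
Definition dominant (s : {set T}) (C : {set I}) :=
  [forall y, [exists i in C, [forall x in s, r i y <= r i x]]].

Lemma dominantP (s : {set T}) (C : {set I}) :
  reflect (forall y, exists2 i, i \in C & forall x, x \in s -> r i y <= r i x)
          (dominant s C).
Proof.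
apply: (iffP forallP) => H y.
  by have /exists_inP[i iC /forall_inP K] := H y; exists i.
by have [i iC K] := H y; apply/exists_inP; exists i => //; apply/forall_inP.
Qed.

Definition is_room (p : {set T} * {set I}) := dominant p.1 p.2 && (#|p.2| == #|p.1|).
Definition is_door (p : {set T} * {set I}) := dominant p.1 p.2 && (#|p.2| == #|p.1|.+1).

Definition door_of (d p : {set T} * {set I}) :=
  ((p.1 == d.1) && [exists j in d.2, p.2 == d.2 :\ j]) ||
  ((p.2 == d.2) && [exists x, (x \notin d.1) && (p.1 == x |: d.1)]).

Section Door.
Variables (s : {set T}) (C : {set I}) (x0 : T).
Hypotheses (x0s : x0 \in s) (doorP : is_door (s, C)).

Let mu i := [arg min_(x < x0 in s) r i x].

Let mu_in i : mu i \in s. Proof. by rewrite /mu; case: arg_minnP. Qed.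
Let mu_le i x : x \in s -> r i (mu i) <= r i x.
Proof. by rewrite /mu; case: arg_minnP => // y _ H /H. Qed.
Let mu_eq i x : x \in s -> (forall y, y \in s -> r i x <= r i y) -> mu i = x.
Proof.
move=> xs H; apply: (@r_inj i); apply/eqP.
by rewrite eqn_leq mu_le //= H.
Qed.

Let dom_im (D : {set I}) : dominant s D -> mu @: D = s.
Proof.
move=> /dominantP dm; apply/eqP; rewrite eqEsubset; apply/andP; split.
  by apply/subsetP => _ /imsetP[i _ ->].
apply/subsetP => x xs; have [i iD H] := dm x.
by apply/imsetP; exists i => //; rewrite (mu_eq xs).
Qed.

Let domC : dominant s C. Proof. by have /andP[] := doorP. Qed.
Let cardC : #|C| = #|s|.+1. Proof. by have /andP[_ /eqP] := doorP. Qed.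

Let mu_dup : exists i j, [/\ i \in C, j \in C, i != j & mu i = mu j].
Proof.
have : ~~ [forall i in C, forall j in C, (mu i == mu j) ==> (i == j)].
  apply/negP => /forall_inP H.
  have /card_in_imset : {in C &, injective mu}.
    by move=> i j iC jC e; have /forall_inP/(_ j jC)/implyP := H i iC;
      move/(_ (introT eqP e))/eqP.
  by rewrite (dom_im domC) cardC => /eqP; rewrite ltn_eqF.
rewrite negb_forall_in => /exists_inP[i iC].
rewrite negb_forall_in => /exists_inP[j jC].
by rewrite negb_imply => /andP[/eqP e ne]; exists i, j.
Qed.

Let above k := [set y | [forall l in C :\ k, r l (mu l) < r l y]].
Let aboveP k y : reflect (forall l, l \in C -> l != k -> r l (mu l) < r l y)
  (y \in above k).
Proof.
rewrite inE; apply: (iffP forall_inP) => H l.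
  by move=> lC lk; apply: H; rewrite !inE lk.
by rewrite !inE => /andP[lk lC]; apply: H.
Qed.

(** The room found by giving up the constraint of the index k: a point above s in all the other
    orders, if there is one, is added, taking the [r k]-largest to keep dominance; otherwise k can
    simply be dropped. *)
Let room k := if [pick y in above k] is Some y0 then
   ([arg max_(x > y0 in above k) r k x] |: s, C) else (s, C :\ k).

Let roomP k :
  ((forall y, y \notin above k) /\ room k = (s, C :\ k)) \/
  exists x, [/\ x \in above k, forall y, y \in above k -> r k y <= r k x &
             room k = (x |: s, C)].
Proof.
rewrite /room; case: pickP => [y0 y0k|H].
  by case: arg_maxnP => // x xk Hx; right; exists x.
by left; split=> // y; rewrite H.
Qed.

Let above_dom k y : y \in above k -> forall z, z \in s -> r k y <= r k z.
Proof.
move=> /aboveP yk; have /dominantP/(_ y)[l lC H] := domC.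
have [<-//|lk] := eqVneq l k.
by have := yk l lC lk; rewrite ltnNge H.
Qed.

Let above_notin k x : mu @: (C :\ k) = s -> x \in above k -> x \notin s.
Proof.
move=> im /aboveP xk; apply/negP => xs.
move: (xs); rewrite -im => /imsetP[l]; rewrite !inE => /andP[lk lC] e.
by have := xk l lC lk; rewrite -e ltnn.
Qed.

Let room_door k : k \in C -> mu @: (C :\ k) = s ->
  is_room (room k) && door_of (s, C) (room k).
Proof.
move=> kC im; have [[H ->]|[x [xk xmax ->]]] := roomP k.
  rewrite /is_room /door_of /= eqxx /=; apply/andP; split; last first.
    by rewrite orbC; apply/orP; right; apply/exists_inP; exists k.
  apply/andP; split; last by have := cardsD1 k C; rewrite kC cardC => -[->].
  apply/dominantP => y; have := H y; rewrite inE negb_forall_in.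
  move=> /exists_inP[l lC]; rewrite -leqNgt => le; exists l => // z zs.
  by apply: leq_trans le _; apply: mu_le.
have xs := above_notin im xk.
rewrite /is_room /door_of /= eqxx /=; apply/andP; split; last first.
  by apply/orP; right; apply/existsP; exists x; rewrite xs eqxx.
rewrite cardsU1 xs cardC eqxx andbT; apply/dominantP => y.
have [yk|] := boolP (y \in above k).
  exists k => // z; rewrite !inE => /orP[/eqP->|]; first exact: xmax.
  exact: above_dom.
rewrite inE negb_forall_in => /exists_inP[l].
rewrite !inE => /andP[lk lC]; rewrite -leqNgt => le; exists l => // z.
rewrite !inE => /orP[/eqP->|zs]; last by apply: leq_trans le _; apply: mu_le.
by apply: leq_trans le _; apply: ltnW; apply/aboveP: lC lk.
Qed.

(** If an index l was dropped, [mu] still maps the rest of C onto s, which by counting forces l to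
    be i or j. If a point x was added, the minimum map [nu] of x |: s is a bijection from C; as
    [mu i = mu j], it must take the value x at i or at j, and dominance makes x the largest point in
    the corresponding [above] set. *)
Let room_uniq1 i j p : i \in C -> j \in C -> i != j -> mu i = mu j ->
  is_room p -> door_of (s, C) p -> p = room i \/ p = room j.
Proof.
move=> iC jC ij mij; case: p => s' C' /andP[/= dm _] /orP[]/andP[/= /eqP].
  move=> e /exists_inP[l lC /eqP /= eC]; subst s' C'.
  have im := dom_im dm.
  suff lij : l = i \/ l = j.
    have sk : room l = (s, C :\ l).
      have [[_ ->]//|[x [/aboveP xk _ _]]] := roomP l.
      have /dominantP/(_ x)[k kC H] := dm.
      move: kC; rewrite !inE => /andP[kl kC].
      by have := xk k kC kl; rewrite ltnNge H.
    by case: lij sk => -> ->; [left|right].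
  have [->|li] := eqVneq l i; first by left.
  have [->|lj] := eqVneq l j; first by right.
  have : mu @: (C :\ l :\ i) = s.
    rewrite -[RHS]im; apply/eqP; rewrite eqEsubset; apply/andP; split.
      by apply: imsetS; apply: subsetDl.
    apply/subsetP => _ /imsetP[k kC ->]; have [ki|ki] := eqVneq k i.
      rewrite ki mij; apply: imset_f.
      by rewrite !inE jC (eq_sym j i) ij (eq_sym j l) lj.
    by apply: imset_f; rewrite 2!inE ki.
  move=> e; have := leq_imset_card mu (mem (C :\ l :\ i)); rewrite e => le.
  have := cardsD1 i (C :\ l); have := cardsD1 l C.
  rewrite lC cardC !inE iC eq_sym li /= add1n => -[<-] e2.
  by move: le; rewrite e2 add1n ltnn.
move=> e /existsP[x /andP[xs /eqP /= es]]; subst s' C'.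
pose nu l := if r l x < r l (mu l) then x else mu l.
have nu_eq l y : y \in x |: s -> (forall z, z \in x |: s -> r l y <= r l z) -> nu l = y.
  move=> yxs H; rewrite /nu; move: yxs; rewrite !inE => /orP[/eqP yx|ys].
    subst y; rewrite ltn_neqAle H ?inE ?mu_in ?orbT// andbT.
    case: eqP => // e; move: (mu_in l); rewrite -(r_inj e) => H2.
    by rewrite H2 in xs.
  rewrite ltnNge (_ : r l (mu l) <= r l x) /=; last first.
    by apply: leq_trans (mu_le _ ys) _; apply: H; rewrite !inE eqxx.
  by apply: mu_eq => // z zs; apply: H; rewrite !inE zs orbT.
have im : nu @: C = x |: s.
  apply/eqP; rewrite eqEsubset; apply/andP; split.
    apply/subsetP => _ /imsetP[k kC ->]; rewrite /nu; case: ifP => _.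
      by rewrite setU11.
    by rewrite inE mu_in orbT.
  apply/subsetP => y yxs; have /dominantP/(_ y)[l lC H] := dm.
  by apply/imsetP; exists l => //; rewrite (nu_eq l y).
have nu_inj : {in C &, injective nu}.
  by apply/imset_injP; rewrite im cardsU1 xs cardC.
suff main k : k \in C -> nu k = x -> (x |: s, C) = room k.
  have [ex|nex] := eqVneq (nu i) x; first by left; apply: main.
  right; apply: main => //; rewrite /nu; case: ifP => // nj; exfalso.
  move/eqP: ij; apply; apply: nu_inj => //; move: nex.
  by rewrite /nu nj; case: ifP => //; rewrite eqxx.
move=> kC nuk.
have xk : x \in above k.
  apply/aboveP => l lC lk; rewrite ltnNge; apply/negP => le.
  move/eqP: lk; apply; apply: nu_inj => //; rewrite nuk /nu ltn_neqAle le andbT.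
  case: eqP => // e; move: (mu_in l); rewrite -(r_inj e) => H2.
  by rewrite H2 in xs.
have [[/(_ x)]|[y [yk ymax ->]]] := roomP k; first by rewrite xk.
suff -> : x = y by [].
apply: (@r_inj k); apply/eqP; rewrite eqn_leq ymax //=.
have /dominantP/(_ y)[l lC H] := dm.
have [<-|lk] := eqVneq l k; first by apply: H; rewrite setU11.
move/aboveP: yk => /(_ l lC lk); rewrite ltnNge H //.
by rewrite inE mu_in orbT.
Qed.

Lemma card_rooms_of_door :
  #|[set p | is_room p && door_of (s, C) p]| = 2.
Proof.
have [i [j [iC jC ij mij]]] := mu_dup.
have im k l : k \in C -> l \in C -> k != l -> mu k = mu l -> mu @: (C :\ k) = s.
  move=> kC lC kl e; rewrite -[RHS](dom_im domC).
  apply/eqP; rewrite eqEsubset; apply/andP; split.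
    by apply: imsetS; apply: subsetDl.
  apply/subsetP => _ /imsetP[m mC ->]; have [mk|mk] := eqVneq m k.
    by rewrite mk e; apply: imset_f; rewrite !inE lC eq_sym kl.
  by apply: imset_f; rewrite 2!inE mk.
have imi := im i j iC jC ij mij.
have imj := im j i jC iC; rewrite eq_sym in imj; have {}imj := imj ij (esym mij).
suff -> : [set p | is_room p && door_of (s, C) p] = [set room i; room j].
  rewrite cards2; suff -> : room i != room j by [].
  have [[Hi ->]|[x [xi _ ->]]] := roomP i;
    have [[Hj ->]|[y [yj _ ->]]] := roomP j.
  - apply/eqP => -[] /setP/(_ i); rewrite !inE eqxx iC /= andbT => /esym.
    by rewrite ij.
  - apply/eqP => -[_] /setP/(_ i); rewrite !inE eqxx iC //.
  - apply/eqP => -[_] /setP/(_ j); rewrite !inE eqxx jC //.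
  apply/eqP => -[exy].
  have xy : x = y.
    have := setU11 x s; rewrite exy !inE => /orP[/eqP//|].
    by rewrite (negbTE (above_notin imi xi)).
  subst y; have /dominantP/(_ x)[l lC H] := domC.
  have : r l (mu l) < r l x.
    have [li|li] := eqVneq l i; last by move/aboveP: xi; apply.
    by move/aboveP: yj; apply => //; rewrite li.
  by rewrite ltnNge H.
apply/setP => p; rewrite !inE; apply/idP/idP.
  move=> /andP[rp dp]; have [->|->] := room_uniq1 iC jC ij mij rp dp.
    by rewrite eqxx.
  by rewrite eqxx orbT.
by move=> /orP[]/eqP->; apply: room_door.
Qed.
End Door.

(** With no point in s there is no minimum map. Dropping the only index destroys dominance, so the
    single room adds the [r i]-largest point of T. *)
Lemma card_rooms_of_outside_door (t0 : T) i :
  #|[set p | is_room p && door_of (set0, [set i]) p]| = 1.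
Proof.
pose m := [arg max_(x > t0) r i x].
suff -> : [set p | is_room p && door_of (set0, [set i]) p] = [set ([set m], [set i])].
  by rewrite cards1.
have mmax y : r i y <= r i m by rewrite /m; case: arg_maxnP => // x _; apply.
apply/setP => -[s C]; rewrite !inE; apply/idP/idP.
  move=> /andP[/andP[/dominantP /= dm /eqP card]] /orP[]/andP[/= /eqP e].
    move=> /exists_inP[j]; rewrite inE => /eqP -> /eqP eC; exfalso.
    have [k] := dm t0; rewrite eC !inE; by case: (k == i).
  move=> /existsP[x /andP[_]]; rewrite setU0 => /eqP e2; subst s C.
  have [k] := dm m; rewrite inE => /eqP -> H.
  suff -> : x = m by [].
  by apply: (@r_inj i); apply/eqP; rewrite eqn_leq mmax H ?inE.
move=> /eqP[-> ->]; rewrite /is_room /= !cards1 eqxx andbT /door_of /= eqxx /=.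
apply/andP; split; last first.
  by apply/orP; right; apply/existsP; exists m; rewrite inE /= setU0.
by apply/dominantP => y; exists i; rewrite ?inE // => x; rewrite inE => /eqP->.
Qed.

Variable c : T -> I.

Definition colourful (p : {set T} * {set I}) := c @: p.1 == p.2.

Definition typical (i0 : I) (d : {set T} * {set I}) :=
  [&& is_door d, i0 \in d.2 & c @: d.1 == d.2 :\ i0].

Lemma dominantS (s s' : {set T}) (C C' : {set I}) :
  s' \subset s -> C \subset C' -> dominant s C -> dominant s' C'.
Proof.
move=> /subsetP ss /subsetP CC /dominantP dm; apply/dominantP => y.
by have [i iC H] := dm y; exists i => [|x /ss]; [exact: CC|exact: H].
Qed.

(** Such a room has no typical door or exactly two. If the colours of s are C minus i0, two points
    share a colour and either of them may be dropped. If they are j |: C minus i0 with j outside C,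
    the colouring is injective on s, and the doors add the index j or drop the point coloured j. *)
Lemma odd_typical_doors i0 p : is_room p -> ~~ colourful p ->
  ~~ odd #|[set d | typical i0 d && door_of d p]|.
Proof.
case: p => s C /andP[/= dm /eqP card] /eqP /= ncol.
have doorsE d : typical i0 d && door_of d (s, C) <->
    (exists j, [/\ j \notin C, d = (s, j |: C), i0 \in j |: C &
               c @: s = (j |: C) :\ i0]) \/
    (exists x, [/\ x \in s, d = (s :\ x, C), i0 \in C &
               c @: (s :\ x) = C :\ i0]).
  case: d => t D; split.
    rewrite /typical /door_of /= => /andP[/and3P[_ i0D /eqP ct]].
    move=> /orP[/andP[/eqP st /exists_inP[j jD /eqP CD]]|].
      left; exists j; subst s C; rewrite setD1K//; split=> //.
      by rewrite !inE eqxx.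
    move=> /andP[/eqP CD /existsP[x /andP[xt /eqP st]]]; subst s C.
    by right; exists x; rewrite setU11 setU1K.
  rewrite /typical /door_of /is_door /=.
  case=> [[j [jC [-> ->] i0C /eqP cs]]|[x [xs [-> ->] i0C /eqP cs]]].
    rewrite (dominantS _ _ dm) ?subsetU1//= cardsU1 jC card i0C cs eqxx /=.
    rewrite eqxx/=; apply/orP; left; apply/exists_inP.
    by exists j; rewrite ?setU11// setU1K.
  rewrite (dominantS _ _ dm) ?subsetDl//= card i0C cs eqxx /=.
  have := cardsD1 x s; rewrite xs => ->; rewrite eqxx /=.
  by apply/orP; right; apply/existsP; exists x; rewrite setD1K // !inE eqxx /=.
have nodoor : (forall d, ~ (typical i0 d && door_of d (s, C))) ->
    ~~ odd #|[set d | typical i0 d && door_of d (s, C)]|.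
  move=> H; rewrite (_ : [set d | _] = set0) ?cards0//.
  by apply/setP => d; rewrite !inE; apply/negP/H.
have twodoors a b : a != b ->
    (forall d, typical i0 d && door_of d (s, C) <-> d = a \/ d = b) ->
    ~~ odd #|[set d | typical i0 d && door_of d (s, C)]|.
  move=> ab H; rewrite (_ : [set d | _] = [set a; b]) ?cards2 ?ab//.
  apply/setP => d; rewrite !inE; apply/idP/orP.
    by move=> /H[]->; rewrite eqxx; [left|right].
  by move=> E; apply/H; case: E => /eqP; [left|right].
have [i0C|i0C] := boolP (i0 \in C); last first.
  apply: nodoor => d /doorsE[[j [jC _ i0jC]]|[x []]]; last by rewrite (negPf i0C).
  move: i0jC; rewrite !inE (negPf i0C) orbF => /eqP <-.
  by rewrite setU1K.
have [e1|ne1] := eqVneq (c @: s) (C :\ i0).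
  have := cardsD1 i0 C; rewrite i0C -e1 card => /imset_drop_dup[x [y [xy E]]].
  have zE z : z \in s /\ c @: (s :\ z) = c @: s <-> z = x \/ z = y.
    have /setP/(_ z) := E; rewrite !inE => zE; split.
      by move=> [zs /eqP cz]; move: zE; rewrite zs cz => /esym/orP[]/eqP; [left|right].
    move=> H; have : (z == x) || (z == y) by case: H => ->; rewrite eqxx ?orbT.
    by rewrite -zE => /andP[? /eqP].
  have [xs _] : x \in s /\ _ := (zE x).2 (or_introl erefl).
  have [ys _] : y \in s /\ _ := (zE y).2 (or_intror erefl).
  apply: (twodoors (s :\ x, C) (s :\ y, C)).
    apply/eqP => -[] /setP/(_ x); rewrite !inE eqxx xs /= andbT => /esym.
    by rewrite xy.
  move=> d; split.
    move=> /doorsE[[j [jC _ _]]|[z [zs -> _]]].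
      rewrite e1 => /setP/(_ j); rewrite !inE eqxx (negPf jC) /= andbF andbT.
      by case: eqP => // ji0; move: jC; rewrite ji0 i0C.
    by rewrite -e1 => cz; have [->|->] := (zE z).1 (conj zs cz); [left|right].
  move=> dxy; apply/doorsE; right; have [z zxy ->] :
      exists2 z, z = x \/ z = y & d = (s :\ z, C).
    by case: dxy => ->; [exists x|exists y]; tauto.
  by have [zs cz] := (zE z).2 zxy; exists z; split=> //; rewrite cz.
have [/exists_inP[j]|ne2] := boolP [exists j in ~: C, c @: s == (j |: C) :\ i0];
    last first.
  apply: nodoor => d /doorsE[[j [jC _ _ e]]|[x [xs _ _ e]]].
    by move/negP: ne2; apply; apply/exists_inP; exists j; rewrite ?inE// e.
  have ecs : c @: s = c x |: (C :\ i0) by rewrite -e -imsetU1 setD1K.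
  have [cxC|cxC] := boolP (c x \in C).
    have [cxi|cxi] := eqVneq (c x) i0.
      by apply: ncol; rewrite ecs cxi setD1K.
    move/eqP: ne1; apply; rewrite ecs; apply/setUidPr; rewrite sub1set !inE.
    by rewrite cxi.
  move/negP: ne2; apply; apply/exists_inP; exists (c x); rewrite ?inE// ecs.
  apply/eqP/setP => k; rewrite !inE; case: (eqVneq k (c x)) => //= ->.
  by rewrite andbT; apply/esym; apply: contraNneq cxC => ->.
rewrite inE => jC /eqP e2.
have ji0 : j != i0 by apply: contraNneq jC => ->.
have cinj : {in s &, injective c}.
  apply/imset_injP; rewrite e2; have := cardsD1 i0 (j |: C).
  by rewrite cardsU1 jC !inE i0C orbT !add1n card => -[<-].
have : j \in c @: s by rewrite e2 !inE ji0 eqxx.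
move=> /imsetP[x xs jx].
have csx z : z \in s -> c @: (s :\ z) = (c @: s) :\ c z.
  move=> zs; apply/setP => k; rewrite !inE; apply/imsetP/andP.
    move=> [w]; rewrite !inE => /andP[wz ws] ->; split; last exact: imset_f.
    by apply: contraNneq wz => /cinj ->.
  move=> [kz /imsetP[w ws kw]]; exists w => //; rewrite !inE ws andbT.
  by apply: contraNneq kz => <-; rewrite kw.
apply: (twodoors (s, j |: C) (s :\ x, C)).
  apply/eqP => -[] /setP/(_ x); rewrite !inE eqxx xs //.
move=> d; split.
  move=> /doorsE[[k [kC -> _]]|[z [zs -> _]]].
    rewrite e2 => /setP/(_ j); rewrite !inE eqxx ji0 (negPf jC) /= orbF.
    by move=> /esym/eqP->; left.
  rewrite csx // e2 => /setP/(_ j); rewrite !inE eqxx ji0 (negPf jC) /=.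
  rewrite andbT => /negbFE/eqP; rewrite jx => /cinj ->//; by right.
case=> ->; apply/doorsE; [left|right].
  by exists j; rewrite !inE i0C orbT.
exists x; split=> //; rewrite csx // -jx e2; apply/setP => k; rewrite !inE.
by case: (eqVneq k j) => [->|//]; rewrite (negPf jC) andbF.
Qed.

(* Scarf: counting pairs (room, typical door) mod 2. *)
Theorem colourful_room (t0 : T) (i0 : I) : exists p, is_room p && colourful p.
Proof.
suff : ~~ [forall p, is_room p ==> ~~ colourful p].
  by rewrite negb_forall => /existsP[p]; rewrite negb_imply negbK; exists p.
apply/negP => /forallP nocol.
pose N := \sum_(p | is_room p) #|[set d | typical i0 d && door_of d p]|.
have : ~~ odd N.
  rewrite /N; elim/big_ind: _ => // [m n|p rp].
    by rewrite oddD; case: odd => //; case: odd.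
  by apply: odd_typical_doors => //; apply: (implyP (nocol p)).
have -> : N = \sum_(d | typical i0 d) #|[set p | is_room p && door_of d p]|.
  under eq_bigr do rewrite -sum1_card.
  rewrite /N; under eq_bigr do rewrite -sum1_card.
  have E1 p : is_room p -> \sum_(d in [set d | typical i0 d && door_of d p]) 1 =
      \sum_(d | typical i0 d) (door_of d p : nat).
    move=> _; rewrite big_mkcond [RHS]big_mkcond; apply: eq_bigr => d _.
    by rewrite inE; case: typical; case: door_of.
  have E2 d : typical i0 d -> \sum_(p in [set p | is_room p && door_of d p]) 1 =
      \sum_(p | is_room p) (door_of d p : nat).
    move=> _; rewrite big_mkcond [RHS]big_mkcond; apply: eq_bigr => p _.
    by rewrite inE; case: is_room; case: door_of.
  by rewrite (eq_bigr _ E1) (eq_bigr _ E2) exchange_big.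
have typ0 : typical i0 (set0, [set i0]).
  rewrite /typical /is_door /= cards1 cards0 eqxx andbT inE eqxx imset0.
  rewrite setDv eqxx andbT andbT; apply/dominantP => y.
  by exists i0; rewrite ?inE // => x; rewrite inE.
(* The outside door counts once. Every other typical door counts twice, because its s is nonempty:
   an empty s would force C = {i0}. *)
rewrite (bigD1 _ typ0) /= card_rooms_of_outside_door // oddD /= negbK.
apply/negP; elim/big_ind: _ => // [m n|[s C] /andP[td ne0]].
  by rewrite oddD; case: odd => //; case: odd.
have /and3P[dd i0C /eqP cs] := td; rewrite /= in i0C cs.
have [s0|/set0Pn[x xs]] := eqVneq s set0; last by rewrite (card_rooms_of_door xs dd).
exfalso; move/eqP: ne0; apply; congr pair => //.
rewrite s0 imset0 in cs; apply/eqP; rewrite eqEsubset sub1set i0C andbT.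
by rewrite -setD_eq0 -cs.
Qed.

End Scarf.

(* The grid points of the simplex {t >= 0, sum t = p}, ordered by each coordinate
   (ties broken by enumeration rank), form an instance of Scarf's theorem. *)
Lemma simplex_grid_colouring (I : finType) (i0 : I) (p : nat) (c : (I -> nat) -> I) :
  exists2 w : I -> nat, \sum_i w i = p & forall i, w i <= #|I| \/
    exists y : I -> nat, [/\ \sum_i y i = p, c y = i &
      forall k, w k <= y k + #|I| /\ y k <= w k + #|I|].
Proof.
pose T : finType := {t : {ffun I -> 'I_p.+1} | \sum_i (t i : nat) == p}.
pose co (t : T) i : nat := val t i.
have co_sum t : \sum_i co t i = p by apply/eqP; exact: (valP t).
pose N := #|T|.
pose r i (t : T) := co t i * N + enum_rank t.
have r_inj i : injective (r i).
  move=> s t; rewrite /r => e.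
  have : (co s i * N + enum_rank s) %% N = (co t i * N + enum_rank t) %% N by rewrite e.
  by rewrite !modnMDl !modn_small ?ltn_ord // => /val_inj/enum_rank_inj.
have r_le i s t : r i s <= r i t -> co s i <= co t i.
  rewrite leqNgt [in X in _ -> X]leqNgt; apply: contra => lt.
  apply: (@leq_trans ((co t i).+1 * N)).
    by rewrite /r mulSn addnC ltn_add2r ltn_ord.
  by rewrite /r; apply: leq_trans (leq_addr _ _); rewrite leq_mul2r lt orbT.
have mk (y : I -> nat) : \sum_i y i = p -> exists t : T, forall i, co t i = y i.
  move=> sy; have yp i : y i < p.+1 by rewrite ltnS -sy (bigD1 i) //= leq_addr.
  have ok : \sum_i ([ffun i => Ordinal (yp i)] i : nat) == p.
    by rewrite -[X in _ == X]sy; apply/eqP; apply: eq_bigr => i _; rewrite ffunE.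
  pose t : {t : {ffun I -> 'I_p.+1} | \sum_i (t i : nat) == p} :=
    exist (fun t : {ffun I -> 'I_p.+1} => \sum_i (t i : nat) == p) _ ok.
  by exists t => i; rewrite /co /= ffunE.
have [t0 _] : exists t : T, forall i, co t i = (if i == i0 then p else 0).
  by apply: mk; rewrite -big_mkcond big_pred1_eq.
have [[s C] /andP[/andP[/dominantP /= dm _] /eqP /= col]] :=
  colourful_room r_inj (fun t : T => c (co t)) t0 i0.
have [i1 i1C _] := dm t0.
have : i1 \in (fun t : T => c (co t)) @: s by rewrite col.
move=> /imsetP[t1 t1s _].
pose m i := co [arg min_(t < t1 in s) co t i] i.
have m_le i t : t \in s -> m i <= co t i.
  by rewrite /m; case: arg_minnP => // u _ H /H.
have m_in i : exists2 t, t \in s & m i = co t i.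
  by rewrite /m; case: arg_minnP => // u us _; exists u.
(* Otherwise some grid point would exceed the minimum [m i] strictly for all i in C, against
   dominance. *)
have sumC : p < \sum_(i in C) (m i).+1.
  rewrite ltnNge; apply/negP => le.
  have [y yE] : exists t : T, forall i, co t i =
      (if i \in C then (m i).+1 else 0) +
      (if i == i1 then p - \sum_(i in C) (m i).+1 else 0).
    by apply: mk; rewrite big_split /= -!big_mkcond /= big_pred1_eq subnKC.
  have [i iC H] := dm y; have [t ts mt] := m_in i.
  have := r_le _ _ _ (H t ts); rewrite yE iC -mt.
  by rewrite leqNgt ltnS leq_addr.
(* The minima over C already sum to more than p - #|C|, so a point of s has at most #|I| left to
   distribute above them. Hence the points of s are close to each other, and coordinates outside C
   are at most #|I|. *)
have far t : t \in s -> forall i, co t i <= (if i \in C then m i else 0) + #|I|.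
  move=> ts i; rewrite -(leq_add2r (\sum_(j | j != i) co t j)).
  rewrite -[X in X <= _](_ : \sum_j co t j = _); last by rewrite (bigD1 i).
  rewrite co_sum addnAC.
  have : \sum_(j in C) (m j).+1 <= \sum_j (if j \in C then m j else 0) + #|I|.
    under eq_bigr do rewrite -addn1.
    by rewrite big_split /= sum1_card -big_mkcond leq_add2l max_card.
  move=> le; apply: leq_trans (ltnW sumC) (leq_trans le _).
  rewrite leq_add2r (bigD1 i) //= leq_add2l; apply: leq_sum => j _.
  by case: ifP => // _; apply: m_le.
exists (co t1) => // i; have [iC|iC] := boolP (i \in C); last first.
  by left; have := far _ t1s i; rewrite (negPf iC).
right; move: (iC); rewrite -col => /imsetP[t ts it]; exists (co t); split=> // k.
have := far _ t1s k; have := far _ ts k; case: ifP => kC A1 A2.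
  by split; [apply: leq_trans A2 _|apply: leq_trans A1 _]; rewrite leq_add2r m_le.
by split; [apply: leq_trans A2 _|apply: leq_trans A1 _]; rewrite leq_add2r.
Qed.

From mathcomp Require Import all_order all_algebra.
From mathcomp Require Import all_classical all_reals all_analysis.
From mathcomp Require Import measurable_realfun.
From mathcomp Require Import ring lra zify.
Import Order.TTheory GRing.Theory Num.Theory numFieldNormedType.Exports.
Local Open Scope classical_set_scope.
Local Open Scope ring_scope.

(** * Brouwer's theorem and variational inequalities *)

Section Brouwer.
Variable R : realType.

Lemma compact_seq_cluster (X : topologicalType) (K : set X) (u : nat -> X) :
  compact K -> (forall n, K (u n)) ->
  exists2 x, K x & forall V N, nbhs x V -> exists2 n, (N <= n)%N & V (u n).
Proof.
move=> cK Ku.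
have uK : (u @ \oo) K by exists 0%N => // n _; exact: Ku.
have [x [Kx cx]] := cK (u @ \oo) _ uK.
exists x => // V N Vx.
have [||y [[n /= Nn <-] Vun]] := cx [set u n | n in [set n | (N <= n)%N]] V => //.
  by exists N => // n Nn; exists n.
by exists n.
Qed.

Lemma near_rV n (x : 'rV[R]_n) (V : set 'rV[R]_n) : nbhs x V ->
  exists2 e : R, 0 < e & forall y : 'rV[R]_n, (forall i, `|x 0 i - y 0 i| < e) -> V y.
Proof.
move=> /nbhs_ballP[e /= e0 H]; exists e => // y xy; apply: H; split=> // i j.
by rewrite (ord1 i); apply: xy.
Qed.

Lemma continuous_sumr (X : topologicalType) (I : Type) (r : seq I) (P : pred I)
    (F : I -> X -> R) : (forall i, continuous (F i)) ->
  continuous (fun x => \sum_(i <- r | P i) F i x).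
Proof.
move=> cF; elim: r => [|i r IH] x.
  by under eq_fun do rewrite big_nil; exact: cvg_cst.
under eq_fun do rewrite big_cons; case: (P i); last exact: IH.
by apply: cvgD; [exact: cF|exact: IH].
Qed.

(* Brouwer: the box containing the range of f is embedded in a simplex; a grid point t
   receives as colour a coordinate that f does not decrease. *)
Theorem bounded_fixpoint n (f : 'rV[R]_n -> 'rV[R]_n) (B : R) :
  continuous f -> (forall x i, `|f x 0 i| <= B) -> exists x, f x = x.
Proof.
move=> cf fB.
have [n0|n_gt0] := posnP n; first by subst n; exists 0; rewrite [LHS]thinmx0.
have B0 : 0 <= B by apply: le_trans (fB 0 (Ordinal n_gt0)).
(* The simplex is {x_i >= -B, sum (x_i + B) <= c}, and the coordinate [None] of a grid point is the
   slack of the last inequality. With this c, the points of zero slack have sum x_i = n B + 1,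
   beyond any value of sum f_i. *)
have [c cE] : {c : R | c = 2 * n%:R * B + 1} by exists (2 * n%:R * B + 1).
have c0 : 0 < c by rewrite cE ltr_pwDr// !mulr_ge0.
pose X (p : nat) (w : option 'I_n -> nat) : 'rV[R]_n :=
  \row_i (c * (w (Some i))%:R / p.+1%:R - B).
pose col p w : option 'I_n :=
  omap id [pick i | X p w 0 i <= f (X p w) 0 i].
have colS p w i : col p w = Some i -> X p w 0 i <= f (X p w) 0 i.
  by rewrite /col; case: pickP => //= j H [<-].
have colN p w : col p w = None -> \sum_i f (X p w) 0 i <= \sum_i X p w 0 i.
  rewrite /col; case: pickP => //= H _; apply: ler_sum => i _.
  by rewrite ltW// ltNge H.
have /choice[w Hw] : forall p, exists w : option 'I_n -> nat,
    (\sum_i w i = p.+1)%N /\ forall i, (w i <= n.+1)%N \/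
    exists y : option 'I_n -> nat, [/\ (\sum_i y i = p.+1)%N, col p y = i &
      forall k, (w k <= y k + n.+1)%N /\ (y k <= w k + n.+1)%N].
  move=> p; have [w sw H] := simplex_grid_colouring None p.+1 (col p).
  by exists w; split=> // i; move: (H i); rewrite card_option card_ord.
pose K := [set v : 'rV[R]_n | forall i, `[- B, c - B]%classic (v ord0 i)].
have cK : compact K by exact: (@rV_compact R n (fun=> `[- B, c - B]%classic)
    (fun=> @segment_compact _ _ _)).
have wp p i : (w p i <= p.+1)%N by rewrite -(Hw p).1 (bigD1 i)//= leq_addr.
have [|x Kx clx] := @compact_seq_cluster _ K (fun p => X p (w p)) cK.
  move=> p i; rewrite /= mxE in_itv /=.
  rewrite lerBrDl subrr divr_ge0 ?mulr_ge0//= ?(ltW c0)//.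
  rewrite lerD2r -mulrA ger_pMr// ler_pdivrMr// mul1r ler_nat; exact: wp.
have large (e : R) : 0 < e -> exists N, forall p, (N <= p)%N -> c * n.+1%:R / p.+1%:R < e.
  move=> e0; exists (Num.truncn (c * n.+1%:R / e)) => p Np.
  rewrite ltr_pdivrMr// (mulrC e) -ltr_pdivrMr//.
  by apply: lt_le_trans (truncnS_gt _) _; rewrite ler_nat ltnS.
have Xclose p y : (forall k, (w p k <= y k + n.+1)%N /\ (y k <= w p k + n.+1)%N) ->
    forall i, `|X p (w p) 0 i - X p y 0 i| <= c * n.+1%:R / p.+1%:R.
  move=> H i; rewrite !mxE.
  rewrite (_ : _ - _ = c * ((w p (Some i))%:R - (y (Some i))%:R) / p.+1%:R); last by ring.
  rewrite !normrM (gtr0_norm c0) (@ger0_norm _ p.+1%:R^-1)//.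
  rewrite ler_pM2r ?invr_gt0// ler_pM2l//.
  have [] := H (Some i); rewrite -(ler_nat R) natrD => A1.
  by rewrite -(ler_nat R) natrD => A2; rewrite ler_norml; lra.
have fi (i : 'I_n) : continuous (fun v => f v 0 i).
  move=> v; apply: (@continuous_comp _ _ _ f (fun u : 'rV[R]_n => u 0 i)).
    exact: cf.
  exact: coord_continuous.
have ixi (i : 'I_n) : continuous (fun v : 'rV[R]_n => v 0 i).
  by move=> v; exact: coord_continuous.
(* If g is positive at the cluster point but nonpositive at all points of colour i, then no
   neighbouring grid point has colour i, and the grid colouring leaves only the alternative that the
   i-th coordinate is small. It is used with g = x_i - f_i for a coordinate and g = sum f_i - sum
   x_i for the slack. *)
have main (i : option 'I_n) (g : 'rV[R]_n -> R) : continuous g ->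
    0 < g x -> (forall p y, (\sum_i y i = p.+1)%N -> col p y = i -> g (X p y) <= 0) ->
    forall d N, 0 < d -> exists p, [/\ (N <= p)%N, (w p i <= n.+1)%N &
      forall j, `|x 0 j - X p (w p) 0 j| < d] .
  move=> cg gx Hg d N d0; have /near_rV[e e0 He] : nbhs x [set z | 0 < g z].
    exact: (cvgr_gt (g x) (cg x) 0 gx).
  have [N' HN'] := large (e / 2) (divr_gt0 e0 (ltr0Sn _ 1)).
  have m0 : 0 < Num.min d (e / 2) by rewrite lt_min d0 divr_gt0.
  have [|p Np xp] := clx (ball x (Num.min d (e / 2))) (maxn N N').
    exact: nbhsx_ballx.
  have {}xp j : `|x 0 j - X p (w p) 0 j| < Num.min d (e / 2) by have [_] := xp; apply.
  exists p; split; first exact: leq_trans (leq_maxl _ _) Np.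
    have [//|[y [sy cy Hy]]] := (Hw p).2 i.
    have := Hg p y sy cy; rewrite leNgt He// => j.
    apply: le_lt_trans (ler_distD (X p (w p) 0 j) _ _) _; rewrite [e]splitr.
    apply: ltrD; first by have := xp j; rewrite lt_min => /andP[].
    apply: le_lt_trans (Xclose p y Hy j) _.
    by apply: HN'; exact: leq_trans (leq_maxr _ _) Np.
  by move=> j; have := xp j; rewrite lt_min => /andP[].
have ge_i i : x 0 i <= f x 0 i.
  rewrite leNgt; apply/negP => lt.
  have xB : 0 < (x 0 i + B) / 2 by have := fB x i; rewrite ler_norml; lra.
  have [N HN] := large _ xB.
  have [|||p [Np wi xX]] := main (Some i) (fun z => z 0 i - f z 0 i) _ _ _ _ N xB.
  - by move=> z; apply: continuousB; [exact: ixi|exact: fi].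
  - by rewrite subr_gt0.
  - by move=> p y _ /colS; rewrite subr_le0.
  have := HN p Np; have := xX i; rewrite mxE ltr_norml => /andP[_].
  have : c * (w p (Some i))%:R / p.+1%:R <= c * n.+1%:R / p.+1%:R.
    by rewrite ler_pM2r ?invr_gt0// ler_pM2l// ler_nat.
  move: (c * (w _ _)%:R / _) (c * n.+1%:R / _) => u v; lra.
have cvs (h : 'rV[R]_n -> 'rV[R]_n) : (forall i, continuous (fun z => h z 0 i)) ->
    continuous (fun z => \sum_i h z 0 i).
  by move=> ch; exact: continuous_sumr.
have le_s : \sum_i f x 0 i <= \sum_i x 0 i.
  rewrite leNgt; apply/negP => lt.
  have d0 : 0 < (2 * n%:R)^-1 :> R by rewrite invr_gt0 mulr_gt0// ltr0n.
  have [N HN] := large (1 / 2) (divr_gt0 ltr01 (ltr0Sn _ 1)).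
  have [|||p [Np wN xX]] :=
    main None (fun z => \sum_i f z 0 i - \sum_i z 0 i) _ _ _ _ N d0.
  - by move=> z; apply: continuousB; exact: cvs.
  - by rewrite subr_gt0.
  - by move=> p y _ /colN; rewrite subr_le0.
  have := HN p Np.
  have : \sum_i f x 0 i <= n%:R * B.
    apply: (@le_trans _ _ (\sum_(i < n) B)); last by rewrite sumr_const card_ord mulr_natl.
    by apply: ler_sum => i _; apply: le_trans (ler_norm _) (fB _ _).
  have : \sum_i X p (w p) 0 i - 1 / 2 <= \sum_i x 0 i.
    apply: (@le_trans _ _ (\sum_i (X p (w p) 0 i - (2 * n%:R)^-1))); last first.
      by apply: ler_sum => i _; have := xX i; rewrite ltr_norml; lra.
    rewrite sumrB lerD2l lerN2 sumr_const card_ord.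
    rewrite (_ : (2 * n%:R)^-1 *+ n = 1 / 2 :> R)// -mulr_natr; field.
    by rewrite pnatr_eq0 -lt0n.
  have -> : \sum_i X p (w p) 0 i =
      c * (p.+1%:R - (w p None)%:R) / p.+1%:R - n%:R * B.
    under eq_bigr do rewrite mxE.
    rewrite sumrB sumr_const card_ord mulr_natl -mulr_suml -mulr_sumr.
    congr (_ * _ / _ - _); rewrite -[in RHS](Hw p).1 natr_sum.
    rewrite (bigD1 None)//= addrC addrK (reindex_onto Some (odflt (Ordinal n_gt0))).
      by apply: eq_big => // i; rewrite eqxx.
    by case.
  rewrite mulrBr mulrBl mulfK ?pnatr_eq0//.
  have : c * (w p None)%:R / p.+1%:R <= c * n.+1%:R / p.+1%:R.
    by rewrite ler_pM2r ?invr_gt0// ler_pM2l// ler_nat.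
  rewrite cE; move: (_ * (w _ _)%:R / _) (_ * n.+1%:R / _) => u v.
  rewrite -!mulrA; move: (n%:R * B) => nB; lra.
exists x; apply/rowP => i; apply/eqP; rewrite eq_le ge_i andbT.
rewrite -subr_le0 -[leLHS]addr0.
apply: le_trans (_ : \sum_i (f x 0 i - x 0 i) <= 0); last by rewrite sumrB subr_le0.
rewrite (bigD1 i)//= lerD2l sumr_ge0// => j _; by rewrite subr_ge0.
Qed.

End Brouwer.

Section VI.
Variable R : realType.

Definition ip n (x y : 'rV[R]_n) : R := \sum_i x 0 i * y 0 i.

Lemma ipDl n (x y z : 'rV[R]_n) : ip (x + y) z = ip x z + ip y z.
Proof. by rewrite -big_split; apply: eq_bigr => i _; rewrite mxE mulrDl. Qed.

Lemma ipC n (x y : 'rV[R]_n) : ip x y = ip y x.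
Proof. by apply: eq_bigr => i _; rewrite mulrC. Qed.

Lemma ipZl n a (x y : 'rV[R]_n) : ip (a *: x) y = a * ip x y.
Proof. by rewrite mulr_sumr; apply: eq_bigr => i _; rewrite mxE mulrA. Qed.

Lemma ipNl n (x y : 'rV[R]_n) : ip (- x) y = - ip x y.
Proof. by rewrite -scaleN1r ipZl mulN1r. Qed.

Lemma ipDr n (x y z : 'rV[R]_n) : ip x (y + z) = ip x y + ip x z.
Proof. by rewrite ipC ipDl !(ipC x). Qed.

Lemma ipZr n a (x y : 'rV[R]_n) : ip x (a *: y) = a * ip x y.
Proof. by rewrite ipC ipZl ipC. Qed.

Lemma ipNr n (x y : 'rV[R]_n) : ip x (- y) = - ip x y.
Proof. by rewrite ipC ipNl ipC. Qed.

Lemma ip_ge_sqr n (x : 'rV[R]_n) i : x 0 i ^+ 2 <= ip x x.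
Proof.
rewrite /ip (bigD1 i)//= expr2 lerDl sumr_ge0// => j _; exact: sqr_ge0.
Qed.

Lemma ip_ge0 n (x : 'rV[R]_n) : 0 <= ip x x.
Proof. by apply: sumr_ge0 => j _; exact: sqr_ge0. Qed.

Lemma ip_eq0 n (x : 'rV[R]_n) : ip x x <= 0 -> x = 0.
Proof.
move=> H; apply/rowP => i; rewrite mxE; apply/eqP.
by rewrite -sqrf_eq0 eq_le sqr_ge0 andbT (le_trans (ip_ge_sqr _ _)).
Qed.

Lemma continuous_ip_sqr n (x : 'rV[R]_n) : continuous (fun y : 'rV[R]_n => ip (y - x) (y - x)).
Proof.
apply: continuous_sumr => i y.
have cc : continuous (fun y : 'rV[R]_n => (y - x) 0 i).
  rewrite (_ : (fun y => _) = fun y : 'rV[R]_n => y 0 i - x 0 i).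
    by move=> z; apply: continuousB; [exact: coord_continuous|exact: cst_continuous].
  by apply/funext => z; rewrite !mxE.
by apply: continuousM; exact: cc.
Qed.

Lemma linear_part_ge0 (a b : R) :
  (forall t, 0 < t -> t <= 1 -> 0 <= t * a + t ^+ 2 * b) -> 0 <= a.
Proof.
move=> H; rewrite leNgt; apply/negP => a0.
have b0 : 0 < b by have := H 1 ltr01 (lexx _); lra.
have t0 : 0 < Num.min 1 (- a / (2 * b)).
  by rewrite lt_min ltr01 divr_gt0 ?oppr_gt0 ?mulr_gt0.
have t1 : Num.min 1 (- a / (2 * b)) <= 1 by rewrite ge_min lexx.
have t2 : Num.min 1 (- a / (2 * b)) <= - a / (2 * b) by rewrite ge_min lexx orbT.
have := H _ t0 t1; move: t0 t1 t2; set t := Num.min _ _ => t0 _ t2.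
rewrite expr2 -mulrA -mulrDr pmulr_rge0//.
have : t * b <= - a / 2.
  rewrite -ler_pdivlMr//; apply: le_trans t2 _; rewrite invfM mulrA//.
lra.
Qed.

Section VariationalInequality.
Variables (n : nat) (K : set 'rV[R]_n) (B : R).
Hypotheses (K0 : K !=set0) (Kclosed : closed K)
  (Kbounded : forall x i, K x -> `|x 0 i| <= B)
  (Kconvex : forall x y t, K x -> K y -> 0 < t -> t <= 1 -> K (x + t *: (y - x))).

Let Kcompact : compact K.
Proof.
apply: (@subclosed_compact _ K [set v : 'rV[R]_n | forall i, `[- B, B]%classic (v ord0 i)]) => //.
  exact: (@rV_compact R n (fun=> `[- B, B]%classic) (fun=> @segment_compact _ _ _)).
by move=> x Kx i; rewrite /= in_itv /= -ler_norml; exact: Kbounded.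
Qed.

Lemma convex_projection (x : 'rV[R]_n) :
  exists2 p, K p & forall y, K y -> ip (x - p) (y - p) <= 0.
Proof.
have [|p] := @compact_EVT_min _ R (fun y : 'rV[R]_n => ip (y - x) (y - x)) K K0 Kcompact.
  by apply: continuous_subspaceT; exact: continuous_ip_sqr.
rewrite inE => Kp pmin; exists p => // y Ky.
suff : 0 <= 2 * ip (p - x) (y - p) by rewrite -[x - p]opprB ipNl; lra.
apply: (@linear_part_ge0 _ (ip (y - p) (y - p))) => t t0 t1.
have := pmin (p + t *: (y - p)); rewrite inE => /(_ (Kconvex Kp Ky t0 t1)).
rewrite (_ : p + t *: (y - p) - x = (p - x) + t *: (y - p)); last first.
  by rewrite addrAC.
rewrite !(ipDl, ipDr, ipZl, ipZr, ipNl, ipNr).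
rewrite (ipC y p) (ipC y x) (ipC p x).
move: (ip x x) (ip p p) (ip y y) (ip p y) (ip x p) (ip x y) => *.
lra.
Qed.

(* Hartman-Stampacchia: a fixed point of x |-> proj (proj x - F (proj x)). *)
Theorem variational_inequality (F : 'rV[R]_n -> 'rV[R]_n) :
  (forall x i e, K x -> 0 < e -> exists2 d : R, 0 < d & forall y, K y ->
     (forall j, `|x 0 j - y 0 j| < d) -> `|F x 0 i - F y 0 i| < e) ->
  exists2 x, K x & forall y, K y -> 0 <= ip (F x) (y - x).
Proof.
move=> cF; have /choice[P HP] : forall x : 'rV[R]_n, exists p, K p /\ forall y, K y ->
    ip (x - p) (y - p) <= 0.
  by move=> x; have [p Kp Hp] := convex_projection x; exists p.
have Pcontr (x y : 'rV[R]_n) : ip (P x - P y) (P x - P y) <= ip (x - y) (x - y).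
  have [Kx /(_ _ (HP y).1)] := HP x; have [Ky /(_ _ (HP x).1)] := HP y.
  have := ip_ge0 ((x - y) - (P x - P y)).
  move: (P x) (P y) => p q; rewrite !(ipDl, ipDr, ipZl, ipZr, ipNl, ipNr).
  rewrite (ipC y x) (ipC p x) (ipC q x) (ipC p y) (ipC q y) (ipC q p).
  move: (ip x x) (ip y y) (ip p p) (ip q q) (ip x y) (ip x p) (ip x q) (ip y p)
    (ip y q) (ip p q) => *; lra.
have Pclose (x : 'rV[R]_n) (e : R) : 0 < e ->
    nbhs x [set y : 'rV[R]_n | forall i, `|P x 0 i - P y 0 i| < e].
  move=> e0; have := cvgr_lt _ (@continuous_ip_sqr _ x x) (e ^+ 2).
  rewrite subrr {1}/ip big1; last by move=> i _; rewrite mxE mul0r.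
  move=> /(_ _ (exprn_gt0 _ e0)); apply: filterS => y lt i.
  rewrite -(@ltr_pXn2r _ 2)// ?nnegrE ?(ltW e0)// real_normK ?num_real//.
  apply: le_lt_trans lt; apply: le_trans (Pcontr y x).
  have := ip_ge_sqr (P y - P x) i; rewrite !mxE.
  by rewrite -sqrrN opprB.
pose f (x : 'rV[R]_n) := P (P x - F (P x)).
have f_near (x : 'rV[R]_n) (e : R) : 0 < e -> \forall y \near x, ball (f x) e (f y).
  move=> e0; have /near_rV[d d0 Hd] := Pclose (P x - F (P x)) e e0.
  have near_i i : nbhs x [set y : 'rV[R]_n |
      `|(P x - F (P x)) 0 i - (P y - F (P y)) 0 i| < d].
    have [d' d'0 Hd'] := cF (P x) i (d / 2) (HP x).1 (divr_gt0 d0 (ltr0Sn _ 1)).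
    have N1 := Pclose x _ d'0.
    have N2 := Pclose x (d / 2) (divr_gt0 d0 (ltr0Sn _ 1)).
    apply: filterS2 N1 N2 => y /(Hd' _ (HP y).1) A1 /(_ i) A2; rewrite /= !mxE.
    rewrite (_ : _ - _ = (P x 0 i - P y 0 i) - (F (P x) 0 i - F (P y) 0 i)); last by ring.
    by rewrite [d]splitr (le_lt_trans (ler_normB _ _))// ltrD.
  have := @filter_forall _ _ _ _ (nbhs_filter x) near_i.
  apply: filterS => y H.
  by split=> // i j; rewrite (ord1 i); exact: (Hd _ H j).
have cf : continuous f.
  move=> x V /nbhs_ballP[e /= e0 HV].
  by apply: filterS (f_near x e e0) => y; exact: HV.
have [x fx] := bounded_fixpoint cf (fun x i => Kbounded i (HP _).1).
have Kx : K x by rewrite -fx; exact: (HP _).1.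
have Px : P x = x.
  by apply/esym/eqP; rewrite -subr_eq0; apply/eqP/ip_eq0/(HP x).2.
exists x => // y Ky; have := (HP (P x - F (P x))).2 y Ky.
by rewrite (_ : P (P x - F (P x)) = x)// Px addrAC subrr add0r ipNl oppr_le0.
Qed.
End VariationalInequality.
End VI.

(** * Integration over the unit cube *)

Import HBNNSimple.

Section TupleMeasure.
Variable R : realType.
Local Notation MR := (measurableTypeR R).
Local Notation mu d := (lebesgue_tuple R d).

(** Neither f nor g is assumed measurable. The integral is a supremum over simple functions, and a
    simple function below f, set to zero on N, is below g and has the same integral. *)
Lemma integral_null_eq (disp : measure_display) (T : measurableType disp)
    (m : {measure set T -> \bar R}) (D N : set T) (f g : T -> \bar R) :
  measurable N -> m N = 0%E -> (forall x, D x -> ~ N x -> f x = g x) ->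
  (\int[m]_(x in D) f x = \int[m]_(x in D) g x)%E.
Proof.
have le (F G : T -> \bar R) : measurable N -> m N = 0%E ->
    (forall x, (0 <= G x)%E) -> (forall x, ~ N x -> F x = G x) ->
    (ereal_sup [set sintegral m h | h in [set h : {nnsfun T >-> R} | forall x, ((h x)%:E <= F x)%E]]
    <= ereal_sup [set sintegral m h | h in [set h : {nnsfun T >-> R} | forall x,
        ((h x)%:E <= G x)%E]])%E.
  move=> mN N0 G0 FG; apply: ge_ereal_sup => _ [h hF <-].
  apply: ereal_sup_ubound; exists (mul_nnsfun h (indic_nnsfun R (measurableC mN))).
    move=> x /=; rewrite mindicE; have [Nx|Nx] := pselect (N x).
      by rewrite memNset ?mulr0//= => -[].
    by rewrite mem_set// mulr1 -FG.
  rewrite -!integralT_nnsfun; apply: ge0_ae_eq_integral => //.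
  - by apply/measurable_EFinP.
  - by apply/measurable_EFinP.
  - by move=> x _; rewrite lee_fin mulr_ge0.
  - by move=> x _; rewrite lee_fin.
  exists N; split=> // x /= /not_implyP[_ H]; apply: contrapT => Nx; apply: H.
  by rewrite mindicE mem_set// mulr1.
move=> mN N0 fg.
have fgN x : ~ N x -> (f \_ D) x = (g \_ D) x.
  by move=> Nx; rewrite /patch; case: ifP => // /set_mem Dx; exact: fg.
rewrite /integral /=; congr (_ - _)%E; apply/eqP; rewrite eq_le.
  by apply/andP; split; apply: le => // x Nx; rewrite !funeposE fgN.
by apply/andP; split; apply: le => // x Nx; rewrite !funenegE fgN.
Qed.

Lemma bigcup_countType_measurable (disp : measure_display) (T : measurableType disp)
    (K : countType) (F : K -> set T) :
  (forall k, measurable (F k)) -> measurable (\bigcup_k F k).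
Proof.
move=> mF; rewrite (_ : \bigcup_k F k = \bigcup_n oapp F set0 (unpickle n)).
  by apply: bigcup_measurable => n _; case: unpickle => //= k.
apply/seteqP; split=> x [k _ Fx].
  by exists (pickle k) => //; rewrite pickleK.
by move: Fx; case: unpickle => //= l Fl; exists l.
Qed.

Lemma bigcup_countType_null (disp : measure_display) (T : measurableType disp)
    (m : {measure set T -> \bar R}) (K : countType) (F : K -> set T) :
  (forall k, measurable (F k)) -> (forall k, m (F k) = 0%E) -> m (\bigcup_k F k) = 0%E.
Proof.
move=> mF F0; rewrite (_ : \bigcup_k F k = \bigcup_n oapp F set0 (unpickle n)).
  pose G n := oapp F set0 (unpickle n).
  have mG n : measurable (G n) by rewrite /G; case: unpickle => //= k.
  have G0 n : m (G n) = 0%E by rewrite /G; case: unpickle => //= k.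
  apply/eqP; rewrite -measure_le0.
  have mU : measurable (\bigcup_n G n) by apply: bigcup_measurable.
  have := measure_sigma_subadditive m mG mU (@subset_refl _ _).
  by rewrite eseries0// => n _ _; exact: G0.
apply/seteqP; split=> x [k _ Fx].
  by exists (pickle k) => //; rewrite pickleK.
by move: Fx; case: unpickle => //= l Fl; exists l.
Qed.

Definition box d (a : 'I_d -> R) (s : R) : set (d.-tuple MR) :=
  [set t | forall i, a i <= tnth t i < a i + s].

Lemma measurable_box d (a : 'I_d -> R) s : measurable (box a s).
Proof.
rewrite (_ : box a s = \bigcap_(i in [set: 'I_d])
    ((fun t : d.-tuple MR => tnth t i) @^-1` `[a i, a i + s[%classic)).
  apply: fin_bigcap_measurable => // i _.
  by rewrite -[X in measurable X]setTI; apply: measurable_tnth.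
apply/seteqP; split=> t H i; first by move=> _; rewrite /= in_itv /=; exact: H.
by have := H i I; rewrite /= in_itv.
Qed.

Lemma tnth_tuple_cons d (p : MR * d.-tuple MR) i :
  tnth (tuple_cons p) i = if unlift ord0 i is Some j then tnth p.2 j else p.1.
Proof.
by case: unliftP => [j|] ->; rewrite /tuple_cons ?tnthS ?tnth0.
Qed.

Lemma lebesgue_box d (a : 'I_d -> R) s : 0 <= s -> mu d (box a s) = (s ^+ d)%:E.
Proof.
move=> s0; elim: d a => [|d IH] a.
  rewrite /= diracE (_ : _ \in _)// inE; by case.
rewrite /= /lebesgue_step /pushforward.
rewrite (_ : _ @^-1` _ = `[a ord0, a ord0 + s[%classic `*` box (fun i => a (lift ord0 i)) s).
  rewrite product_measure1E//; last exact: measurable_box.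
  have leb : @lebesgue_measure R `[a ord0, a ord0 + s[%classic = s%:E.
    rewrite lebesgue_measure_itv /= lte_fin ltrDl.
    have [s_gt0|] := boolP (0 < s); first by rewrite -EFinB addrAC subrr add0r.
    by rewrite -leNgt => s_le0; congr EFin; apply/eqP; rewrite eq_le s_le0 s0.
  by rewrite IH [X in (X * _)%E]leb exprS EFinM.
apply/seteqP; split=> -[x y] /=.
  move=> H; split=> [|i]; rewrite ?in_itv /=.
    by have := H ord0; rewrite tnth_tuple_cons unlift_none.
  by have := H (lift ord0 i); rewrite tnth_tuple_cons liftK.
rewrite in_itv /= => -[xa ya] i; rewrite tnth_tuple_cons.
by case: unliftP => [j|] ->.
Qed.

Definition hyperplane d (g : 'I_d -> R) (c : R) : set (d.-tuple MR) :=
  [set t | \sum_i g i * tnth t i = c].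

Lemma measurable_hyperplane d (g : 'I_d -> R) c : measurable (hyperplane g c).
Proof.
rewrite (_ : hyperplane g c =
  setT `&` (fun t : d.-tuple MR => \sum_i g i * tnth t i) @^-1` [set c]).
  have H : measurable_fun setT (fun t : d.-tuple MR => \sum_i g i * tnth t i : R).
    apply: measurable_sum => i; apply: measurable_funM => //.
    exact: measurable_tnth.
  exact: (H measurableT _ (measurable_set1 c)).
by rewrite setTI.
Qed.

(** Fubini and induction on d: if a later coefficient is nonzero, all slices are null hyperplanes;
    otherwise the hyperplane is a point times the whole space. *)
Lemma hyperplane_null d (g : 'I_d -> R) c : (exists i, g i != 0) ->
  mu d (hyperplane g c) = 0%E.
Proof.
elim: d g c => [|d IH] g c [i gi]; first by case: i gi.
rewrite /= /lebesgue_step /pushforward.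
have E x y : hyperplane g c (tuple_cons (x, y)) <->
    \sum_i g (lift ord0 i) * tnth y i = c - g ord0 * x.
  rewrite /hyperplane /= big_ord_recl tnth_tuple_cons unlift_none /=.
  under eq_bigr do rewrite tnth_tuple_cons liftK /=.
  by split=> [<-|->]; [rewrite addrAC subrr add0r|rewrite addrC subrK].
have [[j gj]|all0] := pselect (exists j, g (lift ord0 j) != 0).
  rewrite /product_measure1 /=; under eq_integral => x _.
    rewrite (_ : xsection _ x = hyperplane (fun i => g (lift ord0 i)) (c - g ord0 * x)).
      by rewrite IH; [over|exists j].
    by apply/seteqP; split=> y; rewrite /xsection /= inE => /E.
  by rewrite integral0.
have {}all0 j : g (lift ord0 j) = 0.
  by apply/eqP/negPn/negP => gj; apply: all0; exists j.
have g0 : g ord0 != 0.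
  by case: (unliftP ord0 i) gi => [j|] ->; rewrite ?all0 ?eqxx.
rewrite (_ : _ @^-1` _ = [set c / g ord0] `*` setT).
  have leb := @lebesgue_measure_set1 R (c / g ord0).
  by rewrite product_measure1E// [X in (X * _)%E]leb mul0e.
apply/seteqP; split=> -[x y] /=.
  move=> /E; rewrite big1 => [|j _]; last by rewrite all0 mul0r.
  by move=> /esym/subr0_eq ->; rewrite mulrAC mulfV ?mul1r.
move=> [-> _]; apply/E; rewrite big1 => [|j _]; last by rewrite all0 mul0r.
by rewrite mulrCA mulfV// mulr1 subrr.
Qed.

Definition rowt d (t : d.-tuple MR) : 'rV[R]_d := \row_i tnth t i.

(** Tuples carry the product sigma-algebra and row vectors the topology. The two are linked by
    writing f as a pointwise limit of functions that are constant on the countably many grid boxes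
    of side 1 / (n + 1). *)
Lemma measurable_continuous_row d (f : 'rV[R]_d -> R) : continuous f ->
  measurable_fun setT (fun t : d.-tuple MR => f (rowt t)).
Proof.
move=> cf.
pose rd n (t : d.-tuple MR) : 'rV[R]_d :=
  \row_i ((Num.floor (n.+1%:R * tnth t i))%:~R / n.+1%:R).
apply: (@measurable_fun_cvg _ _ _ _ (fun n t => f (rd n t))).
  move=> n _ Y mY; rewrite setTI.
  pose F (k : 'rV[int]_d) : set (d.-tuple MR) :=
    if `[< Y (f (\row_i ((k 0 i)%:~R / n.+1%:R))) >] then
      box (fun i => (k 0 i)%:~R / n.+1%:R) n.+1%:R^-1 else set0.
  have boxE (k : 'rV[int]_d) (t : d.-tuple MR) :
      box (fun i => (k 0 i)%:~R / n.+1%:R) n.+1%:R^-1 t <->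
      forall i, Num.floor (n.+1%:R * tnth t i) = k 0 i.
    have e (x : R) : x / n.+1%:R + n.+1%:R^-1 = (x + 1) / n.+1%:R.
      by rewrite mulrDl mul1r.
    split=> H i.
      apply: floor_def; have := H i; rewrite e ler_pdivrMr// ltr_pdivlMr//.
      by rewrite mulrC rmorphD.
    rewrite e ler_pdivrMr// ltr_pdivlMr//.
    by have := floor_itv (n.+1%:R * tnth t i); rewrite H mulrC rmorphD.
  rewrite (_ : _ @^-1` _ = \bigcup_k F k).
    apply: bigcup_countType_measurable => k; rewrite /F; case: ifP => // _.
    exact: measurable_box.
  apply/seteqP; split=> [t /= Yt|t [k _]].
    exists (\row_i Num.floor (n.+1%:R * tnth t i)) => //; rewrite /F.
    rewrite asboolT; first by apply/boxE => i; rewrite mxE.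
    by congr (Y (f _)): Yt; apply/rowP => i; rewrite !mxE.
  rewrite /F; case: asboolP => // Yk /boxE H /=.
  by congr (Y (f _)): Yk; apply/rowP => i; rewrite !mxE H.
move=> t _; apply: cvg_comp (cf (rowt t)).
move=> V /near_rV[e e0 HV].
suff : \forall n \near \oo, V (f (rd n t)) by [].
near=> n; apply: (HV (rd n t)) => i; rewrite !mxE.
have n1 : n.+1%:R^-1 < e.
  rewrite invf_plt ?posrE//.
  apply: lt_le_trans (_ : (Num.truncn e^-1).+1%:R <= _); first exact: truncnS_gt.
  by rewrite ler_nat ltnS; near: n; exists (Num.truncn e^-1).
have := floor_itv (n.+1%:R * tnth t i); rewrite rmorphD /= => /andP[h1 h2].
set k : R := _%:~R in h1 h2 *.
have -> : tnth t i - k / n.+1%:R = (n.+1%:R * tnth t i - k) / n.+1%:R.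
  by rewrite mulrBl mulrAC mulfV ?mul1r// pnatr_eq0.
rewrite normrM (@ger0_norm _ n.+1%:R^-1)// ger0_norm ?subr_ge0//.
apply: le_lt_trans n1; rewrite -[leRHS]mul1r ler_pM2r ?invr_gt0//.
by rewrite lerBlDl ltW.
Unshelve. all: by end_near.
Qed.

End TupleMeasure.

(** * Torus integrals of functions known up to a null set *)

Section Nice.
Variables (R : realType) (d : nat).
Local Notation MR := (measurableTypeR R).
Local Notation mu := (lebesgue_tuple R d).
Local Notation cube := (@unit_cube R d).
Implicit Types f g : 'rV[R]_d -> R.

Definition ae_cube (Q : 'rV[R]_d -> Prop) := exists N : set (d.-tuple MR),
  [/\ measurable N, mu N = 0%E & forall t, cube t -> ~ N t -> Q (rowt t)].

Lemma ae_cubeW (Q : 'rV[R]_d -> Prop) : (forall x, Q x) -> ae_cube Q.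
Proof. by move=> H; exists set0; split. Qed.

Lemma ae_cube2 (P Q S : 'rV[R]_d -> Prop) :
  (forall x, P x -> Q x -> S x) -> ae_cube P -> ae_cube Q -> ae_cube S.
Proof.
move=> PQS [N [mN N0 NP]] [N' [mN' N0' NQ]]; exists (N `|` N'); split.
- exact: measurableU.
- by rewrite measureU0.
- move=> t ct NN; apply: PQS; first by apply: NP => // Nt; apply: NN; left.
  by apply: NQ => // Nt; apply: NN; right.
Qed.

Lemma ae_cube1 (P S : 'rV[R]_d -> Prop) :
  (forall x, P x -> S x) -> ae_cube P -> ae_cube S.
Proof. by move=> PS H; apply: ae_cube2 (H) (H) => x + _; exact: PS. Qed.

(* Gradients of finite-element functions are controlled off a null set only, and need
   not be measurable as functions on the whole cube. *)
Definition nice f := exists g : d.-tuple MR -> R,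
  [/\ measurable_fun setT g, exists B, forall t, `|g t| <= B &
      ae_cube (fun x => f x = g [tuple x 0 i | i < d])].

Lemma tuple_rowt (t : d.-tuple MR) : [tuple rowt t 0 i | i < d] = t.
Proof. by apply: eq_from_tnth => i; rewrite tnth_mktuple mxE. Qed.

Lemma cube_box : cube = box (fun=> 0) 1.
Proof. by apply/seteqP; split=> t H i; have := H i; rewrite add0r. Qed.

Lemma measurable_cube : measurable cube.
Proof. by rewrite cube_box; exact: measurable_box. Qed.

Lemma cube1 : mu cube = 1%E.
Proof. by rewrite cube_box lebesgue_box// expr1n. Qed.

Lemma nice_eq f g : ae_cube (fun x => f x = g x) -> nice f -> nice g.
Proof.
move=> fg [h [mh Bh fh]]; exists h; split => //.
by apply: ae_cube2 fg fh => x -> ->.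
Qed.

Lemma niceD f g : nice f -> nice g -> nice (fun x => f x + g x).
Proof.
move=> [f' [mf [B HB] ff]] [g' [mg [B' HB'] gg]]; exists (fun t => f' t + g' t); split.
- exact: measurable_funD.
- by exists (B + B') => t; apply: le_trans (ler_normD _ _) _; rewrite lerD.
- by apply: ae_cube2 ff gg => x -> ->.
Qed.

Lemma niceM f g : nice f -> nice g -> nice (fun x => f x * g x).
Proof.
move=> [f' [mf [B HB] ff]] [g' [mg [B' HB'] gg]]; exists (fun t => f' t * g' t); split.
- exact: measurable_funM.
- by exists (B * B') => t; rewrite normrM ler_pM.
- by apply: ae_cube2 ff gg => x -> ->.
Qed.

Lemma nice_abs f : nice f -> nice (fun x => `|f x|).
Proof.
move=> [f' [mf [B HB] ff]]; exists (fun t => `|f' t|); split.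
- by apply: measurableT_comp.
- by exists B => t; rewrite normr_id.
- by apply: ae_cube1 ff => x ->.
Qed.

Lemma nice_cst c : nice (fun=> c).
Proof.
exists (fun=> c); split => //; first by exists `|c|.
exact: ae_cubeW.
Qed.

Lemma niceN f : nice f -> nice (fun x => - f x).
Proof.
move=> nf; apply: (@nice_eq (fun x => -1 * f x)).
  by apply: ae_cubeW => x; rewrite mulN1r.
by apply: niceM => //; exact: nice_cst.
Qed.

Lemma niceB f g : nice f -> nice g -> nice (fun x => f x - g x).
Proof. by move=> nf ng; apply: niceD => //; exact: niceN. Qed.

Lemma nice_sum (I : Type) (r : seq I) (P : pred I) (F : I -> 'rV[R]_d -> R) :
  (forall i, P i -> nice (F i)) -> nice (fun x => \sum_(i <- r | P i) F i x).
Proof.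
move=> nF; elim: r => [|i r IH].
  apply: (@nice_eq (fun=> 0)); last exact: nice_cst.
  by apply: ae_cubeW => x; rewrite big_nil.
have [Pi|Pi] := boolP (P i).
  apply: (@nice_eq (fun x => F i x + \sum_(i <- r | P i) F i x)).
    by apply: ae_cubeW => x; rewrite big_cons Pi.
  by apply: niceD => //; exact: nF.
apply: nice_eq IH; by apply: ae_cubeW => x; rewrite big_cons (negPf Pi).
Qed.

Lemma closed_cube_compact : compact [set v : 'rV[R]_d | forall i, 0 <= v 0 i <= 1].
Proof.
have := @rV_compact R d (fun=> `[0, 1]%classic) (fun=> @segment_compact _ _ _).
rewrite (_ : [set v | _] = [set v : 'rV[R]_d | forall i, 0 <= v 0 i <= 1])//.
Qed.

Lemma continuous_bounded_cube f : continuous f ->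
  exists2 B : R, 0 <= B & forall x : 'rV[R]_d, (forall i, 0 <= x 0 i <= 1) -> `|f x| <= B.
Proof.
move=> cf; have c0 : [set v : 'rV[R]_d | forall i, 0 <= v 0 i <= 1] !=set0.
  by exists 0 => i; rewrite mxE lexx ler01.
have cN : {within [set v : 'rV[R]_d | forall i, 0 <= v 0 i <= 1],
    continuous (fun x => `|f x|)}.
  apply: continuous_subspaceT => x.
  by apply: (continuous_comp (cf x)); exact: norm_continuous.
have [x0 _ H] := @compact_EVT_max _ R _ _ c0 closed_cube_compact cN.
by exists `|f x0| => // x cx; apply: H; rewrite inE.
Qed.

Lemma nice_continuous f : continuous f -> nice f.
Proof.
move=> cf; have [B B0 HB] := continuous_bounded_cube cf.
(* A representative must be bounded on all tuples, while f is bounded by B on the closed cube only;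
   hence the truncation. *)
exists (fun t => Num.min B (Num.max (- B) (f (rowt t)))); split.
- apply: measurable_minr => //; apply: measurable_maxr => //.
  exact: measurable_continuous_row.
- exists B => t; rewrite ler_norml ge_min lexx andbT le_min le_max lexx andbT.
  by rewrite lerNl (le_trans _ B0)// oppr_le0.
- apply: (@ae_cube1 (fun x : 'rV[R]_d => forall i, 0 <= x 0 i <= 1)); last first.
    exists set0; split => // t ct _ i; rewrite mxE; have /andP[-> /ltW] := ct i; by [].
  move=> x cx; rewrite (_ : rowt _ = x); last first.
    by apply/rowP => i; rewrite mxE tnth_mktuple.
  by have := HB x cx; rewrite ler_norml => /andP[/max_idPr -> /min_idPr ->].
Qed.

Lemma nice_integrable (g : d.-tuple MR -> R) : measurable_fun setT g ->
  (exists B, forall t, `|g t| <= B) -> mu.-integrable cube (EFin \o g).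
Proof.
move=> mg [B HB]; apply: measurable_bounded_integrable.
- exact: measurable_cube.
- by rewrite [X in (X < _)%E]cube1 ltry.
- exact: measurable_funS mg.
- exists B; split; first exact: num_real.
  by move=> b Bb t _ /=; apply: le_trans (HB t) (ltW Bb).
Qed.

Local Notation I := (@torus_integral R d).

Lemma torus_integral_ae_eq f g : ae_cube (fun x => f x = g x) -> I f = I g.
Proof.
move=> [N [mN N0 NP]]; congr fine; apply: (integral_null_eq mN N0) => t ct Nt.
by have := NP t ct Nt; rewrite /rowt => ->.
Qed.

Lemma nice_torus_integral f (nf : nice f) : exists g : d.-tuple MR -> R, [/\ measurable_fun setT g,
    exists B, forall t, `|g t| <= B,
    exists N, [/\ measurable N, mu N = 0%E & forall t, cube t -> ~ N t -> f (rowt t) = g t] &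
    I f = \int[mu]_(t in cube) g t].
Proof.
case: nf => g [mg Bg [N [mN N0 NP]]].
have NP' t : cube t -> ~ N t -> f (rowt t) = g t.
  by move=> ct Nt; rewrite NP// tuple_rowt.
exists g; split => //; first by exists N.
congr fine; apply: (integral_null_eq mN N0) => t ct Nt.
by rewrite -NP'.
Qed.

Lemma torus_integralD f g : nice f -> nice g -> I (fun x => f x + g x) = I f + I g.
Proof.
move=> /nice_torus_integral[f' [mf Bf [N [mN N0 fN]] ->]] /nice_torus_integral[g' [mg Bg [N'
    [mN' N0' gN]] ->]].
rewrite -RintegralD; [|exact: measurable_cube|exact: nice_integrable|exact: nice_integrable].
congr fine; apply: (@integral_null_eq _ _ _ _ _ (N `|` N')).
- exact: measurableU.
- by rewrite [LHS]measureU0.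
- move=> t ct NN; rewrite -/(rowt t) fN ?gN// => Nt; apply: NN; first [by left | by right].
Qed.

Lemma torus_integralZ c f : nice f -> I (fun x => c * f x) = c * I f.
Proof.
move=> /nice_torus_integral[f' [mf Bf [N [mN N0 fN]] ->]].
rewrite -RintegralZl; [|exact: measurable_cube|exact: nice_integrable].
congr fine; apply: (integral_null_eq mN N0) => t ct Nt.
by rewrite -/(rowt t) fN.
Qed.

Lemma torus_integralN f : nice f -> I (fun x => - f x) = - I f.
Proof.
by move=> nf; rewrite -mulN1r -torus_integralZ//; apply: torus_integral_ae_eq;
    apply: ae_cubeW => x; rewrite mulN1r.
Qed.

Lemma torus_integralB f g : nice f -> nice g -> I (fun x => f x - g x) = I f - I g.
Proof. by move=> nf ng; rewrite torus_integralD ?torus_integralN//; exact: niceN. Qed.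

Lemma torus_integral_cst c : I (fun=> c) = c.
Proof.
rewrite /torus_integral Rintegral_cst; last exact: measurable_cube.
by rewrite [X in fine X]cube1 mulr1.
Qed.

Lemma torus_integral_ge0 f : nice f -> ae_cube (fun x => 0 <= f x) -> 0 <= I f.
Proof.
move=> /nice_torus_integral[f' [mf Bf [N [mN N0 fN]] ->]] [N' [mN' N0' fN']].
rewrite (_ : Rintegral _ _ _ = \int[mu]_(t in cube) `|f' t|).
  by apply: Rintegral_ge0.
congr fine; apply: (@integral_null_eq _ _ _ _ _ (N `|` N')).
- exact: measurableU.
- by rewrite [LHS]measureU0.
- move=> t ct NN; rewrite ger0_norm// -fN//; last by move=> Nt; apply: NN; left.
  by apply: fN' => // Nt; apply: NN; right.
Qed.

Lemma torus_integral_le f g : nice f -> nice g -> ae_cube (fun x => f x <= g x) -> I f <= I g.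
Proof.
move=> nf ng H; rewrite -subr_ge0 -torus_integralB//; apply: torus_integral_ge0; first exact: niceB.
by apply: ae_cube1 H => x; rewrite subr_ge0.
Qed.

Lemma torus_integral_sum (J : Type) (r : seq J) (P : pred J) (F : J -> 'rV[R]_d -> R) :
  (forall i, P i -> nice (F i)) ->
  I (fun x => \sum_(i <- r | P i) F i x) = \sum_(i <- r | P i) I (F i).
Proof.
move=> nF; elim: r => [|i r IH].
  rewrite big_nil -[RHS]torus_integral_cst; apply: torus_integral_ae_eq; apply: ae_cubeW => x.
  by rewrite big_nil.
rewrite big_cons; have [Pi|Pi] := boolP (P i).
  rewrite -IH -torus_integralD; [|exact: nF|exact: nice_sum].
  by apply: torus_integral_ae_eq; apply: ae_cubeW => x; rewrite big_cons Pi.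
by rewrite -IH; apply: torus_integral_ae_eq; apply: ae_cubeW => x; rewrite big_cons (negPf Pi).
Qed.

Definition box_indic (a : 'I_d -> R) s (x : 'rV[R]_d) : R :=
  (`[< forall i, a i <= x 0 i < a i + s >])%:R.

Lemma nice_box a s : nice (box_indic a s).
Proof.
exists (\1_(box a s)); split.
- by apply: measurable_indic; exact: measurable_box.
- exists 1 => t; rewrite indicE; case: (_ \in _); rewrite ?normr1 ?normr0 ?ler01//.
- apply: ae_cubeW => x; rewrite /box_indic indicE; congr (nat_of_bool _)%:R.
  apply/idP/idP.
    by move=> /asboolP H; rewrite inE => i; rewrite tnth_mktuple.
  by rewrite inE => H; apply/asboolP => i; have := H i; rewrite tnth_mktuple.
Qed.

Lemma torus_integral_box (a : 'I_d -> R) s : 0 <= s -> (forall i, 0 <= a i /\ a i + s <= 1) ->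
  I (box_indic a s) = s ^+ d.
Proof.
move=> s0 H; rewrite /torus_integral /Rintegral.
rewrite (_ : (\int[_]_(t in _) _)%E = (\int[mu]_(t in cube) (\1_(box a s) t)%:E)%E).
  rewrite integral_indic; [|exact: measurable_cube|exact: measurable_box].
  rewrite setIidl; first by rewrite [X in fine X]lebesgue_box.
  move=> t bt i.
  have [h1 h2] := H i; have /andP[b1 b2] := bt i.
  by rewrite (le_trans h1)//= (lt_le_trans b2).
apply: eq_integral => t _; rewrite /box_indic indicE; congr (nat_of_bool _)%:R%:E.
apply/idP/idP.
  by move=> /asboolP K; rewrite inE => i; have := K i; rewrite mxE.
by rewrite inE => K; apply/asboolP => i; rewrite mxE; exact: K.
Qed.

End Nice.

(** The basis is a maximal free family. Its size is at most the number of separating points, since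
    the matrix of values at these points has independent rows. Applied to V_h with the mesh vertices
    as points, this makes nodal hat functions unnecessary. *)
Lemma finite_basis (R : fieldType) (X : Type) (W : (X -> R) -> Prop) (J : finType)
    (pt : J -> X) :
  (forall a u v, W u -> W v -> W (fun x => a * u x + v x)) ->
  (forall u, W u -> (forall j, u (pt j) = 0) -> forall x, u x = 0) ->
  exists n (b : 'I_n -> X -> R), [/\ forall i, W (b i),
    forall c : 'rV[R]_n, (forall x, \sum_i c 0 i * b i x = 0) -> c = 0 &
    forall u, W u -> exists c : 'rV[R]_n, forall x, u x = \sum_i c 0 i * b i x].
Proof.
move=> Wlin sep.
have Wsum n (b : 'I_n -> X -> R) (c : 'rV[R]_n) u : W u -> (forall i, W (b i)) ->
    W (fun x => \sum_i c 0 i * b i x + u x).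
  move=> Wu Wb; suff H (r : seq 'I_n) : W (fun x => \sum_(i <- r) c 0 i * b i x + u x).
    exact: H.
  elim: r => [|i r IH].
    by rewrite (_ : (fun x => _) = u)//; apply/funext => x; rewrite big_nil add0r.
  rewrite (_ : (fun x => _) =
    fun x => c 0 i * b i x + (\sum_(i <- r) c 0 i * b i x + u x)); first exact: Wlin.
  by apply/funext => x; rewrite big_cons addrA.
pose free_in n := `[< exists b : 'I_n -> X -> R, (forall i, W (b i)) /\
  forall c : 'rV[R]_n, (forall x, \sum_i c 0 i * b i x = 0) -> c = 0 >].
have P0 : exists n, free_in n.
  by exists 0%N; apply/asboolP; exists (fun _ _ => 0); split=> [[]//|c _]; exact: thinmx0.
have Wzero n (b : 'I_n -> X -> R) (c : 'rV[R]_n) : (0 < n)%N -> (forall i, W (b i)) ->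
    W (fun x => \sum_i c 0 i * b i x).
  move=> n0 Wb; have Wb0 := Wlin (-1) _ _ (Wb (Ordinal n0)) (Wb (Ordinal n0)).
  have := Wsum n b c _ Wb0 Wb; congr (W _); apply/funext => x.
  by rewrite mulN1r addNr addr0.
have Pbound n : free_in n -> (n <= #|J|)%N.
  move=> /asboolP[b [Wb fb]]; have [->//|n0] := posnP n.
  pose A := \matrix_(i < n, j < #|J|) b i (pt (enum_val j)).
  have : row_free A.
    apply: inj_row_free => v vA; apply: fb; apply: sep; first exact: Wzero.
    move=> j; have /rowP/(_ (enum_rank j)) := vA; rewrite !mxE => vAj.
    by rewrite -[RHS]vAj /=; apply: eq_bigr => i _; rewrite mxE enum_rankK.
  by move=> /eqP <-; exact: rank_leq_col.
case: (ex_maxnP P0 Pbound) => n /asboolP[b [Wb fb]] nmax; exists n, b; split=> // u Wu.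
apply: contrapT => nspan.
suff : free_in n.+1 by move=> /nmax; rewrite ltnn.
apply/asboolP; exists (fun i => if unlift ord0 i is Some j then b j else u).
split=> [i|c Hc]; first by case: unlift.
have Hc' x : c 0 ord0 * u x + \sum_(i < n) c 0 (lift ord0 i) * b i x = 0.
  rewrite -[RHS](Hc x) big_ord_recl unlift_none; congr (_ + _).
  by apply: eq_bigr => i _; rewrite liftK.
have c0 : c 0 ord0 = 0.
  apply/eqP/negPn/negP => c0; apply: nspan.
  exists (\row_i (- (c 0 ord0)^-1 * c 0 (lift ord0 i))) => x.
  under eq_bigr do rewrite mxE -mulrA.
  rewrite -mulr_sumr; have /eqP := Hc' x; rewrite addrC addr_eq0 => /eqP ->.
  by rewrite mulrNN mulKf.
have cl : (\row_i c 0 (lift ord0 i) : 'rV[R]_n) = 0.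
  apply: fb => x; have := Hc' x; rewrite c0 mul0r add0r => e; rewrite -[RHS]e.
  by apply: eq_bigr => i _; rewrite mxE.
apply/rowP => i; rewrite mxE; case: (unliftP ord0 i) => [j|] -> //.
by have /rowP/(_ j) := cl; rewrite !mxE.
Qed.

Section ContR.
Variables (R : realType) (X : topologicalType).
Implicit Types f g : X -> R.
Lemma cont_cst (c : R) : continuous (fun _ : X => c).
Proof. exact: cst_continuous. Qed.
Lemma cont_add f g : continuous f -> continuous g -> continuous (fun x => f x + g x).
Proof. by move=> cf cg x; exact: (cvgD (cf x) (cg x)). Qed.
Lemma cont_mul f g : continuous f -> continuous g -> continuous (fun x => f x * g x).
Proof. by move=> cf cg x; exact: (cvgM (cf x) (cg x)). Qed.
Lemma cont_opp f : continuous f -> continuous (fun x => - f x).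
Proof. by move=> cf x; exact: (cvgN (cf x)). Qed.
Lemma cont_comp f (h : R -> R) : continuous f -> (forall x, {for f x, continuous h}) ->
  continuous (fun x => h (f x)).
Proof. by move=> cf ch x; exact: (continuous_comp (cf x) (ch x)). Qed.
End ContR.

(** * The finite-element space *)

Section FE.
Variables (R : realType) (d : nat) (T : mesh R d).
Local Notation V := (fe_space T).
Implicit Types u v : 'rV[R]_d -> R.

Lemma dotDl m n (A B C : 'M[R]_(m, n)) : dot (A + B) C = dot A C + dot B C.
Proof.
rewrite -big_split; apply: eq_bigr => i _; rewrite -big_split; apply: eq_bigr => j _.
by rewrite mxE mulrDl.
Qed.

Lemma dotZl m n a (A C : 'M[R]_(m, n)) : dot (a *: A) C = a * dot A C.
Proof.
rewrite mulr_sumr; apply: eq_bigr => i _; rewrite mulr_sumr; apply: eq_bigr => j _.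
by rewrite mxE mulrA.
Qed.

Lemma dotC m n (A B : 'M[R]_(m, n)) : dot A B = dot B A.
Proof. by apply: eq_bigr => i _; apply: eq_bigr => j _; rewrite mulrC. Qed.

Lemma dotDr m n (A B C : 'M[R]_(m, n)) : dot C (A + B) = dot C A + dot C B.
Proof. by rewrite dotC dotDl !(dotC C). Qed.

Lemma dotZr m n a (A C : 'M[R]_(m, n)) : dot C (a *: A) = a * dot C A.
Proof. by rewrite dotC dotZl dotC. Qed.

Lemma dotNl m n (A C : 'M[R]_(m, n)) : dot (- A) C = - dot A C.
Proof. by rewrite -scaleN1r dotZl mulN1r. Qed.

Lemma dotNr m n (A C : 'M[R]_(m, n)) : dot C (- A) = - dot C A.
Proof. by rewrite dotC dotNl dotC. Qed.

Lemma dot0l m n (A : 'M[R]_(m, n)) : dot 0 A = 0.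
Proof. by rewrite -(scale0r 0) dotZl mul0r. Qed.

Lemma dot_sumr m n (I : finType) (F : I -> 'M[R]_(m, n)) (C : 'M[R]_(m, n)) :
  dot C (\sum_i F i) = \sum_i dot C (F i).
Proof.
by elim/big_ind2: _ => [|A a B b <- <-|//]; [rewrite dotC dot0l|rewrite dotDr].
Qed.

Lemma dot_row n (g x : 'rV[R]_n) : dot g x = \sum_j g 0 j * x 0 j.
Proof. by rewrite /dot big_ord1. Qed.

Lemma fe_const c : V (fun=> c).
Proof.
split; [exact: cst_continuous|by []|move=> K].
by exists 0, c => x _; rewrite dot0l add0r.
Qed.

Lemma fe_lin a u v : V u -> V v -> V (fun x => a * u x + v x).
Proof.
move=> [cu pu au] [cv pv av]; split.
- by apply: cont_add => //; apply: cont_mul => //; exact: cont_cst.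
- by move=> k x; rewrite pu pv.
- move=> K; have [g [c gu]] := au K; have [g' [c' gv]] := av K.
  exists (a *: g + g'), (a * c + c') => x Kx; rewrite gu// gv// dotDl dotZl.
  by rewrite mulrDr addrACA.
Qed.

Lemma affine_on_simplex u (v : 'I_d.+1 -> 'rV[R]_d) : affine_on (simplex v) u ->
  forall w : 'I_d.+1 -> R, (forall i, 0 <= w i) -> \sum_i w i = 1 ->
  u (\sum_i w i *: v i) = \sum_i w i * u (v i).
Proof.
move=> [g [c gu]] w w0 w1; rewrite gu; last by exists w.
have vs i : simplex v (v i).
  exists (fun j => (j == i)%:R); split.
  - by move=> j.
  - by rewrite (bigD1 i)//= eqxx big1 ?addr0// => j /negPf ->.
  - rewrite (bigD1 i)//= eqxx scale1r big1 ?addr0// => j /negPf ->.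
    by rewrite scale0r.
under [RHS]eq_bigr do rewrite gu// mulrDr.
rewrite big_split /= -mulr_suml w1 mul1r dot_sumr; congr (_ + _).
by apply: eq_bigr => i _; rewrite dotZr.
Qed.

Lemma fe_separated u : V u -> (forall p : cell T * 'I_d.+1, u (vertex p.1 p.2) = 0) ->
  forall x, u x = 0.
Proof.
move=> [_ pu au] H x; have [K [k [w [w0 w1 xk]]]] := mesh_cover T x.
rewrite -(subrK (int_vec R k) x) pu xk (affine_on_simplex (au K))//.
by rewrite big1// => i _; rewrite (H (K, i)) mulr0.
Qed.

Lemma fe_basis : exists n (b : 'I_n -> 'rV[R]_d -> R), [/\ forall i, V (b i),
    forall c : 'rV[R]_n, (forall x, \sum_i c 0 i * b i x = 0) -> c = 0 &
    forall u, V u -> exists c : 'rV[R]_n, forall x, u x = \sum_i c 0 i * b i x].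
Proof. exact: finite_basis fe_lin fe_separated. Qed.

Lemma fe_sum n (b : 'I_n -> 'rV[R]_d -> R) (c : 'rV[R]_n) : (forall i, V (b i)) ->
  V (fun x => \sum_i c 0 i * b i x).
Proof.
move=> Vb; suff H (r : seq 'I_n) : V (fun x => \sum_(i <- r) c 0 i * b i x).
  exact: H.
elim: r => [|i r IH].
  rewrite (_ : (fun x => _) = fun=> 0); first exact: fe_const.
  by apply/funext => x; rewrite big_nil.
rewrite (_ : (fun x => _) = fun x => c 0 i * b i x + \sum_(i <- r) c 0 i * b i x).
  exact: fe_lin.
by apply/funext => x; rewrite big_cons.
Qed.

Lemma periodic_cube u x : Defs.periodic u ->
  exists y : 'rV[R]_d, u y = u x /\ forall i, 0 <= y 0 i < 1.
Proof.
move=> pu; pose k : 'rV[int]_d := \row_i Num.floor (x 0 i).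
exists (x - int_vec R k); split; first by rewrite -(pu k) subrK.
move=> i; rewrite !mxE; have := floor_itv (x 0 i); rewrite rmorphD /=.
by move=> /andP[h1 h2]; rewrite subr_ge0 h1 ltrBlDl.
Qed.

Lemma periodic_bounded u : continuous u -> Defs.periodic u ->
  exists2 B, 0 <= B & forall x, `|u x| <= B.
Proof.
move=> cu pu; have [B B0 HB] := continuous_bounded_cube cu.
exists B => // x; have [y [<- yc]] := periodic_cube x pu.
by apply: HB => i; have /andP[-> /ltW] := yc i.
Qed.

Lemma fe_nice u : V u -> nice u.
Proof. by move=> [cu _ _]; exact: nice_continuous. Qed.

Lemma torus_integral_abs_eq0 u : continuous u -> Defs.periodic u ->
  torus_integral (fun x => `|u x|) = 0 -> forall x, u x = 0.
Proof.
move=> cu pu I0 x; have [x0 [<- xc]] := periodic_cube x pu.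
apply/eqP/negPn/negP => ux0; have un0 : 0 < `|u x0| by rewrite normr_gt0.
have cn : {for x0, continuous (fun y => `|u y|)}.
  by apply: (continuous_comp (cu x0)); exact: norm_continuous.
have /near_rV[e e0 He] : nbhs x0 [set y | `|u x0| / 2 < `|u y|].
  by apply: (cvgr_gt `|u x0| cn); rewrite ltr_pdivrMr// ltr_pMr// ltr1n.
(* The box of side s with lower corner x0 stays in the unit cube, because x0 lies in the half-open
   cube; on it |u| exceeds |u x0| / 2. *)
pose s := \big[Num.min/e]_(i < d) (1 - x0 0 i).
have s0 : 0 < s.
  rewrite /s; elim/big_ind: _ => //; first by move=> a b a0 b0; rewrite lt_min a0.
  by move=> i _; rewrite subr_gt0; have /andP[] := xc i.
have se : s <= e by rewrite /s; apply: bigmin_le_id.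
have s1 i : x0 0 i + s <= 1.
  by rewrite addrC -lerBrDr /s; apply: bigmin_le_cond.
have nu : nice (fun y => `|u y|) by apply: nice_abs; exact: nice_continuous.
have : torus_integral (fun y => `|u x0| / 2 * box_indic (fun i => x0 0 i) s y) <=
       torus_integral (fun y => `|u y|).
  apply: torus_integral_le => //; first by apply: niceM; [exact: nice_cst|exact: nice_box].
  apply: ae_cubeW => y; rewrite /box_indic; case: asboolP => H; last by rewrite mulr0.
  rewrite mulr1; apply/ltW/He => i; have /andP[h1 h2] := H i.
  by rewrite distrC ger0_norm ?subr_ge0// ltrBlDl (lt_le_trans h2)// lerD2l.
rewrite I0 torus_integralZ; last exact: nice_box.
rewrite torus_integral_box; [|exact: ltW|by move=> i; have /andP[-> _] := xc i].
by rewrite leNgt mulr_gt0 ?exprn_gt0// divr_gt0.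
Qed.

Section Basis.
Variables (n : nat) (b : 'I_n -> 'rV[R]_d -> R).
Hypotheses (Vb : forall i, V (b i))
  (bfree : forall c : 'rV[R]_n, (forall x, \sum_i c 0 i * b i x = 0) -> c = 0).

Definition comb (c : 'rV[R]_n) (x : 'rV[R]_d) : R := \sum_i c 0 i * b i x.

Lemma fe_comb c : V (comb c). Proof. exact: fe_sum. Qed.

Lemma comb_bound : exists2 C : R, 0 < C & forall (c : 'rV[R]_n) (e : R),
  0 <= e -> (forall i, `|c 0 i| <= e) -> forall x, `|comb c x| <= C * e.
Proof.
have /choice[B HB] : forall i, exists B, 0 <= B /\ forall x, `|b i x| <= B.
  by move=> i; have [cb pb _] := Vb i; have [B B0 HB] := periodic_bounded cb pb; exists B.
exists (1 + \sum_i B i); first by rewrite ltr_pwDl// sumr_ge0// => i _; have [] := HB i.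
move=> c e e0 ce x; rewrite /comb.
apply: le_trans (ler_norm_sum _ _ _) _; rewrite mulrDl mul1r mulr_suml.
apply: ler_wpDl => //; apply: ler_sum => i _; rewrite normrM mulrC.
by apply: ler_pM => //; have [] := HB i.
Qed.

End Basis.
End FE.

(** * Barycentric coordinates and gradients of finite-element functions *)

Section Barycentric.
Variables (R : realType) (d : nat).

(** The affine functions are the barycentric coordinates: for a nonzero index a column of the
    inverse edge matrix applied to x - v_0, for index 0 one minus the sum of the others. That their
    linear parts do not vanish makes the facets lie in null hyperplanes. *)
Lemma barycentric (v : 'I_d.+1 -> 'rV[R]_d) : (0 < d)%N ->
  (\matrix_(i < d) (v (lift ord0 i) - v ord0)) \in unitmx ->
  exists gc : ('I_d.+1 -> 'rV[R]_d) * ('I_d.+1 -> R), [/\ forall i, gc.1 i != 0,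
    forall w i, \sum_j w j = 1 -> dot (gc.1 i) (\sum_j w j *: v j) + gc.2 i = w i &
    forall x, simplex v x <-> forall i, 0 <= dot (gc.1 i) x + gc.2 i].
Proof.
move=> d0; set A := \matrix_(i < d) _ => uA.
pose gl j : 'rV[R]_d := \row_k invmx A k j.
pose cl j : R := - dot (gl j) (v ord0).
pose g i := if unlift ord0 i is Some j then gl j else - \sum_j gl j.
pose c i := if unlift ord0 i is Some j then cl j else 1 - \sum_j cl j.
pose s x := (x - v ord0) *m invmx A.
have sE x j : s x 0 j = dot (gl j) x + cl j.
  rewrite /cl -dotNr -dotDr dot_row mxE.
  by apply: eq_bigr => k _; rewrite !mxE mulrC.
have w0E x : dot (g ord0) x + c ord0 = 1 - \sum_j s x 0 j.
  rewrite /g /c unlift_none dotNl (dotC (\sum_j _)) dot_sumr.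
  under [in RHS]eq_bigr do rewrite sE.
  rewrite big_split /= opprD addrCA; congr (_ + (_ + _)).
  by congr (- _); apply: eq_bigr => j _; rewrite dotC.
have wlE x j : dot (g (lift ord0 j)) x + c (lift ord0 j) = s x 0 j.
  by rewrite /g /c liftK sE.
have AK : A *m invmx A = 1%:M by rewrite mulmxV.
have colE (z : 'I_d -> R) i : \sum_j \sum_k A i k * invmx A k j * z j = z i.
  have E j : \sum_k A i k * invmx A k j = (i == j)%:R.
    by have /matrixP/(_ i j) := AK; rewrite !mxE.
  under eq_bigr do rewrite -mulr_suml E.
  by rewrite (bigD1 i)//= eqxx mul1r big1 ?addr0// => j; rewrite eq_sym => /negPf ->; rewrite mul0r.
have sumE (w : 'I_d.+1 -> R) : \sum_i w i = 1 ->
    \sum_i w i *: v i = (\row_j w (lift ord0 j)) *m A + v ord0.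
  move=> w1; rewrite mulmx_sum_row big_ord_recl.
  rewrite big_ord_recl in w1.
  under [in RHS]eq_bigr do rewrite mxE rowK scalerBr.
  have {}w1 : w ord0 = 1 - \sum_(i < d) w (lift ord0 i) by rewrite -w1 addrK.
  rewrite sumrB -scaler_suml w1 scalerBl scale1r addrC [RHS]addrAC.
  by rewrite addrA.
suff weights w i : \sum_j w j = 1 -> dot (g i) (\sum_j w j *: v j) + c i = w i.
  exists (g, c); split=> [i||x] //=.
    rewrite /g; case: unliftP => [j|] _.
      apply/eqP => g0; have := colE (fun k => (k == j)%:R) j.
      rewrite eqxx big1 => [/eqP|k _]; first by rewrite eq_sym oner_eq0.
      rewrite big1// => l _; have [->|] := eqVneq k j; last by rewrite mulr0.
      by have /rowP/(_ l) := g0; rewrite !mxE => ->; rewrite mulr0 mul0r.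
    apply/eqP => /eqP; rewrite oppr_eq0 => /eqP g0.
    have := colE (fun=> 1) (Ordinal d0).
    rewrite exchange_big big1 => [/eqP|k _]; first by rewrite eq_sym oner_eq0.
    under eq_bigr do rewrite mulr1.
    rewrite -mulr_sumr; have /rowP/(_ k) := g0; rewrite summxE mxE.
    by under eq_bigr do rewrite mxE; move=> ->; rewrite mulr0.
  split=> [[w [w0 w1 ->]] i|H]; first by rewrite weights.
  exists (fun i => dot (g i) x + c i).
  have w1 : \sum_i (dot (g i) x + c i) = 1.
    by rewrite big_ord_recl w0E (eq_bigr _ (fun j _ => wlE x j)) subrK.
  split=> //; rewrite sumE//.
  rewrite (_ : \row_j _ = s x); last by apply/rowP => j; rewrite mxE wlE.
  by rewrite /s -mulmxA mulVmx// mulmx1 subrK.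
move=> w1; have sw : s (\sum_i w i *: v i) = \row_j w (lift ord0 j).
  by rewrite /s sumE// addrK -mulmxA mulmxV// mulmx1.
case: (unliftP ord0 i) => [j|] ->; first by rewrite wlE sw mxE.
rewrite w0E sw; under eq_bigr do rewrite mxE.
by rewrite -w1 big_ord_recl addrK.
Qed.
End Barycentric.

Section Gradient.
Variables (R : realType) (d : nat) (T : mesh R d) (d_gt0 : (0 < d)%N).
Local Notation V := (fe_space T).
Local Notation MR := (measurableTypeR R).
Implicit Types (u v : 'rV[R]_d -> R) (x : 'rV[R]_d).

Let bary K := cid (barycentric d_gt0 (mesh_nondegenerate (m := T) K)).
Definition bary_lin (K : cell T) := (projT1 (bary K)).1.
Definition bary_cst (K : cell T) := (projT1 (bary K)).2.

Lemma bary_lin_neq0 K i : bary_lin K i != 0.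
Proof. by have [H _ _] := projT2 (bary K); exact: H. Qed.

Lemma simplex_bary K x :
  simplex (vertex K) x <-> forall i, 0 <= dot (bary_lin K i) x + bary_cst K i.
Proof. by have [_ _ H] := projT2 (bary K); exact: H. Qed.

Lemma bary_weights K (w : 'I_d.+1 -> R) i : \sum_j w j = 1 ->
  dot (bary_lin K i) (\sum_j w j *: vertex K j) + bary_cst K i = w i.
Proof. by have [_ H _] := projT2 (bary K); exact: H. Qed.

(* The hyperplanes spanned by the facets, a null set off which every function of the
   finite-element space is locally affine. *)
Definition skeleton : set 'rV[R]_d := [set x | exists K (k : 'rV[int]_d) i,
  dot (bary_lin K i) (x - int_vec R k) + bary_cst K i = 0].

Lemma skeleton_null : measurable [set t : d.-tuple MR | skeleton (rowt t)] /\
  lebesgue_tuple R d [set t | skeleton (rowt t)] = 0%E.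
Proof.
pose F (p : cell T * 'rV[int]_d * 'I_d.+1) : set (d.-tuple MR) :=
  hyperplane (fun i => bary_lin p.1.1 p.2 0 i)
    (dot (bary_lin p.1.1 p.2) (int_vec R p.1.2) - bary_cst p.1.1 p.2).
rewrite (_ : [set t : d.-tuple MR | skeleton (rowt t)] = \bigcup_p F p).
  split; first by apply: bigcup_countType_measurable => p; exact: measurable_hyperplane.
  apply: bigcup_countType_null => p; first exact: measurable_hyperplane.
  apply: hyperplane_null; apply: contrapT => H.
  have /eqP := bary_lin_neq0 p.1.1 p.2; apply; apply/rowP => i; rewrite mxE.
  by apply/eqP/negPn/negP => ?; apply: H; exists i.
have E K k i (t : d.-tuple MR) :
    dot (bary_lin K i) (rowt t - int_vec R k) + bary_cst K i = 0 <->
    F (K, k, i) t.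
  have tE (g : 'rV[R]_d) : dot g (rowt t) = \sum_j g 0 j * tnth t j.
    by rewrite dot_row; apply: eq_bigr => j _; rewrite mxE.
  rewrite /F /hyperplane /= dotDr dotNr tE.
  split=> H; first by apply/eqP; rewrite -subr_eq0 opprB addrA addrAC H.
  by rewrite H addrAC subrK subrr.
apply/seteqP; split=> t.
  by move=> [K [k [i H]]]; exists (K, k, i) => //; apply/E.
by move=> [[[K k] i] _ H]; exists K, k, i; apply/E.
Qed.

Lemma ae_good : ae_cube (fun x : 'rV[R]_d => ~ skeleton x).
Proof.
by have [mS S0] := skeleton_null; exists [set t | skeleton (rowt t)]; split.
Qed.

Lemma cont_shift (a : 'rV[R]_d) : continuous (fun x : 'rV[R]_d => a + x).
Proof.
move=> x W /near_rV[e e0 He]; apply/nbhs_ballP; exists e => //= y [_ xy].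
apply: He => i; rewrite !mxE opprD addrACA subrr add0r; exact: (xy 0 i).
Qed.

Lemma cont_dot (g : 'rV[R]_d) : continuous (fun x : 'rV[R]_d => dot g x).
Proof.
rewrite (_ : (fun x => _) = fun x : 'rV[R]_d => \sum_j g 0 j * x 0 j).
  apply: continuous_sumr => j; apply: cont_mul; first exact: cont_cst.
  by move=> y; exact: coord_continuous.
by apply/funext => x; rewrite dot_row.
Qed.

Lemma good_in_cell x : ~ skeleton x -> exists (K : cell T) (k : 'rV[int]_d) (e : R),
  0 < e /\ forall y : 'rV[R]_d, (forall i, `|x 0 i - y 0 i| < e) ->
    simplex (vertex K) (y - int_vec R k).
Proof.
move=> gx; have [K [k Kx]] := mesh_cover T x.
have /simplex_bary wx := Kx.
have near_i i : nbhs x [set y : 'rV[R]_d |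
    0 < dot (bary_lin K i) y + (bary_cst K i - dot (bary_lin K i) (int_vec R k))].
  have c : {for x, continuous (fun y : 'rV[R]_d => dot (bary_lin K i) y +
      (bary_cst K i - dot (bary_lin K i) (int_vec R k)))}.
    by apply: (@cont_add R _ (dot (bary_lin K i)) _ (@cont_dot _) (@cont_cst _ _ _)).
  apply: (cvgr_gt _ c); rewrite addrCA addrC -dotNr -dotDr lt_neqAle wx andbT eq_sym.
  by apply/eqP => w0; apply: gx; exists K, k, i.
have /near_rV[e e0 He] := @filter_forall _ _ _ _ (nbhs_filter x) near_i.
exists K, k, e; split=> // y /He /= yx; apply/simplex_bary => i.
by rewrite dotDr dotNr addrAC -addrA ltW.
Qed.

(** The cell and the radius are chosen before u, so that all basis functions can be treated on one
    cell. The difference quotients are exactly constant for small h, which yields the derivative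
    and, later, its measurability. *)
Lemma good_local x : ~ skeleton x -> exists (K : cell T) (e : R), 0 < e /\
  forall u (g : 'rV[R]_d) (c : R), V u ->
    (forall y, simplex (vertex K) y -> u y = dot g y + c) ->
    (forall h j, h != 0 -> `|h| < e ->
      h^-1 * (u (h *: delta_mx 0 j + x) - u x) = g 0 j) /\
    forall j, grad u x j 0 = g 0 j.
Proof.
move=> /good_in_cell[K [k [e [e0 He]]]]; exists K, e; split=> // u g c [_ pu _] ug.
have quot h j : h != 0 -> `|h| < e ->
    h^-1 * (u (h *: delta_mx 0 j + x) - u x) = g 0 j.
  move=> h0 he.
  have uE (y : 'rV[R]_d) : (forall i, `|x 0 i - y 0 i| < e) -> u y = dot g (y - int_vec R k) + c.
    by move=> /He Ky; rewrite -ug// -[RHS](pu k) subrK.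
  rewrite !uE => [|i|i].
  - have -> : dot g (h *: delta_mx 0 j + x - int_vec R k) =
        h * dot g (delta_mx 0 j) + dot g (x - int_vec R k).
      by rewrite -addrA [LHS]dotDr dotZr.
    rewrite opprD addrACA subrr addr0 addrK mulKf// dot_row (bigD1 j)//=.
    rewrite mxE !eqxx mulr1 big1 ?addr0// => i.
    by move=> /negPf ij; rewrite mxE eqxx ij mulr0.
  - by rewrite subrr normr0.
  - rewrite !mxE eqxx /= opprD addrCA subrr addr0 normrN normrM.
    apply: le_lt_trans he; rewrite ler_piMr//.
    by case: (i == j); rewrite ?normr1 ?normr0.
split=> // j; rewrite mxE; apply: cvg_lim => //.
apply: (@cvg_near_cst _ _ (g 0 j)).
near=> h; apply: (quot h j).
  by near: h; exact: nbhs_dnbhs_neq.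
near: h; apply: nbhs_dnbhs.
exists e => // h /=; by rewrite sub0r normrN.
Unshelve. all: by end_near.
Qed.

Lemma grad_bounded u : V u -> exists B, forall x j, ~ skeleton x -> `|grad u x j 0| <= B.
Proof.
move=> Vu; have [_ _ au] := Vu.
have /choice[g Hg] : forall K : cell T, exists g : 'rV[R]_d, exists c : R,
    forall y, simplex (vertex K) y -> u y = dot g y + c.
  exact: au.
exists (\sum_K \sum_j `|g K 0 j|) => x j /good_local[K [e [_ HK]]].
have [c uc] := Hg K; rewrite (HK u _ _ Vu uc).2 (bigD1 K)//= (bigD1 j)//= -addrA lerDl.
by rewrite addr_ge0// sumr_ge0// => i _; rewrite sumr_ge0.
Qed.

Lemma nice_grad u j : V u -> nice (fun x => grad u x j 0).
Proof.
move=> Vu; have [B HB] := grad_bounded Vu; have [mS S0] := skeleton_null.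
(* Set to zero on the skeleton, where [grad] may take a default value, the partial derivative is a
   pointwise limit of difference quotients of step 1 / (n + 1), each of them measurable. *)
pose G (t : d.-tuple MR) : R :=
  \1_(~` [set t | skeleton (rowt t)]) t * grad u (rowt t) j 0.
exists G; split.
- apply: (@measurable_fun_cvg _ _ _ _ (fun n (t : d.-tuple MR) =>
    \1_(~` [set t | skeleton (rowt t)]) t *
    (n.+1%:R * (u (n.+1%:R^-1 *: delta_mx 0 j + rowt t) - u (rowt t))))).
    move=> n; apply: measurable_funM.
      by apply: measurable_indic; exact: measurableC.
    have [cu _ _] := Vu.
    apply: (@measurable_continuous_row R d (fun x : 'rV[R]_d =>
      n.+1%:R * (u (n.+1%:R^-1 *: delta_mx 0 j + x) - u x))).
    apply: cont_mul; first exact: cont_cst.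
    apply: cont_add; last exact: cont_opp.
    move=> x; apply: (@continuous_comp _ _ _ (fun x => n.+1%:R^-1 *: delta_mx 0 j + x) u).
      exact: cont_shift.
    exact: cu.
  move=> t _; rewrite /G indicE; have [St|St] := pselect (skeleton (rowt t)).
    rewrite memNset; last by move=> /(_ St).
    by rewrite mul0r; apply: cvg_near_cst; apply: nearW => n; rewrite mul0r.
  rewrite mem_set// mul1r.
  have [K [e [e0 He]]] := good_local St.
  have [_ _ /(_ K)[g [c ug]]] := Vu; have [quot gE] := He u g c Vu ug.
  apply: cvg_near_cst; near=> n; rewrite mul1r gE -(quot n.+1%:R^-1 j) ?invrK//.
  rewrite ger0_norm// invf_plt ?posrE//.
  apply: lt_le_trans (_ : (Num.truncn e^-1).+1%:R <= _); first exact: truncnS_gt.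
  by rewrite ler_nat ltnS; near: n; exists (Num.truncn e^-1).
- exists `|B| => t; rewrite /G indicE; have [St|St] := pselect (skeleton (rowt t)).
    by rewrite memNset ?mul0r ?normr0//; move=> /(_ St).
  by rewrite mem_set// mul1r; apply: le_trans (HB _ _ St) (ler_norm _).
- apply: ae_cube1 ae_good => x gx; rewrite /G.
  have -> : rowt [tuple x 0 i | i < d] = x.
    by apply/rowP => i; rewrite mxE tnth_mktuple.
  rewrite indicE mem_set ?mul1r//=.
  by rewrite (_ : rowt _ = x)//; apply/rowP => i; rewrite mxE tnth_mktuple.
Unshelve. all: by end_near.
Qed.

End Gradient.

(** * Equivalence of norms on the finite-element space *)

Section Coercive.
Variables (R : realType) (d : nat) (T : mesh R d) (d_gt0 : (0 < d)%N).
Local Notation V := (fe_space T).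
Local Notation I := (@torus_integral R d).
Variables (n : nat) (b : 'I_n -> 'rV[R]_d -> R).
Hypotheses (Vb : forall i, V (b i))
  (bfree : forall c : 'rV[R]_n, (forall x, \sum_i c 0 i * b i x = 0) -> c = 0).

Lemma grad_comb_coord (c : 'rV[R]_n) : ae_cube (fun x => forall j,
  grad (comb b c) x j 0 = \sum_i c 0 i * grad (b i) x j 0).
Proof.
apply: ae_cube1 (ae_good T d_gt0) => x /good_local[K [e [_ HK]]] j.
have /choice[g Hg] : forall i : 'I_n, exists g : 'rV[R]_d, exists a : R,
    forall y, simplex (vertex K) y -> b i y = dot g y + a.
  by move=> i; have [_ _] := Vb i; apply.
have /choice[a Ha] := Hg.
have gE i : forall j, grad (b i) x j 0 = g i 0 j.
  exact: (HK _ _ _ (Vb i) (Ha i)).2.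
have lcK y : simplex (vertex K) y ->
    comb b c y = dot (\sum_i c 0 i *: g i) y + \sum_i c 0 i * a i.
  move=> Ky; rewrite (dotC (\sum_i _)) dot_sumr -big_split.
  by apply: eq_bigr => i _; rewrite Ha// dotZr mulrDr dotC.
rewrite (HK _ _ _ (fe_comb Vb c) lcK).2 summxE.
by apply: eq_bigr => i _; rewrite mxE gE.
Qed.

Lemma combB (c c' : 'rV[R]_n) x : comb b c x - comb b c' x = comb b (c - c') x.
Proof. by rewrite -sumrB; apply: eq_bigr => i _; rewrite !mxE mulrBl. Qed.

Lemma combZ a (c : 'rV[R]_n) x : comb b (a *: c) x = a * comb b c x.
Proof. by rewrite mulr_sumr; apply: eq_bigr => i _; rewrite mxE mulrA. Qed.

Lemma cont_near_rV m (f : 'rV[R]_m -> R) :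
  (forall (c : 'rV[R]_m) (e : R), 0 < e -> exists2 r : R, 0 < r & forall c' : 'rV[R]_m,
     (forall i, `|c 0 i - c' 0 i| < r) -> `|f c - f c'| < e) -> continuous f.
Proof.
move=> H c W /nbhs_ballP[e /= e0 He].
have [r r0 Hr] := H c e e0; apply/nbhs_ballP; exists r => //= c' [_ cc'].
by apply: He; apply: Hr => i; exact: (cc' 0 i).
Qed.

Lemma nice_abs_comb c : nice (fun x => `|comb b c x|).
Proof. by apply: nice_abs; exact: fe_nice (fe_comb Vb c). Qed.

(** The L^1 norm is continuous in the coefficients and vanishes for none on their unit sphere, so it
    has a positive minimum there; homogeneity does the rest. *)
Lemma comb_coercive : exists2 al : R, 0 < al & forall (c : 'rV[R]_n) i,
  al * `|c 0 i| <= I (fun x => `|comb b c x|).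
Proof.
have [n0|n_gt0] := posnP n.
  by exists 1 => // c i; have := ltn_ord i; rewrite [X in (_ < X)%N -> _]n0.
pose f (c : 'rV[R]_n) := I (fun x => `|comb b c x|).
have [C C0 HC] := comb_bound Vb.
have cf : continuous f.
  apply: cont_near_rV => c e e0.
  exists (e / (2 * C)) => [|c' cc']; first by rewrite divr_gt0// mulr_gt0.
  have lcc x : `|comb b c x - comb b c' x| <= e / 2.
    rewrite combB; apply: le_trans (HC _ (e / (2 * C)) _ _ x) _.
    - by rewrite divr_ge0 ?mulr_ge0// ltW.
    - by move=> i; rewrite !mxE ltW.
    - by rewrite (_ : C * _ = e / 2)//; field; rewrite gt_eqF.
  have half (c1 c2 : 'rV[R]_n) : (forall x, `|comb b c1 x - comb b c2 x| <= e / 2) ->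
      f c1 <= f c2 + e / 2.
    move=> H; rewrite -(@torus_integral_cst R d (e / 2)) -torus_integralD;
        [|exact: nice_abs_comb|exact: nice_cst].
    apply: torus_integral_le; [exact: nice_abs_comb|by apply: niceD;
        [exact: nice_abs_comb|exact: nice_cst]|].
    apply: ae_cubeW => x; rewrite -lerBlDl; apply: le_trans (H x).
    exact: lerB_dist.
  have h1 := half c c' lcc.
  have h2 := half c' c (fun x => le_trans (eq_ind _ (fun z =>
      z <= _) (lexx _) _ (distrC _ _)) (lcc x)).
  by rewrite ltr_norml; apply/andP; split; lra.
pose S := [set c : 'rV[R]_n | ip (c - 0) (c - 0) = 1].
have S0 : S !=set0.
  exists (delta_mx 0 (Ordinal n_gt0)); rewrite /S /= subr0 /ip (bigD1 (Ordinal n_gt0))//=.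
  rewrite mxE !eqxx mulr1 big1 ?addr0// => i /negPf ij.
  by rewrite mxE ij andbF mulr0.
have cS : compact S.
  apply: (@subclosed_compact _ S [set v : 'rV[R]_n | forall i, `[- 1, 1]%classic (v ord0 i)]).
  - rewrite (_ : S = (fun c : 'rV[R]_n => ip (c - 0) (c - 0)) @^-1` [set 1])//.
    apply: preimage_closed; last exact: closed_eq.
    by move=> x _; exact: continuous_ip_sqr.
  - exact: (@rV_compact R n (fun=> `[- 1, 1]%classic) (fun=> @segment_compact _ _ _)).
  move=> c; rewrite /S /= subr0 => c1 i; rewrite in_itv /= -ler_norml.
  by rewrite -(@expr_le1 _ 2)// real_normK ?num_real// -c1 ip_ge_sqr.
have [c0 c0S Hmin] := @compact_EVT_min _ R f S S0 cS (continuous_subspaceT cf).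
have f0 : 0 < f c0.
  rewrite lt_neqAle eq_sym; apply/andP; split; last first.
    by apply: torus_integral_ge0; [exact: nice_abs_comb|exact: ae_cubeW].
  apply/eqP => fc0; have [cu pu _] := fe_comb Vb c0.
  have /bfree c00 := torus_integral_abs_eq0 cu pu fc0.
  move: c0S; rewrite inE /S /= subr0 c00 /ip big1 => [/eqP|i _]; last by rewrite mxE mul0r.
  by rewrite eq_sym oner_eq0.
exists (f c0) => // c i.
have [cc0|] := eqVneq (ip c c) 0.
  have -> : c = 0 by apply: ip_eq0; rewrite cc0.
  rewrite mxE normr0 mulr0; apply: torus_integral_ge0; [exact: nice_abs_comb|exact: ae_cubeW].
rewrite -/(f c) => ccn0; pose r := Num.sqrt (ip c c).
have r0 : 0 < r by rewrite sqrtr_gt0 lt_neqAle eq_sym ccn0 ip_ge0.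
have fr : f c = r * f (r^-1 *: c).
  rewrite /f -torus_integralZ; last exact: nice_abs_comb.
  apply: torus_integral_ae_eq; apply: ae_cubeW => x.
  by rewrite combZ normrM gtr0_norm ?invr_gt0// mulVKf// gt_eqF.
have ci : `|c 0 i| <= r.
  rewrite -(@ler_pXn2r _ 2)// ?nnegrE ?(ltW r0)// real_normK ?num_real//.
  by rewrite sqr_sqrtr ?ip_ge0// ip_ge_sqr.
rewrite fr mulrC; apply: ler_pM => //; first exact: ltW.
apply: Hmin; rewrite inE /S /= subr0 ipZl ipZr mulrA -expr2.
by rewrite exprVn sqr_sqrtr ?ip_ge0// mulVf.
Qed.

End Coercive.

(** * Lower bounds from negative powers *)

Section Singular.
Variables (R : realType) (d : nat) (T : mesh R d) (d_gt0 : (0 < d)%N).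
Local Notation V := (fe_space T).
Local Notation I := (@torus_integral R d).

Lemma simplex_vertex (v : 'I_d.+1 -> 'rV[R]_d) p : simplex v (v p).
Proof.
exists (fun j => (j == p)%:R); split => //.
  by rewrite (bigD1 p)//= eqxx big1 ?addr0// => j /negPf ->.
rewrite (bigD1 p)//= eqxx scale1r big1 ?addr0// => j /negPf ->.
by rewrite scale0r.
Qed.

Lemma simplex_shrink K p (w : 'rV[R]_d) r : 0 <= r <= 1 -> simplex (vertex (m := T) K) w ->
  simplex (vertex K) (vertex K p + r *: (w - vertex K p)).
Proof.
move=> /andP[r0 r1] /(simplex_bary d_gt0) H; apply/(simplex_bary d_gt0) => i.
have /(simplex_bary d_gt0)/(_ i) := simplex_vertex (vertex K) p; have := H i.
rewrite !(dotDr, dotZr, dotNr) => w0 v0.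
rewrite (_ : _ + _ = (1 - r) * (dot (bary_lin d_gt0 K i) (vertex K p) + bary_cst d_gt0 K i)
  + r * (dot (bary_lin d_gt0 K i) w + bary_cst d_gt0 K i)); last by ring.
by rewrite addr_ge0// mulr_ge0// subr_ge0.
Qed.

Lemma simplex_interior K : exists (w : 'rV[R]_d) (e : R), 0 < e /\
  forall y : 'rV[R]_d, (forall i, `|w 0 i - y 0 i| < e) -> simplex (vertex (m := T) K) y.
Proof.
pose w := \sum_j (d.+1%:R^-1 : R) *: vertex K j.
have near_i i : nbhs w [set y : 'rV[R]_d |
    0 < dot (bary_lin d_gt0 K i) y + bary_cst d_gt0 K i].
  have c : {for w, continuous (fun y : 'rV[R]_d =>
      dot (bary_lin d_gt0 K i) y + bary_cst d_gt0 K i)}.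
    by apply: (@cont_add R _ (dot (bary_lin d_gt0 K i)) _ (@cont_dot _ _ _) (@cont_cst _ _ _)).
  apply: (cvgr_gt _ c); rewrite bary_weights ?invr_gt0//.
  by rewrite sumr_const card_ord -[LHS]mulr_natr mulVf// pnatr_eq0.
have /near_rV[e e0 He] := @filter_forall _ _ _ _ (nbhs_filter w) near_i.
exists w, e; split=> // y /He /= yw; apply/(simplex_bary d_gt0) => i; exact: ltW.
Qed.

(* Shrinking boxes towards the vertex [vertex K p], all contained in one integer
   translate of the unit cube; [s <= |w - vertex K p|_inf] keeps them off the vertex. *)
Lemma vertex_boxes K p : exists (al : 'I_d -> R) (s : R) (k : 'rV[int]_d), [/\ 0 < s,
  forall w : 'rV[R]_d,
    (forall i, al i <= w 0 i - vertex (m := T) K p 0 i < al i + s) -> simplex (vertex K) w,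
  forall i (x : R), al i <= x <= al i + s -> s <= `|x| &
  forall i r, 0 <= r <= 1 -> 0 <= vertex K p 0 i - (k 0 i)%:~R + r * al i /\
    vertex K p 0 i - (k 0 i)%:~R + r * al i + r * s <= 1].
Proof.
have [w [e [e0 He]]] := simplex_interior K; set v := vertex K p.
have [s0 [s00 s0E]] : exists s0, 0 < s0 /\ s0 = e / 4 by exists (e / 4); rewrite divr_gt0.
(* Relative to the vertex, each side of the box is shifted away from 0 in the direction of w: it
   keeps distance s0 from the vertex coordinate and, as e = 4 s0, stays within e of w. *)
pose al0 i := if 0 <= w 0 i - v 0 i then w 0 i - v 0 i + s0 else w 0 i - v 0 i - 2 * s0.
(* The translate puts v_i - k_i in [0, 1[ if the boxes extend upwards and in ]0, 1] if they extend
   downwards, so there is always space on the side that is used. [room i] is the largest scaling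
   that fits. *)
pose k : 'rV[int]_d := \row_i if 0 <= w 0 i - v 0 i then Num.floor (v 0 i) else Num.ceil (v 0
    i) - 1.
pose room i : R := if 0 <= w 0 i - v 0 i then (1 - (v 0 i - (k 0 i)%:~R)) / (al0 i + s0)
  else (v 0 i - (k 0 i)%:~R) / (- al0 i).
have room0 i : 0 < room i.
  rewrite /room /al0 /k mxE; case: (boolP (0 <= w 0 i - v 0 i)) => wv.
    rewrite divr_gt0//; last by lra.
    by have := floorD1_gt (v 0 i); rewrite rmorphD /=; lra.
  rewrite -ltNge in wv; rewrite divr_gt0//; last by lra.
  by have := ceilB1_lt (v 0 i); rewrite rmorphB /=; lra.
pose r0 := \big[Num.min/1]_i room i.
have r00 : 0 < r0.
  by rewrite /r0; elim/big_ind: _ => // a b a0 b0; rewrite lt_min a0.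
have r01 : r0 <= 1 by apply: bigmin_le_id.
have r0room i : r0 <= room i by apply: bigmin_le_cond.
exists (fun i => r0 * al0 i), (r0 * s0), k; split.
- exact: mulr_gt0.
- move=> w' Hw'; pose y := v + r0^-1 *: (w' - v).
  have -> : w' = v + r0 *: (y - v).
    by rewrite /y addrAC subrr add0r scalerA mulfV ?gt_eqF// scale1r addrC subrK.
  apply: simplex_shrink; first by rewrite ltW.
  apply: He => i; have := Hw' i; rewrite -mulrDr !mxE.
  rewrite -(ler_pdivlMl _ _ r00) -(ltr_pdivrMl _ _ r00) /al0.
  move: (r0^-1 * _) => z; rewrite -/v.
  case: ifPn => _ H; rewrite ltr_norml; lra.
- move=> i x /andP[h1 h2].
  have : al0 i <= r0^-1 * x <= al0 i + s0.
    by rewrite ler_pdivlMl// ler_pdivrMl// h1 mulrDr h2.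
  move=> H; rewrite -(ler_pdivlMl _ _ r00) -[X in X * `|x|]gtr0_norm ?invr_gt0// -normrM.
  move: (r0^-1 * x) H => z; rewrite /al0 ler_normr; case: ifPn; rewrite -?ltNge => wv H; lra.
move=> i r /andP[r_ge0 r_le1].
have rr : r * r0 <= room i by apply: le_trans (r0room i); rewrite ler_piMl// ltW.
have rr0 : 0 <= r * r0 by rewrite mulr_ge0// ltW.
rewrite !mulrA; move: (r * r0) rr rr0 => t.
rewrite /room /al0 /k mxE; case: (boolP (0 <= w 0 i - v 0 i)) => wv.
  have := floor_le (v 0 i).
  rewrite ler_pdivlMr; last by lra.
  move=> fl rr rr0; split; first by rewrite addr_ge0 ?subr_ge0// mulr_ge0//; lra.
  by lra.
rewrite -ltNge in wv.
have := ceil_ge (v 0 i); rewrite ler_pdivlMr; last by lra.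
rewrite rmorphB /= => fl rr rr0; split; first by lra.
have : t * (w 0 i - v 0 i - 2 * s0 + s0) <= 0 by rewrite mulr_ge0_le0//; lra.
lra.
Qed.

Lemma cont_powR (X : topologicalType) (f : X -> R) a : continuous f ->
  (forall x, 0 < f x) -> continuous (fun x => f x `^ a).
Proof.
move=> cf f0; apply: (@cont_comp _ _ f (fun y => y `^ a)) => // x.
apply: differentiable_continuous; apply/derivable1_diffP.
by apply: derivable_powR; rewrite in_itv /= andbT.
Qed.

(* Since q >= d, each of the boxes v + lam^j (Q - v), on which theta is at most
   theta(v) + lam^j B, contributes a fixed amount to the integral of theta^(-q) as long
   as theta(v) <= lam^j B; hence only boundedly many j satisfy this. *)
Lemma vertex_lower_bound K p (q B C : R) : d%:R <= q -> 0 < B ->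
  exists2 ka : R, 0 < ka & forall th, V th -> (forall x, 0 < th x) ->
    (forall x, th x <= B) -> I (fun x => th x `^ (- q)) <= C ->
    ka <= th (vertex (m := T) K p).
Proof.
move=> dq B0; have [al [s [k [s0 simp off box01]]]] := vertex_boxes K p.
pose i0 := Ordinal d_gt0; pose A := `|al i0| + s.
have sA : s <= A by rewrite lerDr.
have A0 : 0 < A by apply: lt_le_trans sA.
(* The i0-th coordinate of the box number j has distance at least lam^j s from the vertex and at
   most lam^j A. Since lam A = s / 2, the next box ends before the present one starts, so the boxes
   are disjoint. *)
pose lam := s / (2 * A).
have lam0 : 0 < lam by rewrite divr_gt0// mulr_gt0.
have lamA : lam * A = s / 2 by rewrite /lam; field; rewrite gt_eqF.
have lam1 : lam <= 1 by rewrite /lam ler_pdivrMr ?mulr_gt0//; lra.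
pose r j := lam ^+ j.
have r0 j : 0 < r j by rewrite exprn_gt0.
have lam_ge0 : 0 <= lam by exact: ltW.
have r1 j : r j <= 1 by exact: exprn_ile1.
have rle j j' : (j <= j')%N -> r j' <= r j.
  by move=> jj; rewrite -(subnK jj) /r exprD ler_piMl ?exprn_ge0 ?exprn_ile1.
pose c' := (2 * B) `^ (- q) * s ^+ d.
have c'0 : 0 < c' by rewrite mulr_gt0 ?exprn_gt0// powR_gt0// mulr_gt0.
(* If theta(v) were below lam^J B, all of the J boxes would contribute at least c' each, and J c' >
   C. *)
pose J := (Num.truncn (C / c')).+1.
exists (r J * B); first exact: mulr_gt0.
move=> th Vth th0 thB IC; rewrite leNgt; apply/negP => small.
have [cth pth ath] := Vth.
pose v := vertex K p.
pose bx j := box_indic (fun i => v 0 i - (k 0 i)%:~R + r j * al i) (r j * s).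
pose inb j (y : 'rV[R]_d) := forall i, v 0 i - (k 0 i)%:~R + r j * al i <= y 0 i <
    v 0 i - (k 0 i)%:~R + r j * al i + r j * s.
have inb_w j y : inb j y -> forall i,
    al i <= (r j)^-1 * (y 0 i + (k 0 i)%:~R - v 0 i) < al i + s.
  move=> yb i; have /andP[h1 h2] := yb i.
  rewrite ler_pdivlMl// ltr_pdivrMl// mulrDr; apply/andP; split; lra.
have claim1 j y : (j < J)%N -> inb j y -> th y <= 2 * B * r j.
  move=> jJ yb; have yw := inb_w j y yb.
  pose w := v + (r j)^-1 *: (y + int_vec R k - v).
  have Kw : simplex (vertex K) w.
    apply: simp => i; have := yw i; rewrite /w -/v !mxE.
    by rewrite [X in _ -> _ <= X < _]addrAC subrr add0r.
  have yE : y + int_vec R k = v + r j *: (w - v).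
    rewrite /w [in RHS]addrAC subrr add0r scalerA mulfV ?gt_eqF// scale1r.
    by rewrite [RHS]addrC subrK.
  have [g [c gc]] := ath K.
  rewrite -(pth k) yE gc; last by apply: simplex_shrink => //; rewrite r1 ltW.
  have vE : th v = dot g v + c by rewrite gc//; exact: simplex_vertex.
  have wE : th w = dot g w + c by rewrite gc.
  rewrite dotDr dotZr dotDr dotNr.
  rewrite (_ : _ + _ = (1 - r j) * th v + r j * th w); last by rewrite vE wE; ring.
  have tv : th v <= r j * B.
    by apply: le_trans (ltW small) _; rewrite ler_pM2r// rle// ltnW.
  rewrite (_ : 2 * B * r j = r j * B + r j * B); last by ring.
  apply: lerD; last by rewrite ler_pM2l.
  apply: le_trans tv; rewrite ler_piMl//; first by rewrite ltW// th0.
  by rewrite gerBl ltW.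
have claim2 j j' y : (j < j')%N -> inb j y -> inb j' y -> False.
  move=> jj /inb_w/(_ i0) /andP[a1 a2] /inb_w/(_ i0) /andP[b1 b2].
  move: a1 a2 b1 b2; set z := y 0 i0 + _ - _ => a1 a2 b1 b2.
  have : s <= `|(r j)^-1 * z| by apply: (off i0); rewrite a1 ltW.
  have : `|(r j')^-1 * z| <= A.
    rewrite /A ler_norml; have := ler_norm (al i0); have := ler_norm (- al i0).
    rewrite normrN => n1 n2; apply/andP; split; lra.
  have ri0 l : 0 < (r l)^-1 by rewrite invr_gt0.
  rewrite !normrM (gtr0_norm (ri0 j)) (gtr0_norm (ri0 j')).
  rewrite ler_pdivrMl// ler_pdivlMl// => h1 h2.
  have : r j * s <= r j' * A by apply: le_trans h1.
  rewrite -(subnK jj) addnS /r exprS mulrAC lamA.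
  have : lam ^+ (j' - j.+1 + j) <= lam ^+ j by apply: rle; rewrite leq_addl.
  rewrite -/(r j) => h3 h4.
  have : s / 2 * r j < r j * s by rewrite mulrC ltr_pM2l//; lra.
  have : s / 2 * lam ^+ (j' - j.+1 + j) <= s / 2 * r j by rewrite ler_pM2l// divr_gt0.
  move: h4; rewrite (mulrC (r j)); lra.
pose cj j := (2 * B * r j) `^ (- q).
have npow : nice (fun x => th x `^ (- q)).
  by apply: nice_continuous; exact: cont_powR.
have bx1 j y : inb j y -> bx j y = 1.
  by move=> H; rewrite /bx /box_indic asboolT.
have bx0 j y : ~ inb j y -> bx j y = 0.
  by move=> H; rewrite /bx /box_indic asboolF.
have nsum : nice (fun y => \sum_(j < J) cj j * bx j y).
  by apply: nice_sum => j _; apply: niceM; [exact: nice_cst|exact: nice_box].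
have : I (fun y => \sum_(j < J) cj j * bx j y) <= C.
  apply: le_trans IC; apply: torus_integral_le => //; apply: ae_cubeW => y.
  have [[j yb]|no] := pselect (exists j : 'I_J, inb j y); last first.
    rewrite big1 ?powR_ge0// => j _; rewrite bx0 ?mulr0// => H; apply: no.
    by exists j.
  rewrite (bigD1 j)//= big1 ?addr0 => [|j' jj']; last first.
    rewrite bx0 ?mulr0// => yb'; have := jj'; rewrite -val_eqE neq_ltn => /orP[] lt.
      exact: claim2 lt yb' yb.
    exact: claim2 lt yb yb'.
  rewrite bx1// mulr1 /cj !powRN lef_pV2 ?posrE ?powR_gt0//; last first.
    by rewrite !mulr_gt0.
  apply: ge0_ler_powR; rewrite ?nnegrE.
  - by apply: le_trans dq.
  - by rewrite ltW.
  - by rewrite !mulr_ge0// ltW.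
  - exact: claim1.
rewrite torus_integral_sum; last by move=> j _; apply: niceM; [exact: nice_cst|exact: nice_box].
apply/negP; rewrite -ltNge.
apply: (@lt_le_trans _ _ (\sum_(j < J) c')).
  rewrite sumr_const card_ord -mulr_natr mulrC -ltr_pdivrMr//.
  exact: truncnS_gt.
apply: ler_sum => j _; rewrite torus_integralZ; last exact: nice_box.
rewrite torus_integral_box; last 2 first.
- by rewrite mulr_ge0// ltW.
- by move=> i; apply: box01; rewrite r1 ltW.
have pM : (2 * B * r j) `^ (- q) = (2 * B) `^ (- q) * r j `^ (- q).
  by apply: powRM; rewrite ?mulr_ge0// ltW.
rewrite /cj /c' pM exprMn.
(* The place where q >= d enters: r^(-q) r^d >= 1 for 0 < r <= 1, so shrinking the box does not
   diminish its contribution. *)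
rewrite [leRHS](_ : _ = (2 * B) `^ (- q) * s ^+ d * (r j `^ (- q) * r j ^+ d));
  last by ring.
rewrite ler_peMr ?(ltW c'0)// powRN mulrC ler_pdivlMr ?powR_gt0// mul1r.
rewrite -powR_mulrn ?(ltW (r0 j))//.
by apply: ger_powR => //; rewrite r0 r1.
Qed.

Lemma fe_lower_bound (q B C : R) : d%:R <= q -> 0 < B ->
  exists2 ka : R, 0 < ka & forall th, V th -> (forall x, 0 < th x) ->
    (forall x, th x <= B) -> I (fun x => th x `^ (- q)) <= C -> forall x, ka <= th x.
Proof.
move=> dq B0.
have /choice[ka Hka] : forall a : cell T * 'I_d.+1, exists ka, 0 < ka /\ forall th, V th ->
    (forall x, 0 < th x) ->
    (forall x, th x <= B) -> I (fun x => th x `^ (- q)) <= C ->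
    ka <= th (vertex a.1 a.2).
  by move=> [K p]; have [ka ka0 H] := vertex_lower_bound K p C dq B0; exists ka.
exists (\big[Num.min/1]_a ka a).
  by elim/big_ind: _ => // [a b a0 b0|a _]; [rewrite lt_min a0|have [] := Hka a].
move=> th Vth th0 thB IC x; have [_ pth ath] := Vth.
have [K [k [w [w0 w1 xk]]]] := mesh_cover T x.
rewrite -(subrK (int_vec R k) x) pth xk (affine_on_simplex (ath K))//.
rewrite -[leLHS]mulr1 -w1 mulr_sumr; apply: ler_sum => i _.
rewrite mulrC ler_wpM2l//.
apply: le_trans (_ : ka (K, i) <= _); first exact: bigmin_le_cond.
by have [_] := Hka (K, i); apply.
Qed.

End Singular.

(** * The potential *)

Section Potential.
Variable R : realType.

Lemma is_derive_line (a h t : R) : is_derive t 1 (fun t => a + t * h) h.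
Proof.
apply: is_derive_eq; rewrite /GRing.scale /=; ring.
Qed.

Lemma is_derive_horner_line (c : {poly R}) (b h t : R) :
  is_derive t 1 (fun t => c.[b + t * h]) (h * c^`().[b + t * h]).
Proof.
elim/poly_ind: c => [|p k IH].
  rewrite deriv0 horner0 mulr0 (_ : (fun t => _) = cst 0); first exact: is_derive_cst.
  by apply/funext => s; rewrite horner0.
rewrite derivMXaddC !hornerE.
rewrite (_ : (fun t => _) = (fun t => p.[b + t * h] * (b + t * h) + k)); last first.
  by apply/funext => s; rewrite !hornerE.
have L := is_derive_line b h t.
apply: is_derive_eq; rewrite /GRing.scale /=; ring.
Qed.

Lemma eval2_MXaddC (F : {poly {poly R}}) c z :
  eval2 (F * 'X + c%:P) z = eval2 F z * z.1 + c.[z.2].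
Proof. by rewrite /eval2 !hornerE. Qed.

Lemma eval2_partials (F : {poly {poly R}}) : exists Fr Fe : {poly {poly R}},
  forall a b h k t : R, is_derive t 1 (fun t => eval2 F (a + t * h, b + t * k))
    (h * eval2 Fr (a + t * h, b + t * k) + k * eval2 Fe (a + t * h, b + t * k)).
Proof.
elim/poly_ind: F => [|F c [Fr [Fe IH]]].
  exists 0, 0 => a b h k t; rewrite /eval2 !horner0 !mulr0 addr0.
  rewrite (_ : (fun t => _) = cst 0); first exact: is_derive_cst.
  by apply/funext => s; rewrite !horner0.
exists (Fr * 'X + F), (Fe * 'X + (c^`())%:P) => a b h k t.
rewrite (_ : (fun t => _) = fun t => eval2 F (a + t * h, b + t * k) * (a + t * h)
    + c.[b + t * k]); last by apply/funext => s; rewrite eval2_MXaddC.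
have := IH a b h k t => IHt.
have L := is_derive_line a h t.
have H := is_derive_horner_line c b k t.
have e2 : eval2 (Fr * 'X + F) (a + t * h, b + t * k) =
    eval2 Fr (a + t * h, b + t * k) * (a + t * h) + eval2 F (a + t * h, b + t * k).
  by rewrite /eval2 !hornerE.
rewrite e2 eval2_MXaddC /=.
apply: is_derive_eq; rewrite /GRing.scale /=; ring.
Qed.

(** Derivatives along straight lines suffice: coordinate lines give [d_rho] and [d_eta], segments
    between two states give the tangent inequality of a convex function. *)
Definition has_grad (f : R * R -> R) (g : R * R -> R * R) :=
  forall a b h k t : R, is_derive t 1 (fun t => f (a + t * h, b + t * k))
    (h * (g (a + t * h, b + t * k)).1 + k * (g (a + t * h, b + t * k)).2).

Lemma has_grad_rho f g z : has_grad f g -> d_rho f z = (g z).1.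
Proof.
case: z => a b H; rewrite /d_rho /=.
have := H 0 b 1 0 a; rewrite add0r !mulr1 mulr0 addr0 mul1r mul0r addr0.
rewrite (_ : (fun t => _) = (fun r => f (r, b))); last first.
  by apply/funext => r; rewrite add0r mulr1 mulr0 addr0.
by move=> D; rewrite derive1E derive_val.
Qed.

Lemma has_grad_eta f g z : has_grad f g -> d_eta f z = (g z).2.
Proof.
case: z => a b H; rewrite /d_eta /=.
have := H a 0 0 1 b; rewrite add0r !mulr1 mulr0 addr0 mul1r mul0r add0r.
rewrite (_ : (fun t => _) = (fun r => f (a, r))); last first.
  by apply/funext => r; rewrite add0r mulr1 mulr0 addr0.
by move=> D; rewrite derive1E derive_val.
Qed.

(** Were the slope at z1 larger than f z0 - f z1, so would be the difference quotient for some small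
    step h in ]0, 1], against convexity on the segment. *)
Lemma convex_tangent f g (z1 z0 : R * R) : convex_R2 f -> has_grad f g ->
  (z0.1 - z1.1) * (g z1).1 + (z0.2 - z1.2) * (g z1).2 <= f z0 - f z1.
Proof.
move=> cf gf; have D := gf z1.1 z1.2 (z0.1 - z1.1) (z0.2 - z1.2) 0.
rewrite !mul0r !addr0 -surjective_pairing in D.
set phi := (fun t => _) in D; set d := _ + _ in D *.
rewrite leNgt; apply/negP => lt.
have cv : (h^-1 *: ((phi \o shift 0) (h *: 1) - phi 0)) @[h --> 0^'] --> d.
  have [dD dv] := D; rewrite -dv; exact: dD.
have [e /= e0 He] := cvgr_gt _ cv _ lt.
pose h := Num.min (e / 2) 1.
have h0 : 0 < h by rewrite /h lt_min ltr01 divr_gt0.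
have h1 : h <= 1 by rewrite /h ge_min lexx orbT.
have he : h < e by rewrite /h gt_min ltr_pdivrMr// ltr_pMr// ltr1n.
have := He h; rewrite /= sub0r normrN gtr0_norm// => /(_ he).
rewrite gt_eqF// => /(_ isT).
have phi0 : phi 0 = f z1 by rewrite /phi !mul0r !addr0 -surjective_pairing.
rewrite addr0 phi0 {1}/GRing.scale /= ltNge => /negP; apply.
rewrite ler_pdivrMl// lerBlDr.
have h01 : 0 <= h <= 1 by rewrite h1 ltW.
have := cf (Itv01 (ltW h0) h1) z0 z1; rewrite !inE => /(_ I I).
rewrite /conv /= => le.
have {}le : phi h%:A <= h * f z0 + (1 - h) * f z1.
  apply: le_trans le; rewrite /phi le_eqVlt; apply/orP; left; apply/eqP; congr f.
  rewrite [RHS]surjective_pairing /unstable.onem.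
  congr pair; rewrite /= /GRing.scale /=; ring.
by apply: le_trans le _; rewrite le_eqVlt; apply/orP; left; apply/eqP; ring.
Qed.

Definition normsq (z : R * R) : R := z.1 ^+ 2 + z.2 ^+ 2.

Lemma znorm_sqr z : znorm z ^+ 2 = normsq z.
Proof. by rewrite /znorm sqr_sqrtr// addr_ge0 ?sqr_ge0. Qed.

Definition quartic_grad (M th : R) (z : R * R) : R * R :=
  (4 * M * (1 + th) * (1 + normsq z) * z.1, 4 * M * (1 + th) * (1 + normsq z) * z.2).

Lemma quartic_has_grad M th : has_grad (fun z => quartic M z th) (quartic_grad M th).
Proof.
move=> a b h k t.
have La := is_derive_line a h t; have Lb := is_derive_line b k t.
rewrite (_ : (fun t => _) = (fun t => M * (1 + th) *
   (1 + ((a + t * h) * (a + t * h) + (b + t * k) * (b + t * k))) *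
   (1 + ((a + t * h) * (a + t * h) + (b + t * k) * (b + t * k))))); last first.
  by apply/funext => s; rewrite /quartic znorm_sqr /normsq /=; ring.
apply: is_derive_eq; rewrite /quartic_grad /normsq /GRing.scale /=; ring.
Qed.

Variables (P : potential R) (M : R).

Lemma psi_vex_grad : exists r0 e0 r1 e1 : {poly {poly R}}, forall th,
  has_grad (psi_vex P M ^~ th) (fun z =>
    (- eval2 r0 z + th * eval2 r1 z + (quartic_grad M th z).1,
     - eval2 e0 z + th * eval2 e1 z + (quartic_grad M th z).2)).
Proof.
have [r0 [e0 H0]] := eval2_partials (F0 P); have [r1 [e1 H1]] := eval2_partials (F1 P).
exists r0, e0, r1, e1 => th a b h k t.
have D0 := H0 a b h k t; have D1 := H1 a b h k t.
have DQ := quartic_has_grad M th a b h k t.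
rewrite /psi_vex /psi /=.
set c := ln th - _ - _; move: c => c.
apply: is_derive_eq; rewrite /GRing.scale /=; ring.
Qed.

Lemma psi_cav_grad th : has_grad (psi_cav M ^~ th)
  (fun z => (- (quartic_grad M th z).1, - (quartic_grad M th z).2)).
Proof.
move=> a b h k t; have DQ := quartic_has_grad M th a b h k t.
rewrite /psi_cav; apply: is_derive_eq; rewrite /=; ring.
Qed.

Lemma opp_has_grad f g : has_grad f g -> has_grad (fun z => - f z) (fun z => (- (g z).1,
    - (g z).2)).
Proof.
move=> H a b h k t; have D := H a b h k t.
apply: is_derive_eq; rewrite /=; ring.
Qed.

(** The tangent of the convex part is taken at the new state and that of the concave part at the old
    one, both at the same temperature; this is the purpose of the implicit-explicit splitting. *)
Lemma splitting_ineq (hM : admissible_splitting P M) (z0 z1 : R * R) th : 0 < th ->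
  psi P z1 th - psi P z0 th <=
  (d_rho (psi_vex P M ^~ th) z1 + d_rho (psi_cav M ^~ th) z0) * (z1.1 - z0.1) +
  (d_eta (psi_vex P M ^~ th) z1 + d_eta (psi_cav M ^~ th) z0) * (z1.2 - z0.2).
Proof.
move=> th0; have [r0 [e0 [r1 [e1 /(_ th) Hv]]]] := psi_vex_grad.
have Hc := psi_cav_grad th.
rewrite (has_grad_rho _ Hv) (has_grad_eta _ Hv) (has_grad_rho _ Hc) (has_grad_eta _ Hc).
have := convex_tangent z1 z0 (vex_convex hM th0) Hv.
have := convex_tangent z0 z1 (cav_concave hM th0) (opp_has_grad Hc).
rewrite /psi_vex /psi_cav /=.
move: (quartic_grad M th z1) (quartic_grad M th z0) => [q1 q2] [p1 p2] /=.
lra.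
Qed.

Lemma e_potE z th : 1 < qexp P -> 0 < th -> e_pot P z th =
  th^-1 - eps1 P * ln th + epsq P * th `^ (- qexp P) + eval2 (F1 P) z.
Proof.
move=> q1 th0; rewrite /e_pot derive1E.
have D1 := is_derive1_ln th0; have D2 := is_derive1_powR (1 - qexp P) th0.
rewrite /psi derive_val /GRing.scale /=.
rewrite (_ : 1 - qexp P - 1 = - qexp P); last by ring.
by field; rewrite subr_eq0 !gt_eqF.
Qed.

Lemma ln_le_sub1 (x : R) : 0 < x -> ln x <= x - 1.
Proof.
by move=> x0; have := @le_ln1Dx R (x - 1); rewrite (addrC 1) subrK; apply; lra.
Qed.

(** With x = b / a: x^p = exp(p ln x) >= 1 + p ln x >= 1 + p (x - 1), the last step because p <=
    0. *)
Lemma powR_tangent (p a b : R) : p <= 0 -> 0 < a -> 0 < b ->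
  a `^ p + p * a `^ (p - 1) * (b - a) <= b `^ p.
Proof.
move=> p0 a0 b0.
have X0 : 0 < b / a by rewrite divr_gt0.
have bernoulli : 1 + p * (b / a - 1) <= (b / a) `^ p.
  rewrite /powR gt_eqF//; apply: le_trans (expR_ge1Dx _).
  by rewrite lerD2l ler_wnM2l// ln_le_sub1.
have bE : b = a * (b / a) by rewrite mulrCA mulfV ?mulr1// gt_eqF.
rewrite [X in _ <= X `^ _]bE.
rewrite powRM ?(ltW a0) ?(ltW X0)// powRB; last by apply/implyP => _; rewrite gt_eqF.
rewrite powRr1 ?(ltW a0)//.
have E : a `^ p * (1 + p * (b / a - 1)) = a `^ p + p * (a `^ p / a) * (b - a).
  by field; rewrite gt_eqF.
by rewrite -E; apply: ler_wpM2l => //; exact: powR_ge0.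
Qed.

Lemma psi_concave (d : nat) (hP : admissible_potential d P) z a b : 0 < a -> 0 < b ->
  psi P z b <= psi P z a + e_pot P z a * (b - a).
Proof.
move=> a0 b0; have q1 := q_gt1 hP.
rewrite e_potE// /psi.
have q0 : 1 - qexp P <= 0 by rewrite subr_le0 ltW.
have := powR_tangent q0 a0 b0.
rewrite (_ : 1 - qexp P - 1 = - qexp P); last by ring.
move: (a `^ (1 - qexp P)) (b `^ (1 - qexp P)) (a `^ (- qexp P)) => A B A' AB.
have ln1 : ln b <= ln a + (b - a) / a.
  have := ln_le_sub1 (divr_gt0 b0 a0); rewrite ln_div ?posrE//.
  by rewrite mulrBl divff ?gt_eqF// => H; lra.
have ln2 : b * (ln a - ln b) <= a - b.
  have := ln_le_sub1 (divr_gt0 a0 b0); rewrite ln_div ?posrE// => H.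
  have <- : b * (a / b - 1) = a - b by field; rewrite gt_eqF.
  by apply: ler_wpM2l => //; exact: ltW.
have e1 := eps1_gt0 hP; have eq := epsq_gt0 hP.
have k0 : 0 < epsq P / (qexp P - 1) by rewrite divr_gt0// subr_gt0.
have := ler_wpM2l (ltW k0) AB; have := ler_wpM2l (ltW e1) ln2.
have E : epsq P / (qexp P - 1) * (A + (1 - qexp P) * A' * (b - a)) =
    epsq P / (qexp P - 1) * A - epsq P * A' * (b - a).
  by field; rewrite subr_eq0 gt_eqF.
rewrite E; move: (epsq P / _) => k.
have : (b - a) / a = a^-1 * (b - a) by rewrite mulrC.
move: ln1; move: ((b - a) / a) (a^-1) => x y ln1 xy h1 h2.
rewrite xy in ln1.
lra.
Qed.

(** In psi - theta e the terms theta F_1 cancel, so that adding a e leaves a F_1 - F_0. The good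
    terms in theta are eps1 theta, a / theta and a epsq theta^(-q); a logarithm of either sign and -
    A theta^(1-q) have to be absorbed. *)
Lemma entropy_coercive (d : nat) (hP : admissible_potential d P) :
  exists a k C : R, [/\ 0 < a, 0 < k & forall z th, 0 < th ->
    k * (normsq z ^+ 2 + th + th `^ (- qexp P)) - C <=
    psi P z th - th * e_pot P z th + a * e_pot P z th].
Proof.
have [a [c [C [a0 c0 C0 Hc]]]] := coercive hP.
have e1 := eps1_gt0 hP; have eq := epsq_gt0 hP; have q1 := q_gt1 hP.
pose q := qexp P.
pose A := epsq P * q / (q - 1).
have q0 : 0 < q by rewrite /q; lra.
have qm0 : 0 < q - 1 by rewrite /q; lra.
have A0 : 0 < A by rewrite /A divr_gt0// mulr_gt0.
(* Below this threshold A theta^(1-q) is at most half of a epsq theta^(-q); above it, it is bounded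
   by its value at [ts]. *)
pose ts := a * epsq P / (2 * A).
have ts0 : 0 < ts by rewrite divr_gt0// mulr_gt0.
have [B [B0 BE]] : exists B, 0 < B /\ `|1 - a * eps1 P| <= B.
  by exists (`|1 - a * eps1 P| + 1); rewrite ltr_pwDr// lerDl.
(* From |ln theta| <= de theta + de / theta + |ln de|; this choice lets B |ln theta| be absorbed by
   eps1 theta / 2 and a / theta. *)
pose de := Num.min (eps1 P / 2) a / B.
have de0 : 0 < de by rewrite divr_gt0// lt_min a0 divr_gt0.
have deB : de * B <= eps1 P / 2 by rewrite /de divfK ?gt_eqF// ge_min lexx.
have deB' : de * B <= a by rewrite /de divfK ?gt_eqF// ge_min lexx orbT.
pose C1 := B * (1 + `|ln de|).
exists a, (Num.min c (Num.min (eps1 P / 2) (a * epsq P / 2))),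
  (C + C1 + A * ts `^ (1 - q) + 1); split=> //.
  by rewrite !lt_min c0 !divr_gt0// mulr_gt0.
move=> z th th0; rewrite e_potE// -/q.
set k := Num.min _ _.
have k1 : k <= c by rewrite ge_min lexx.
have k2 : k <= eps1 P / 2 by rewrite ge_min ge_min lexx orbT.
have k3 : k <= a * epsq P / 2 by rewrite ge_min ge_min lexx !orbT.
have Y0 : 0 <= th `^ (- q) by apply: powR_ge0.
have pE : th `^ (1 - q) = th * th `^ (- q).
  rewrite powRD ?powRr1 ?(ltW th0)//; by apply/implyP => _; rewrite gt_eqF.
have hz := Hc z; rewrite (_ : znorm z ^+ 4 = normsq z ^+ 2) in hz; last first.
  by rewrite -znorm_sqr -exprM.
have hY : A * (th * th `^ (- q)) <= a * epsq P / 2 * th `^ (- q) + A * ts `^ (1 - q).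
  have [le|gt] := leP th ts.
    apply: ler_wpDr; first by rewrite mulr_ge0 ?powR_ge0// ltW.
    rewrite mulrA ler_wpM2r// -ler_pdivlMl//.
    by rewrite (_ : A^-1 * _ = ts)// /ts; field; rewrite gt_eqF.
  apply: ler_wpDl; first by rewrite mulr_ge0// divr_ge0 ?mulr_ge0// ltW.
  rewrite ler_pM2l// -pE (_ : 1 - q = - (q - 1)); last by ring.
  rewrite !powRN lef_pV2 ?posrE ?powR_gt0//.
  by apply: ge0_ler_powR; rewrite ?nnegrE ?subr_ge0 ?(ltW q1) ?(ltW th0) ?(ltW ts0) ?(ltW gt).
have hln : - ((1 - a * eps1 P) * ln th) <= eps1 P / 2 * th + a / th + C1.
  have l1 : ln th <= de * th + `|ln de|.
    have := ln_le_sub1 (mulr_gt0 de0 th0); rewrite lnM ?posrE//.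
    have := ler_norm (- ln de); rewrite normrN; lra.
  have l2 : - ln th <= de / th + `|ln de|.
    have th0' : 0 < th^-1 by rewrite invr_gt0.
    have := ln_le_sub1 (mulr_gt0 de0 th0'); rewrite lnM ?posrE// lnV ?posrE//.
    have := ler_norm (- ln de); rewrite normrN; lra.
  have l3 : `|ln th| <= de * th + de / th + `|ln de|.
    have p1 : 0 <= de * th by rewrite mulr_ge0// ltW.
    have p2 : 0 <= de / th by rewrite divr_ge0// ltW.
    by rewrite ler_norml; apply/andP; split; lra.
  apply: le_trans (ler_norm _) _; rewrite normrN normrM.
  apply: le_trans (_ : B * (de * th + de / th + `|ln de|) <= _).
    by apply: ler_pM.
  have u1 := ler_wpM2r (ltW th0) deB.
  have u2 : de * B / th <= a / th by rewrite ler_wpM2r// invr_ge0 ltW.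
  by rewrite /C1; move: (th^-1) u2 => ti u2; lra.
have w1 := ler_wpM2r (sqr_ge0 (normsq z)) k1.
have w2 := ler_wpM2r (ltW th0) k2.
have w3 := ler_wpM2r Y0 k3.
rewrite /psi -/q pE mulrDr mulrDr.
have E : ln th - eps1 P * th * (ln th - 1) - epsq P / (q - 1) * (th * th `^ (- q))
     - eval2 (F0 P) z + th * eval2 (F1 P) z
     - th * (th^-1 - eps1 P * ln th + epsq P * th `^ (- q) + eval2 (F1 P) z)
     + a * (th^-1 - eps1 P * ln th + epsq P * th `^ (- q) + eval2 (F1 P) z) =
   (1 - a * eps1 P) * ln th - 1 + eps1 P * th - A * (th * th `^ (- q))
     + a / th + a * epsq P * th `^ (- q) + (a * eval2 (F1 P) z - eval2 (F0 P) z).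
  rewrite /A; field; rewrite gt_eqF//= gt_eqF//= /q; lra.
rewrite E; move: (A * (th * _)) (A * ts `^ _) hY => x1 x2 hY.
move: (a / th) hln => x3 hln; move: ((1 - a * eps1 P) * ln th) hln => x4 hln.
lra.
Qed.

End Potential.

(** * Families of integrands *)

Section Families.
Variables (R : realType) (d N : nat) (K : set 'rV[R]_N).
Local Notation I := (@torus_integral R d).
Implicit Types (f g : 'rV[R]_N -> 'rV[R]_d -> R) (c : 'rV[R]_N).

Definition ae_near f c (e r : R) := forall c', K c' -> (forall i, `|c 0 i - c' 0 i| < r) ->
  ae_cube (fun x => `|f c x - f c' x| <= e).

(** Integrands depending on the coefficient vector c: bounded uniformly over K, and continuous in c
    uniformly in x, both off null sets that may depend on c, as gradients require. Boundedness makes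
    the class closed under products, and the integrals are continuous and bounded on K. *)
Record ufam f : Prop := UFam {
  ufam_nice : forall c, K c -> nice (f c);
  ufam_bounded : exists2 B : R, 0 <= B & forall c, K c -> ae_cube (fun x => `|f c x| <= B);
  ufam_cont : forall c e, K c -> 0 < e -> exists2 r : R, 0 < r & ae_near f c e r }.

Lemma nice_bounded (g : 'rV[R]_d -> R) : nice g ->
  exists2 B : R, 0 <= B & ae_cube (fun x => `|g x| <= B).
Proof.
move=> [h [_ [B HB] gh]]; exists `|B| => //.
by apply: ae_cube1 gh => x ->; apply: le_trans (HB _) (ler_norm _).
Qed.

Lemma ufam_cst (g : 'rV[R]_d -> R) : nice g -> ufam (fun _ => g).
Proof.
move=> ng; split=> //; first by have [B B0 HB] := nice_bounded ng; exists B.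
move=> c e _ e0; exists 1 => // c' _ _; apply: ae_cubeW => x.
by rewrite subrr normr0 ltW.
Qed.

Lemma ufam_ext f g : (forall c x, K c -> f c x = g c x) -> ufam f -> ufam g.
Proof.
move=> fg [nf [B B0 HB] cf]; split.
- by move=> c Kc; apply: nice_eq (nf c Kc); apply: ae_cubeW => x; exact: fg.
- by exists B => // c Kc; apply: ae_cube1 (HB c Kc) => x; rewrite fg.
- move=> c e Kc e0; have [r r0 H] := cf c e Kc e0; exists r => // c' Kc' cc'.
  by apply: ae_cube1 (H c' Kc' cc') => x; rewrite !fg.
Qed.

Lemma ufam_add f g : ufam f -> ufam g -> ufam (fun c x => f c x + g c x).
Proof.
move=> [nf [B B0 HB] cf] [ng [B' B0' HB'] cg]; split.
- by move=> c Kc; apply: niceD; [exact: nf|exact: ng].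
- exists (B + B'); first exact: addr_ge0.
  move=> c Kc; apply: ae_cube2 (HB c Kc) (HB' c Kc) => x h1 h2.
  by apply: le_trans (ler_normD _ _) _; exact: lerD.
- move=> c e Kc e0; have e20 : 0 < e / 2 by rewrite divr_gt0.
  have [r r0 H] := cf c _ Kc e20; have [r' r0' H'] := cg c _ Kc e20.
  exists (Num.min r r'); first by rewrite lt_min r0.
  have h1 : Num.min r r' <= r by rewrite ge_min lexx.
  have h2 : Num.min r r' <= r' by rewrite ge_min lexx orbT.
  move=> c' Kc' cc'.
  have := H' c' Kc' (fun i => lt_le_trans (cc' i) h2).
  apply: ae_cube2 (H c' Kc' (fun i => lt_le_trans (cc' i) h1)) => x l1 l2.
  rewrite opprD addrACA (splitr e); apply: le_trans (ler_normD _ _) _; exact: lerD.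
Qed.

Lemma ufam_mul f g : ufam f -> ufam g -> ufam (fun c x => f c x * g c x).
Proof.
move=> [nf [B B0 HB] cf] [ng [B' B0' HB'] cg]; split.
- by move=> c Kc; apply: niceM; [exact: nf|exact: ng].
- exists (B * B'); first exact: mulr_ge0.
  move=> c Kc; apply: ae_cube2 (HB c Kc) (HB' c Kc) => x h1 h2.
  by rewrite normrM; exact: ler_pM.
- move=> c e Kc e0; pose e1 := e / (B + B' + 1).
  have BB : 0 < B + B' + 1 by rewrite ltr_pwDr// addr_ge0.
  have e10 : 0 < e1 by rewrite divr_gt0.
  have [r r0 H] := cf c _ Kc e10; have [r' r0' H'] := cg c _ Kc e10.
  exists (Num.min r r'); first by rewrite lt_min r0.
  have h1 : Num.min r r' <= r by rewrite ge_min lexx.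
  have h2 : Num.min r r' <= r' by rewrite ge_min lexx orbT.
  move=> c' Kc' cc'.
  have A1 := H c' Kc' (fun i => lt_le_trans (cc' i) h1).
  have A2 := H' c' Kc' (fun i => lt_le_trans (cc' i) h2).
  have A3 := ae_cube2 (fun x a b => conj a b) A1 A2.
  have A4 := ae_cube2 (fun x a b => conj a b) (HB c' Kc') (HB' c Kc).
  apply: ae_cube2 A3 A4 => x [l1 l2] [l3 l4].
  rewrite (_ : _ - _ = (f c x - f c' x) * g c x + f c' x * (g c x - g c' x)); last by ring.
  apply: le_trans (ler_normD _ _) _; rewrite !normrM.
  apply: le_trans (_ : e1 * B' + B * e1 <= _); first by apply: lerD; exact: ler_pM.
  rewrite mulrC -mulrDl /e1 mulrC mulrAC ler_pdivrMr// ler_pM2l//; lra.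
Qed.

Lemma ufam_opp f : ufam f -> ufam (fun c x => - f c x).
Proof.
move=> uf; apply: (@ufam_ext (fun c x => -1 * f c x)).
  by move=> c x _; rewrite mulN1r.
by apply: ufam_mul => //; apply: ufam_cst; exact: nice_cst.
Qed.

Lemma ufam_sub f g : ufam f -> ufam g -> ufam (fun c x => f c x - g c x).
Proof. by move=> uf ug; apply: ufam_add => //; exact: ufam_opp. Qed.

Lemma ufam_const (a : R) : ufam (fun _ _ => a).
Proof. by apply: ufam_cst; exact: nice_cst. Qed.

Lemma ufam_scale (a : R) f : ufam f -> ufam (fun c x => a * f c x).
Proof. by move=> uf; apply: ufam_mul => //; exact: ufam_const. Qed.

Lemma ufam_sum (J : Type) (r : seq J) (F : J -> 'rV[R]_N -> 'rV[R]_d -> R) :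
  (forall j, ufam (F j)) -> ufam (fun c x => \sum_(j <- r) F j c x).
Proof.
move=> uF; elim: r => [|j r IH].
  by apply: ufam_ext (ufam_const 0) => c x _; rewrite big_nil.
apply: (@ufam_ext (fun c x => F j c x + \sum_(j <- r) F j c x)).
  by move=> c x _; rewrite big_cons.
exact: ufam_add.
Qed.

(** Meant for inverse, logarithm and negative powers, which are Lipschitz only away from 0; [y0]
    anchors the bound on phi. *)
Lemma ufam_lipschitz (D : R -> Prop) (phi : R -> R) (La y0 : R) f : 0 <= La -> D y0 ->
  (forall y y', D y -> D y' -> `|phi y - phi y'| <= La * `|y - y'|) ->
  (forall c x, K c -> D (f c x)) -> (forall c, K c -> nice (fun x => phi (f c x))) ->
  ufam f -> ufam (fun c x => phi (f c x)).
Proof.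
move=> La0 Dy0 lip Df nphi [nf [B B0 HB] cf]; split=> //.
- exists (`|phi y0| + La * (B + `|y0|)).
    by rewrite addr_ge0// mulr_ge0// addr_ge0.
  move=> c Kc; apply: ae_cube1 (HB c Kc) => x h.
  have := lip _ _ (Df c x Kc) Dy0; rewrite -lerBlDl => l.
  apply: le_trans (lerB_dist _ _) _; apply: le_trans l _.
  rewrite ler_wpM2l//; apply: le_trans (ler_normB _ _) _; exact: lerD.
- move=> c e Kc e0; have e10 : 0 < e / (La + 1) by rewrite divr_gt0// ltr_wpDl.
  have [r r0 H] := cf c _ Kc e10; exists r => // c' Kc' cc'.
  apply: ae_cube1 (H c' Kc' cc') => x l.
  apply: le_trans (lip _ _ (Df c x Kc) (Df c' x Kc')) _.
  apply: le_trans (ler_wpM2l La0 l) _.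
  rewrite mulrCA ler_piMr ?(ltW e0)// ler_pdivrMr ?ltr_wpDl// mul1r; lra.
Qed.

Lemma ufam_horner (p : {poly R}) f : ufam f -> ufam (fun c x => p.[f c x]).
Proof.
move=> uf; elim/poly_ind: p => [|p k IH].
  by apply: ufam_ext (ufam_const 0) => c x _; rewrite horner0.
apply: (@ufam_ext (fun c x => p.[f c x] * f c x + k)).
  by move=> c x _; rewrite !hornerE.
by apply: ufam_add; [exact: ufam_mul|exact: ufam_const].
Qed.

Lemma ufam_eval2 (F : {poly {poly R}}) f g : ufam f -> ufam g ->
  ufam (fun c x => eval2 F (f c x, g c x)).
Proof.
move=> uf ug; elim/poly_ind: F => [|F p IH].
  by apply: ufam_ext (ufam_const 0) => c x _; rewrite /eval2 !horner0.
apply: (@ufam_ext (fun c x => eval2 F (f c x, g c x) * f c x + p.[g c x])).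
  by move=> c x _; rewrite eval2_MXaddC.
by apply: ufam_add; [exact: ufam_mul|exact: ufam_horner].
Qed.

Lemma ufam_coord (B : R) i : 0 <= B -> (forall c, K c -> `|c 0 i| <= B) ->
  ufam (fun c _ => c 0 i).
Proof.
move=> B0 HB; split.
- by move=> c _; exact: nice_cst.
- by exists B => // c Kc; apply: ae_cubeW => x; exact: HB.
- move=> c e Kc e0; exists e => // c' Kc' cc'; apply: ae_cubeW => x.
  exact: ltW.
Qed.

Lemma ufam_dot m (F G : 'rV[R]_N -> 'rV[R]_d -> 'cV[R]_m) :
  (forall i, ufam (fun c x => F c x i 0)) -> (forall i, ufam (fun c x => G c x i 0)) ->
  ufam (fun c x => dot (F c x) (G c x)).
Proof.
move=> uF uG; apply: (@ufam_ext (fun c x => \sum_i F c x i 0 * G c x i 0)).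
  by move=> c x _; apply: eq_bigr => i _; rewrite big_ord1.
by apply: ufam_sum => i; exact: ufam_mul.
Qed.

Lemma ufam_torus_integral_cont f : ufam f -> forall c e, K c -> 0 < e -> exists2 r : R, 0 < r &
  forall c', K c' -> (forall i, `|c 0 i - c' 0 i| < r) -> `|I (f c) - I (f c')| < e.
Proof.
move=> [nf _ cf] c e Kc e0; have e20 : 0 < e / 2 by rewrite divr_gt0.
have [r r0 H] := cf c _ Kc e20; exists r => // c' Kc' cc'.
have A := H c' Kc' cc'; have [n1 n2] := (nf c Kc, nf c' Kc').
apply: (@le_lt_trans _ _ (e / 2)); last by rewrite ltr_pdivrMr// ltr_pMr// ltr1n.
rewrite -torus_integralB// ler_norml; apply/andP; split.
  rewrite -(@torus_integral_cst R d (- (e / 2))); apply: torus_integral_le;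
      [exact: nice_cst|exact: niceB|].
  by apply: ae_cube1 A => x; rewrite ler_norml => /andP[].
rewrite -(@torus_integral_cst R d (e / 2)); apply: torus_integral_le;
    [exact: niceB|exact: nice_cst|].
by apply: ae_cube1 A => x; rewrite ler_norml => /andP[].
Qed.

Lemma ufam_torus_integral_bounded f : ufam f -> exists2 B : R, 0 <= B & forall c, K c ->
    `|I (f c)| <= B.
Proof.
move=> [nf [B B0 HB] _]; exists B => // c Kc; have n1 := nf c Kc.
rewrite ler_norml; apply/andP; split.
  rewrite -(@torus_integral_cst R d (- B)); apply: torus_integral_le => //; first exact: nice_cst.
  by apply: ae_cube1 (HB c Kc) => x; rewrite ler_norml => /andP[].
rewrite -(@torus_integral_cst R d B); apply: torus_integral_le => //; first exact: nice_cst.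
by apply: ae_cube1 (HB c Kc) => x; rewrite ler_norml => /andP[].
Qed.

End Families.

(** * The pointwise entropy inequality *)

Section Blocks.
Variables (R : realType) (d : nat).

Lemma dot_col m (X Y : 'cV[R]_m) : dot X Y = (X^T *m Y) 0 0.
Proof. by rewrite mxE; apply: eq_bigr => i _; rewrite big_ord1 mxE. Qed.

Lemma dot_col_mx m1 m2 (X1 Y1 : 'cV[R]_m1) (X2 Y2 : 'cV[R]_m2) :
  dot (col_mx X1 X2) (col_mx Y1 Y2) = dot X1 Y1 + dot X2 Y2.
Proof. by rewrite !dot_col tr_col_mx mul_row_col mxE. Qed.

Definition flux1 (A : 'M[R]_(d + d + 1)) (gm gt : 'cV[R]_d) (w : R) : 'cV[R]_d :=
  blk11 A *m gm - blk12 A *m gt + w *: blk13 A.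
Definition flux3 (A : 'M[R]_(d + d + 1)) (gm gt : 'cV[R]_d) (w : R) : 'cV[R]_d :=
  (blk12 A)^T *m gm - blk22 A *m gt + w *: blk23 A.
Definition flux4 (A : 'M[R]_(d + d + 1)) (gm gt : 'cV[R]_d) (w : R) : R :=
  dot (blk13 A) gm - dot (blk23 A) gt + blk33 A * w.

(** The minus sign of the temperature gradient in [zeta] makes the three fluxes the blocks of A
    zeta; symmetry of A provides the lower blocks, which the scheme writes as transposes of the
    upper ones. *)
Lemma mobility_form (A : 'M[R]_(d + d + 1)) (gm gt : 'cV[R]_d) (w : R) : A^T = A ->
  let zeta : 'cV[R]_(d + d + 1) := col_mx (col_mx gm (- gt)) w%:M in
  (zeta^T *m A *m zeta) 0 0 =
  dot (flux1 A gm gt w) gm - dot (flux3 A gm gt w) gt + flux4 A gm gt w * w.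
Proof.
move=> symA zeta; rewrite -mulmxA -dot_col dotC.
have AE : A *m zeta = col_mx (col_mx (flux1 A gm gt w) (flux3 A gm gt w))
    (flux4 A gm gt w)%:M.
  have e1 : dlsubmx A = (ursubmx A)^T by rewrite trmx_ursub symA.
  have e2 : dlsubmx (ulsubmx A) = (ursubmx (ulsubmx A))^T.
    by rewrite trmx_ursub trmx_ulsub symA.
  have AB : A = block_mx (ulsubmx A) (ursubmx A) (ursubmx A)^T (drsubmx A).
    by rewrite -e1 submxK.
  have UB : ulsubmx A = block_mx (blk11 A) (blk12 A) (blk12 A)^T (blk22 A).
    by rewrite /blk12 -e2 submxK.
  have RB : ursubmx A = col_mx (blk13 A) (blk23 A) by rewrite vsubmxK.
  rewrite [in LHS]AB mul_block_col [in LHS]UB [in LHS]RB; congr col_mx.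
    by rewrite mul_block_col mul_col_mx add_col_mx !mulmxN !mul_mx_scalar.
  rewrite tr_col_mx mul_row_col; apply/matrixP => i j.
  rewrite !ord1 /flux4 !dot_col mulmxN mul_mx_scalar.
  by rewrite /blk33 !mxE mulr1n mulrC.
rewrite AE !dot_col_mx dotNr; congr (_ + _).
by rewrite /dot !big_ord1 !mxE /= !mulr1n.
Qed.

End Blocks.

Section PointwiseEntropy.
Variables (R : realType) (d : nat).

Lemma half_sqr_le m (X Y : 'cV[R]_m) : - (dot Y Y / 2) <= dot X (X - Y).
Proof.
rewrite dotDr dotNr.
have h : 0 <= dot (X - Y) (X - Y).
  by apply: sumr_ge0 => i _; apply: sumr_ge0 => j _; exact: sqr_ge0.
have h' : 0 <= dot X X.
  by apply: sumr_ge0 => i _; apply: sumr_ge0 => j _; exact: sqr_ge0.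
move: h; rewrite !(dotDl, dotDr, dotNl, dotNr) (dotC Y X).
move: h'; move: (dot X X) (dot X Y) (dot Y Y) => x y z; lra.
Qed.

(** The right-hand side is the integrand of the residuals tested with the difference to the
    comparison state. The products of mu and nu with the increments cancel, and the fluxes give a
    nonnegative quadratic form, which is dropped. Splitting in z at temperature t1 and concavity in
    theta at (r0, e0) give psi_1 - psi_0 - e_0 (t1 - t0) <= G . (z_1 - z_0); subtracting (e_1 - e_0)
    (t1 - a) turns the left side into the increment of S. Of the gradient energies only the old ones
    are kept. *)
Lemma entropy_pointwise (P : potential R) (hP : admissible_potential d P)
    (M : R) (hM : admissible_splitting P M) (A : 'M[R]_(d + d + 1)) (symA : A^T = A)
    (posA : forall zeta : 'cV[R]_(d + d + 1), 0 <= (zeta^T *m A *m zeta) 0 0)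
    (tau gr ge a : R) (htau : 0 < tau) (hgr : 0 < gr) (hge : 0 < ge)
    (r0 e0 t0 r1 e1 t1 mu nu : R) (gr0 ge0 gr1 ge1 gm gt : 'cV[R]_d) :
  0 < t0 -> 0 < t1 ->
  let Gr := d_rho (psi_vex P M ^~ t1) (r1, e1) + d_rho (psi_cav M ^~ t1) (r0, e0) in
  let Ge := d_eta (psi_vex P M ^~ t1) (r1, e1) + d_eta (psi_cav M ^~ t1) (r0, e0) in
  let S r e t := psi P (r, e) t - t * e_pot P (r, e) t + a * e_pot P (r, e) t in
  tau^-1 * (S r1 e1 t1 - (S r0 e0 t0 + gr / 2 * dot gr0 gr0 + ge / 2 * dot ge0 ge0)) <=
    ((Gr - mu) / tau * (r1 - r0) + dot ((gr / tau) *: gr1) (gr1 - gr0)) +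
    ((r1 - r0) / tau * mu + dot (flux1 A gm gt nu) gm) +
    (- ((e_pot P (r1, e1) t1 - e_pot P (r0, e0) t0) / tau) * (t1 - a) +
       dot (- flux3 A gm gt nu) gt) +
    ((Ge - nu) / tau * (e1 - e0) + dot ((ge / tau) *: ge1) (ge1 - ge0)) +
    ((e1 - e0) / tau + flux4 A gm gt nu) * nu.
Proof.
move=> t00 t10; cbv zeta; set Gr := d_rho _ _ + d_rho _ _; set Ge := d_eta _ _ + d_eta _ _.
have hs := splitting_ineq hM (r0, e0) (r1, e1) t10.
have hc := psi_concave hP (r0, e0) t00 t10.
have hq := mobility_form gm gt nu symA; rewrite /= in hq.
have := posA (col_mx (col_mx gm (- gt)) nu%:M); rewrite hq => hpos.
rewrite !dotZl dotNl.
have h1 : gr / tau * - (dot gr0 gr0 / 2) <= gr / tau * dot gr1 (gr1 - gr0).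
  by rewrite ler_pM2l ?half_sqr_le// divr_gt0.
have h2 : ge / tau * - (dot ge0 ge0 / 2) <= ge / tau * dot ge1 (ge1 - ge0).
  by rewrite ler_pM2l ?half_sqr_le// divr_gt0.
have ti0 : 0 < tau^-1 by rewrite invr_gt0.
rewrite /= -/Gr -/Ge in hs.
move: h1 h2 hpos.
move: (dot (flux1 _ _ _ _) _) (dot (flux3 _ _ _ _) _) (flux4 _ _ _ _) => f1 f3 f4.
move: (dot gr1 _) (dot ge1 _) (dot gr0 _) (dot ge0 _) => q1 q2 q3 q4 h1 h2 hpos.
have h3 : tau^-1 * (psi P (r1, e1) t1 - psi P (r0, e0) t0 - e_pot P (r0, e0) t0 * (t1 - t0))
    <= tau^-1 * (Gr * (r1 - r0) + Ge * (e1 - e0)).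
  by rewrite ler_pM2l//; lra.
clear hs hc hq.
move: (e_pot P _ t1) (e_pot P _ t0) (psi P _ t1) (psi P _ t0) Gr Ge h3 =>
  E1 E0 p1 p0 Gr Ge h3.
move: (tau^-1) ti0 h1 h2 h3 => ti ti0 h1 h2 h3.
lra.
Qed.

End PointwiseEntropy.

Lemma le_1_quartic (R : realType) (y z : R) : `|y| <= 1 + (y ^+ 2 + z ^+ 2) ^+ 2.
Proof.
have := real_normK (num_real y); move: `|y| (normr_ge0 y) => t t0 <-.
have : 0 <= (t ^+ 2 - 1 / 2) ^+ 2 by exact: sqr_ge0.
have : 0 <= (t - 1 / 2) ^+ 2 by exact: sqr_ge0.
have : (t ^+ 2) ^+ 2 <= (t ^+ 2 + z ^+ 2) ^+ 2.
  by rewrite ler_pXn2r ?nnegrE ?addr_ge0 ?sqr_ge0// lerDl sqr_ge0.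
move: ((_ + _) ^+ 2) => w; rewrite !expr2; lra.
Qed.

(** * Control of a finite-element function by its moments *)

Section Dual.
Variables (R : realType) (d : nat) (d_gt0 : (0 < d)%N) (T : mesh R d)
  (n : nat) (b : 'I_n -> 'rV[R]_d -> R).
Local Notation V := (fe_space T).
Local Notation I := (@torus_integral R d).
Hypotheses (Vb : forall i, V (b i))
  (bfree : forall c : 'rV[R]_n, (forall x, \sum_i c 0 i * b i x = 0) -> c = 0).

(** Let s be the sum of the |v_i|. Expanding one factor gives int v^2 <= C s, Young gives t int |v|
    <= (int v^2 + t^2) / 2, and coercivity gives al s <= n int |v|. The choice t = n (C + 1) / al
    makes the left side at least (C + 1) s, so C s / 2 is absorbed and s <= t^2 / 2. *)
Lemma comb_bound_of_dual (C : R) : 0 <= C -> exists2 R1 : R, 0 <= R1 &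
  forall v : 'rV[R]_n, (forall j, `|I (fun x => comb b v x * b j x)| <= C) ->
    forall j, `|v 0 j| <= R1.
Proof.
move=> C0; have [al al0 Hal] := comb_coercive Vb bfree.
pose t := n%:R * (C + 1) / al.
exists (t ^+ 2 / 2) => [|v Hv j]; first by rewrite divr_ge0// sqr_ge0.
have n_gt0 : (0 < n)%N by apply: leq_trans (ltn_ord j).
have nv : nice (comb b v) by exact: fe_nice (fe_comb Vb v).
have nb i : nice (b i) by exact: fe_nice (Vb i).
pose s := \sum_i `|v 0 i|.
have vs : `|v 0 j| <= s by rewrite /s (bigD1 j)//= lerDl sumr_ge0.
apply: le_trans vs _.
have Iv2 : I (fun x => comb b v x * comb b v x) <= C * s.
  have -> : I (fun x => comb b v x * comb b v x) =
      \sum_i v 0 i * I (fun x => comb b v x * b i x).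
    transitivity (\sum_i I (fun x => v 0 i * (comb b v x * b i x))); last first.
      by apply: eq_bigr => i _; rewrite torus_integralZ//; exact: niceM.
    rewrite -torus_integral_sum; last by move=> i _; apply: niceM; [exact: nice_cst|exact: niceM].
    apply: torus_integral_ae_eq; apply: ae_cubeW => x.
    by rewrite {2}/comb mulr_sumr; apply: eq_bigr => i _; rewrite mulrCA.
  rewrite mulr_sumr; apply: ler_sum => i _; apply: le_trans (ler_norm _) _.
  by rewrite normrM mulrC ler_wpM2r.
have sI : al * s <= n%:R * I (fun x => `|comb b v x|).
  rewrite mulr_sumr; apply: le_trans (_ : \sum_(i < n) I (fun x => `|comb b v x|) <= _).
    by apply: ler_sum => i _; exact: Hal.
  by rewrite sumr_const card_ord mulr_natl.
have tI : t * I (fun x => `|comb b v x|) <= (C * s + t ^+ 2) / 2.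
  rewrite -torus_integralZ; last exact: nice_abs_comb.
  have n2 : nice (fun x => comb b v x * comb b v x) by exact: niceM.
  apply: (@le_trans _ _ (I (fun x => 2^-1 * (comb b v x * comb b v x) + t ^+ 2 / 2))).
    apply: torus_integral_le.
    - by apply: niceM; [exact: nice_cst|exact: nice_abs_comb].
    - by apply: niceD; [apply: niceM => //; exact: nice_cst|exact: nice_cst].
    apply: ae_cubeW => x; rewrite -expr2 -(real_normK (num_real (comb b v x))).
    have : 0 <= (t - `|comb b v x|) ^+ 2 by exact: sqr_ge0.
    by move: `|_| => y; rewrite !expr2; lra.
  rewrite torus_integralD; [|by apply: niceM => //; exact: nice_cst|exact: nice_cst].
  by rewrite torus_integral_cst torus_integralZ//; lra.
have e : t * (al * s) = n%:R * ((C + 1) * s) by rewrite /t; field; rewrite gt_eqF.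
have t0 : 0 <= t by rewrite /t divr_ge0 ?mulr_ge0 ?addr_ge0// ltW.
have := ler_wpM2l t0 sI; rewrite e (mulrCA t).
have n0 : 0 < n%:R :> R by rewrite ltr0n.
rewrite ler_pM2l//; move: tI; move: (t ^+ 2) => t2.
have s0 : 0 <= s by apply: sumr_ge0.
have := mulr_ge0 C0 s0; lra.
Qed.

End Dual.

Lemma cont_horner (R : realType) (X : topologicalType) (p : {poly R}) (f : X -> R) :
  continuous f -> continuous (fun x => p.[f x]).
Proof.
move=> cf; elim/poly_ind: p => [|p k IH].
  rewrite (_ : (fun x => _) = fun=> 0); first exact: cont_cst.
  by apply/funext => x; rewrite horner0.
rewrite (_ : (fun x => _) = fun x => p.[f x] * f x + k).
  by apply: cont_add; [exact: cont_mul|exact: cont_cst].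
by apply/funext => x; rewrite !hornerE.
Qed.

Lemma cont_eval2 (R : realType) (X : topologicalType) (F : {poly {poly R}}) (f g : X -> R) :
  continuous f -> continuous g -> continuous (fun x => eval2 F (f x, g x)).
Proof.
move=> cf cg; elim/poly_ind: F => [|F p IH].
  rewrite (_ : (fun x => _) = fun=> 0); first exact: cont_cst.
  by apply/funext => x; rewrite /eval2 !horner0.
rewrite (_ : (fun x => _) = fun x => eval2 F (f x, g x) * f x + p.[g x]).
  by apply: cont_add; [exact: cont_mul|exact: cont_horner].
by apply/funext => x; rewrite eval2_MXaddC.
Qed.

(** * The scheme *)

Section Scheme.
Variables (R : realType) (d : nat) (d_gt0 : (0 < d)%N) (P : potential R)
  (hP : admissible_potential d P) (gamma_rho gamma_eta M : R)
  (lambda0 lambda1 : R) (L : R * R -> R -> 'M[R]_(d + d + 1))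
  (hL : admissible_mobility lambda0 lambda1 L) (T : mesh R d) (tau : R)
  (rho0 theta0 eta0 : 'rV[R]_d -> R).
Local Notation V := (fe_space T).
Local Notation I := (@torus_integral R d).
Hypotheses (hrho0 : V rho0) (htheta0 : V theta0) (heta0 : V eta0)
  (theta0_gt0 : forall x, 0 < theta0 x).
Variables (n : nat) (b : 'I_n -> 'rV[R]_d -> R).
Hypotheses (Vb : forall i, V (b i)).

Let Lh x := L (rho0 x, eta0 x) (theta0 x).

Lemma cont_mobility i j : continuous (fun x => Lh x i j).
Proof.
have oS : open [set p : (R * R) * R | 0 < p.2].
  apply: (@open_comp _ _ (snd : (R * R) * R -> R) [set y | 0 < y]); last exact: open_gt.
  by move=> p _; exact: cvg_snd.
have cL := mob_continuous hL; rewrite continuous_open_subspace// in cL.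
have [cr _ _] := hrho0; have [ct _ _] := htheta0; have [ce _ _] := heta0.
move=> x.
have c1 : {for x, continuous (fun x => ((rho0 x, eta0 x), theta0 x))}.
  exact: (cvg_pair (cvg_pair (cr x) (ce x)) (ct x)).
have c2 : {for ((rho0 x, eta0 x), theta0 x), continuous (fun p : (R * R) * R => L p.1 p.2)}.
  by apply: cL; rewrite inE /=.
exact: (continuous_comp (continuous_comp c1 c2) (@coord_continuous R _ _ i j _)).
Qed.

Lemma nice_mobility i j : nice (fun x => Lh x i j).
Proof. by apply: nice_continuous; exact: cont_mobility. Qed.

Lemma nice_blk11 i j : nice (fun x => blk11 (Lh x) i j).
Proof.
rewrite (_ : (fun x => _) = fun x => Lh x (lshift 1 (lshift d i)) (lshift 1 (lshift d j))).
  exact: nice_mobility.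
by apply/funext => x; rewrite !mxE.
Qed.

Lemma nice_blk12 i j : nice (fun x => blk12 (Lh x) i j).
Proof.
rewrite (_ : (fun x => _) = fun x => Lh x (lshift 1 (lshift d i)) (lshift 1 (rshift d j))).
  exact: nice_mobility.
by apply/funext => x; rewrite !mxE.
Qed.

Lemma nice_blk12t i j : nice (fun x => (blk12 (Lh x))^T i j).
Proof.
rewrite (_ : (fun x => _) = fun x => blk12 (Lh x) j i); first exact: nice_blk12.
by apply/funext => x; rewrite mxE.
Qed.

Lemma nice_blk22 i j : nice (fun x => blk22 (Lh x) i j).
Proof.
rewrite (_ : (fun x => _) = fun x => Lh x (lshift 1 (rshift d i)) (lshift 1 (rshift d j))).
  exact: nice_mobility.
by apply/funext => x; rewrite !mxE.
Qed.

Lemma nice_blk13 i j : nice (fun x => blk13 (Lh x) i j).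
Proof.
rewrite (_ : (fun x => _) = fun x => Lh x (lshift 1 (lshift d i)) (rshift (d + d) j)).
  exact: nice_mobility.
by apply/funext => x; rewrite !mxE.
Qed.

Lemma nice_blk23 i j : nice (fun x => blk23 (Lh x) i j).
Proof.
rewrite (_ : (fun x => _) = fun x => Lh x (lshift 1 (rshift d i)) (rshift (d + d) j)).
  exact: nice_mobility.
by apply/funext => x; rewrite !mxE.
Qed.

Lemma nice_blk33 : nice (fun x => blk33 (Lh x)).
Proof.
rewrite (_ : (fun x => _) = fun x => Lh x (rshift (d + d) 0) (rshift (d + d) 0)).
  exact: nice_mobility.
by apply/funext => x; rewrite /blk33 !mxE.
Qed.

(** Linear in c at every point, whereas [grad (comb b c)] has this property only almost
    everywhere. *)
Definition comb_grad (c : 'rV[R]_n) (x : 'rV[R]_d) : 'cV[R]_d := \sum_i c 0 i *: grad (b i) x.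

Lemma comb_gradE c x j : comb_grad c x j 0 = \sum_i c 0 i * grad (b i) x j 0.
Proof. by rewrite /comb_grad summxE; apply: eq_bigr => i _; rewrite mxE. Qed.

Lemma grad_comb c : ae_cube (fun x => grad (comb b c) x = comb_grad c x).
Proof.
apply: ae_cube1 (grad_comb_coord d_gt0 Vb c) => x H.
by apply/matrixP => i j; rewrite ord1 H comb_gradE.
Qed.

(** The index is a natural number so that unknowns can be named by numerals; only k < 5 is
    meaningful. *)
Definition coefs (k : nat) (c : 'rV[R]_(5 * n)) : 'rV[R]_n := row (inord k) (vec_mx c).

Lemma coefsE k c j : coefs k c 0 j = c 0 (mxvec_index (inord k) j).
Proof. by rewrite !mxE. Qed.

Definition Grho (c : 'rV[R]_(5 * n)) x :=
  d_rho (psi_vex P M ^~ (comb b (coefs 2 c) x)) (comb b (coefs 0 c) x, comb b (coefs 3 c) x) +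
  d_rho (psi_cav M ^~ (comb b (coefs 2 c) x)) (rho0 x, eta0 x).
Definition Geta (c : 'rV[R]_(5 * n)) x :=
  d_eta (psi_vex P M ^~ (comb b (coefs 2 c) x)) (comb b (coefs 0 c) x, comb b (coefs 3 c) x) +
  d_eta (psi_cav M ^~ (comb b (coefs 2 c) x)) (rho0 x, eta0 x).
Definition e1 (c : 'rV[R]_(5 * n)) x :=
  e_pot P (comb b (coefs 0 c) x, comb b (coefs 3 c) x) (comb b (coefs 2 c) x).

(* The rows 0, ..., 4 of [vec_mx c] are the coordinates of rho, mu_rho, theta, eta,
   mu_eta. Equation k of the scheme, paired with unknown number k, has the weak form
   (weak_source k c, v) + (weak_flux k c, grad v) = 0; the order of the equations and
   their signs are such that the sum over k of the equations tested with the unknowns is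
   the entropy production. *)
Definition weak_source (k : nat) (c : 'rV[R]_(5 * n)) (x : 'rV[R]_d) : R :=
  match k with
  | 0 => (Grho c x - comb b (coefs 1 c) x) / tau
  | 1 => (comb b (coefs 0 c) x - rho0 x) / tau
  | 2 => - ((e1 c x - e_pot P (rho0 x, eta0 x) (theta0 x)) / tau)
  | 3 => (Geta c x - comb b (coefs 4 c) x) / tau
  | _ => (comb b (coefs 3 c) x - eta0 x) / tau +
         flux4 (Lh x) (comb_grad (coefs 1 c) x) (comb_grad (coefs 2 c) x) (comb b (coefs 4 c) x)
  end.

Definition weak_flux (k : nat) (c : 'rV[R]_(5 * n)) (x : 'rV[R]_d) : 'cV[R]_d :=
  match k with
  | 0 => (gamma_rho / tau) *: comb_grad (coefs 0 c) x
  | 1 => flux1 (Lh x) (comb_grad (coefs 1 c) x) (comb_grad (coefs 2 c) x) (comb b (coefs 4 c) x)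
  | 2 => - flux3 (Lh x) (comb_grad (coefs 1 c) x) (comb_grad (coefs 2 c) x) (comb b (coefs 4 c) x)
  | 3 => (gamma_eta / tau) *: comb_grad (coefs 3 c) x
  | _ => 0
  end.

Section OnK.
Variables (Rb ka : R) (Rb0 : 0 <= Rb) (ka0 : 0 < ka).

Definition trial_set : set 'rV[R]_(5 * n) :=
  [set c : 'rV[R]_(5 * n) | (forall i, `|c 0 i| <= Rb) /\ forall x, ka <= comb b (coefs 2 c) x].
Local Notation K := trial_set.

Lemma ufam_coefs k j : ufam (d := d) K (fun (c : 'rV[R]_(5 * n)) _ => coefs k c 0 j).
Proof.
have H := @ufam_coord R d (5 * n) K Rb (mxvec_index (inord k) j) Rb0.
apply: ufam_ext (H _); last by move=> c [].
by move=> c x _; rewrite coefsE.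
Qed.

Lemma ufam_comb k : ufam K (fun (c : 'rV[R]_(5 * n)) (x : 'rV[R]_d) => comb b (coefs k c) x).
Proof.
apply: ufam_sum => j; apply: ufam_mul; first exact: ufam_coefs.
by apply: ufam_cst; exact: fe_nice (Vb j).
Qed.

Lemma ufam_comb_grad k i : ufam K (fun (c : 'rV[R]_(5 * n)) (x : 'rV[R]_d) =>
    comb_grad (coefs k c) x i 0).
Proof.
apply: (@ufam_ext _ _ _ _ (fun (c : 'rV[R]_(5 * n)) (x : 'rV[R]_d) =>
    \sum_j coefs k c 0 j * grad (b j) x i 0)).
  by move=> c x _; rewrite comb_gradE.
apply: ufam_sum => j; apply: ufam_mul; first exact: ufam_coefs.
by apply: ufam_cst; exact: (nice_grad d_gt0 i (Vb j)).
Qed.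

Lemma K_theta_cont c : continuous (comb b (coefs 2 c)).
Proof. by have [] := fe_comb Vb (coefs 2 c). Qed.

Lemma ufam_theta (phi : R -> R) (La : R) : 0 <= La ->
  (forall y y', ka <= y -> ka <= y' -> `|phi y - phi y'| <= La * `|y - y'|) ->
  (forall y, 0 < y -> {for y, continuous phi}) ->
  ufam K (fun (c : 'rV[R]_(5 * n)) (x : 'rV[R]_d) => phi (comb b (coefs 2 c) x)).
Proof.
move=> La0 lip cphi.
apply: (@ufam_lipschitz _ _ _ _ (fun y => ka <= y) phi La ka) => //.
- by move=> c x [].
- move=> c [_ Hc]; apply: nice_continuous; apply: cont_comp; first exact: K_theta_cont.
  by move=> x; apply: cphi; apply: lt_le_trans (Hc x).
- exact: ufam_comb.
Qed.

Lemma symmetric_lipschitz (phi : R -> R) (La : R) :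
  (forall y y', ka <= y -> y <= y' -> `|phi y - phi y'| <= La * (y' - y)) ->
  forall y y', ka <= y -> ka <= y' -> `|phi y - phi y'| <= La * `|y - y'|.
Proof.
move=> H y y' ky ky'; have [le|/ltW le] := leP y y'.
  by rewrite (distrC y y') (@ger0_norm _ (y' - y)) ?subr_ge0//; exact: H.
by rewrite (@ger0_norm _ (y - y')) ?subr_ge0// distrC; exact: H.
Qed.

Lemma ufam_theta_inv : ufam K (fun (c : 'rV[R]_(5 * n)) (x : 'rV[R]_d) =>
    (comb b (coefs 2 c) x)^-1).
Proof.
apply: (@ufam_theta (fun y => y^-1) (ka ^- 2)).
- by rewrite invr_ge0 exprn_ge0// ltW.
- apply: symmetric_lipschitz => y y' ky yy'.
  have y0 : 0 < y by apply: lt_le_trans ky.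
  have y'0 : 0 < y' by apply: lt_le_trans yy'.
  rewrite ger0_norm; last by rewrite subr_ge0 lef_pV2 ?posrE.
  rewrite (_ : y^-1 - y'^-1 = (y * y')^-1 * (y' - y)); last first.
    by field; rewrite !gt_eqF.
  rewrite ler_wpM2r ?subr_ge0// lef_pV2 ?posrE ?mulr_gt0 ?exprn_gt0//.
  by rewrite expr2 ler_pM// ?(ltW ka0)//; apply: le_trans yy'.
- by move=> y y0; apply: inv_continuous; rewrite gt_eqF.
Qed.

Lemma ufam_theta_ln : ufam K (fun (c : 'rV[R]_(5 * n)) (x : 'rV[R]_d) => ln (comb b (coefs 2 c) x)).
Proof.
apply: (@ufam_theta (fun y => ln y) (ka^-1)).
- by rewrite invr_ge0 ltW.
- apply: symmetric_lipschitz => y y' ky yy'.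
  have y0 : 0 < y by apply: lt_le_trans ky.
  have y'0 : 0 < y' by apply: lt_le_trans yy'.
  rewrite ler0_norm; last by rewrite subr_le0 ler_ln ?posrE.
  rewrite opprB; have := ln_le_sub1 (divr_gt0 y'0 y0); rewrite ln_div ?posrE//.
  move=> H; apply: le_trans H _.
  rewrite (_ : y' / y - 1 = y^-1 * (y' - y)); last by field; rewrite gt_eqF.
  by rewrite ler_wpM2r ?subr_ge0// lef_pV2 ?posrE.
- by move=> y y0; exact: continuous_ln.
Qed.

Lemma ufam_theta_powR (q : R) : 0 <= q -> ufam K (fun (c : 'rV[R]_(5 * n)) (x : 'rV[R]_d) =>
    comb b (coefs 2 c) x `^ (- q)).
Proof.
move=> q0.
apply: (@ufam_theta (fun y => y `^ (- q)) (q * ka `^ (- q - 1))).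
- by rewrite mulr_ge0// powR_ge0.
- apply: symmetric_lipschitz => y y' ky yy'.
  have y0 : 0 < y by apply: lt_le_trans ky.
  have y'0 : 0 < y' by apply: lt_le_trans yy'.
  rewrite ger0_norm; last first.
    rewrite subr_ge0 !powRN lef_pV2 ?posrE ?powR_gt0//.
    by apply: ge0_ler_powR => //; rewrite nnegrE ltW.
  have q0' : - q <= 0 by rewrite oppr_le0.
  have H := powR_tangent q0' y0 y'0.
  apply: (@le_trans _ _ (q * y `^ (- q - 1) * (y' - y))); first by lra.
  rewrite ler_wpM2r ?subr_ge0// ler_wpM2l//.
  rewrite (_ : - q - 1 = - (q + 1)); last by ring.
  rewrite !powRN lef_pV2 ?posrE ?powR_gt0//.
  by apply: ge0_ler_powR; rewrite ?nnegrE ?addr_ge0 ?(ltW y0) ?(ltW ka0).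
- move=> y y0; apply: differentiable_continuous; apply/derivable1_diffP.
  by apply: derivable_powR; rewrite in_itv /= andbT.
Qed.

Lemma ufam_e1 : ufam K e1.
Proof.
have q1 := q_gt1 hP.
apply: (@ufam_ext _ _ _ _ (fun (c : 'rV[R]_(5 * n)) (x : 'rV[R]_d) =>
    (comb b (coefs 2 c) x)^-1 - eps1 P * ln (comb b (coefs 2 c) x) +
   epsq P * comb b (coefs 2 c) x `^ (- qexp P) + eval2 (F1 P) (comb b (coefs 0 c) x,
       comb b (coefs 3 c) x))).
  by move=> c x [_ Hc]; rewrite /e1 e_potE//; apply: lt_le_trans (Hc x).
apply: ufam_add; last by apply: ufam_eval2; exact: ufam_comb.
apply: ufam_add; last first.
  by apply: ufam_scale; apply: ufam_theta_powR; lra.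
apply: ufam_sub; first exact: ufam_theta_inv.
by apply: ufam_scale; exact: ufam_theta_ln.
Qed.

Lemma ufam_quartic k (f g : 'rV[R]_(5 * n) -> 'rV[R]_d -> R) : (k < 2)%N ->
  ufam K f -> ufam K g ->
  ufam K (fun (c : 'rV[R]_(5 * n)) (x : 'rV[R]_d) =>
      if k == 0%N then (quartic_grad M (comb b (coefs 2 c) x) (f c x, g c x)).1
     else (quartic_grad M (comb b (coefs 2 c) x) (f c x, g c x)).2).
Proof.
move=> k2 uf ug.
apply: (@ufam_ext _ _ _ _ (fun (c : 'rV[R]_(5 * n)) (x : 'rV[R]_d) =>
    4 * M * (1 + comb b (coefs 2 c) x) *
  (1 + (f c x * f c x + g c x * g c x)) * (if k == 0%N then f else g) c x)).
  by move=> c x _; rewrite /quartic_grad /normsq /= -!expr2; case: ifP.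
apply: ufam_mul; last by case: ifP.
apply: ufam_mul.
  by apply: ufam_mul; [exact: ufam_const|apply: ufam_add; [exact: ufam_const|exact: ufam_comb]].
by apply: ufam_add; [exact: ufam_const|apply: ufam_add; exact: ufam_mul].
Qed.

Lemma ufam_Grho : ufam K Grho.
Proof.
have [p0 [q0 [p1 [q1 Hv]]]] := psi_vex_grad P M.
apply: (@ufam_ext _ _ _ _ (fun (c : 'rV[R]_(5 * n)) (x : 'rV[R]_d) =>
  (- eval2 p0 (comb b (coefs 0 c) x, comb b (coefs 3 c) x)
   + comb b (coefs 2 c) x * eval2 p1 (comb b (coefs 0 c) x, comb b (coefs 3 c) x)
   + (quartic_grad M (comb b (coefs 2 c) x) (comb b (coefs 0 c) x, comb b (coefs 3 c) x)).1)
   - (quartic_grad M (comb b (coefs 2 c) x) (rho0 x, eta0 x)).1)).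
  move=> c x _; rewrite /Grho (has_grad_rho _ (Hv _)).
  by rewrite (has_grad_rho _ (psi_cav_grad M (comb b (coefs 2 c) x))).
apply: ufam_sub; last first.
  by apply: (@ufam_quartic 0) => //; apply: ufam_cst; apply: (fe_nice (T := T)).
apply: ufam_add; last by apply: (@ufam_quartic 0) => //; exact: ufam_comb.
apply: ufam_add; first by apply: ufam_opp; apply: ufam_eval2; exact: ufam_comb.
by apply: ufam_mul; [exact: ufam_comb|apply: ufam_eval2; exact: ufam_comb].
Qed.

Lemma ufam_Geta : ufam K Geta.
Proof.
have [p0 [q0 [p1 [q1 Hv]]]] := psi_vex_grad P M.
apply: (@ufam_ext _ _ _ _ (fun (c : 'rV[R]_(5 * n)) (x : 'rV[R]_d) =>
  (- eval2 q0 (comb b (coefs 0 c) x, comb b (coefs 3 c) x)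
   + comb b (coefs 2 c) x * eval2 q1 (comb b (coefs 0 c) x, comb b (coefs 3 c) x)
   + (quartic_grad M (comb b (coefs 2 c) x) (comb b (coefs 0 c) x, comb b (coefs 3 c) x)).2)
   - (quartic_grad M (comb b (coefs 2 c) x) (rho0 x, eta0 x)).2)).
  move=> c x _; rewrite /Geta (has_grad_eta _ (Hv _)).
  by rewrite (has_grad_eta _ (psi_cav_grad M (comb b (coefs 2 c) x))).
apply: ufam_sub; last first.
  by apply: (@ufam_quartic 1) => //; apply: ufam_cst; apply: (fe_nice (T := T)).
apply: ufam_add; last by apply: (@ufam_quartic 1) => //; exact: ufam_comb.
apply: ufam_add; first by apply: ufam_opp; apply: ufam_eval2; exact: ufam_comb.
by apply: ufam_mul; [exact: ufam_comb|apply: ufam_eval2; exact: ufam_comb].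
Qed.

Lemma ufam_mulmx (A : 'rV[R]_d -> 'M[R]_d) (g : 'rV[R]_(5 * n) -> 'rV[R]_d -> 'cV[R]_d) i :
  (forall i j, nice (fun x => A x i j)) -> (forall j,
      ufam K (fun (c : 'rV[R]_(5 * n)) (x : 'rV[R]_d) => g c x j 0)) ->
  ufam K (fun (c : 'rV[R]_(5 * n)) (x : 'rV[R]_d) => (A x *m g c x) i 0).
Proof.
move=> nA ug; apply: (@ufam_ext _ _ _ _ (fun (c : 'rV[R]_(5 * n)) (x : 'rV[R]_d) =>
    \sum_j A x i j * g c x j 0)).
  by move=> c x _; rewrite mxE.
apply: ufam_sum => j; apply: ufam_mul; last exact: ug.
by apply: ufam_cst; exact: nA.
Qed.

Lemma cont_e0 : continuous (fun x => e_pot P (rho0 x, eta0 x) (theta0 x)).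
Proof.
have [cr _ _] := hrho0; have [ct _ _] := htheta0; have [ce _ _] := heta0.
rewrite (_ : (fun x => _) = fun x => (theta0 x)^-1 + (- eps1 P) * ln (theta0 x) +
   epsq P * theta0 x `^ (- qexp P) + eval2 (F1 P) (rho0 x, eta0 x)); last first.
  by apply/funext => x; rewrite e_potE ?mulNr// (q_gt1 hP).
apply: cont_add; last exact: cont_eval2.
apply: cont_add; last first.
  by apply: cont_mul; [exact: cont_cst|exact: cont_powR].
apply: cont_add.
  apply: (@cont_comp _ _ theta0 (fun y => y^-1)) => // x.
  by apply: inv_continuous; rewrite gt_eqF.
apply: cont_mul; first exact: cont_cst.
by apply: cont_comp => // x; exact: continuous_ln.
Qed.

Lemma ufam_weak_source k : ufam K (weak_source k).
Proof.
have nr0 : ufam K (fun _ => rho0) by apply: ufam_cst; apply: (fe_nice (T := T)).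
have ne0 : ufam K (fun _ => eta0) by apply: ufam_cst; apply: (fe_nice (T := T)).
have div f : ufam K f -> ufam K (fun (c : 'rV[R]_(5 * n)) (x : 'rV[R]_d) => f c x / tau).
  by move=> uf; apply: ufam_mul => //; exact: ufam_const.
case: k => [|[|[|[|k]]]] /=.
- by apply: div; apply: ufam_sub; [exact: ufam_Grho|exact: ufam_comb].
- by apply: div; apply: ufam_sub; [exact: ufam_comb|].
- apply: ufam_opp; apply: div; apply: ufam_sub; first exact: ufam_e1.
  by apply: ufam_cst; apply: nice_continuous; exact: cont_e0.
- by apply: div; apply: ufam_sub; [exact: ufam_Geta|exact: ufam_comb].
apply: ufam_add; first by apply: div; apply: ufam_sub; [exact: ufam_comb|].
apply: ufam_add.
  apply: ufam_sub; apply: ufam_dot => i; try exact: ufam_comb_grad.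
    by apply: ufam_cst; exact: nice_blk13.
  by apply: ufam_cst; exact: nice_blk23.
by apply: ufam_mul; [apply: ufam_cst; exact: nice_blk33|exact: ufam_comb].
Qed.

Lemma ufam_weak_flux k i : ufam K (fun (c : 'rV[R]_(5 * n)) (x : 'rV[R]_d) => weak_flux k c x i 0).
Proof.
have sc a l : ufam K (fun (c : 'rV[R]_(5 * n)) (x : 'rV[R]_d) =>
    (a *: comb_grad (coefs l c) x) i 0).
  apply: (@ufam_ext _ _ _ _ (fun (c : 'rV[R]_(5 * n)) (x : 'rV[R]_d) =>
      a * comb_grad (coefs l c) x i 0)).
    by move=> c x _; rewrite mxE.
  by apply: ufam_scale; exact: ufam_comb_grad.
case: k => [|[|[|[|k]]]] /=; try exact: sc.
- apply: (@ufam_ext _ _ _ _ (fun (c : 'rV[R]_(5 * n)) (x : 'rV[R]_d) =>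
    (blk11 (Lh x) *m comb_grad (coefs 1 c) x) i 0 -
    (blk12 (Lh x) *m comb_grad (coefs 2 c) x) i 0 + comb b (coefs 4 c) x * blk13 (Lh x) i 0)).
    by move=> c x _; rewrite /flux1 !mxE.
  apply: ufam_add; first apply: ufam_sub.
  + by apply: ufam_mulmx; [exact: nice_blk11|exact: ufam_comb_grad].
  + by apply: ufam_mulmx; [exact: nice_blk12|exact: ufam_comb_grad].
  by apply: ufam_mul; [exact: ufam_comb|apply: ufam_cst; exact: nice_blk13].
- apply: (@ufam_ext _ _ _ _ (fun (c : 'rV[R]_(5 * n)) (x : 'rV[R]_d) =>
    - (((blk12 (Lh x))^T *m comb_grad (coefs 1 c) x) i 0 -
    (blk22 (Lh x) *m comb_grad (coefs 2 c) x) i 0 + comb b (coefs 4 c) x * blk23 (Lh x) i 0))).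
    by move=> c x _; rewrite /flux3 !mxE.
  apply: ufam_opp; apply: ufam_add; first apply: ufam_sub.
  + by apply: ufam_mulmx; [exact: nice_blk12t|exact: ufam_comb_grad].
  + by apply: ufam_mulmx; [exact: nice_blk22|exact: ufam_comb_grad].
  by apply: ufam_mul; [exact: ufam_comb|apply: ufam_cst; exact: nice_blk23].
- apply: (@ufam_ext _ _ _ _ (fun _ _ => 0)); last exact: ufam_const.
  by move=> c x _; rewrite mxE.
Qed.

Definition basis_residual k c j := I (fun x =>
    weak_source k c x * b j x + dot (weak_flux k c x) (grad (b j) x)).
Definition residual k c v := I (fun x => weak_source k c x * comb b v x + dot (weak_flux k c x)
    (comb_grad v x)).

Lemma ufam_weak_form k j :
  ufam K (fun c x => weak_source k c x * b j x + dot (weak_flux k c x) (grad (b j) x)).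
Proof.
apply: ufam_add.
  by apply: ufam_mul; [exact: ufam_weak_source|apply: ufam_cst; exact: fe_nice (Vb j)].
apply: ufam_dot => i; first exact: ufam_weak_flux.
by apply: ufam_cst; exact: (nice_grad d_gt0 i (Vb j)).
Qed.

Lemma weak_form_sum k (c : 'rV[R]_(5 * n)) (v : 'rV[R]_n) x :
  weak_source k c x * comb b v x + dot (weak_flux k c x) (comb_grad v x) =
  \sum_j v 0 j * (weak_source k c x * b j x + dot (weak_flux k c x) (grad (b j) x)).
Proof.
rewrite /comb /comb_grad dot_sumr mulr_sumr -big_split; apply: eq_bigr => j _ /=.
by rewrite dotZr; ring.
Qed.

Lemma nice_weak_form k c (v : 'rV[R]_n) : K c ->
  nice (fun x => weak_source k c x * comb b v x + dot (weak_flux k c x) (comb_grad v x)).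
Proof.
move=> Kc; apply: (@nice_eq _ _ (fun x =>
    \sum_j v 0 j * (weak_source k c x * b j x + dot (weak_flux k c x) (grad (b j) x)))).
  by apply: ae_cubeW => x; rewrite weak_form_sum.
apply: nice_sum => j _; apply: niceM; first exact: nice_cst.
exact: (ufam_nice (ufam_weak_form k j) Kc).
Qed.

Lemma residual_sum k c v : K c -> residual k c v = \sum_j v 0 j * basis_residual k c j.
Proof.
move=> Kc; have nj j := ufam_nice (ufam_weak_form k j) Kc.
under [RHS]eq_bigr do rewrite -torus_integralZ//.
rewrite -torus_integral_sum; last by move=> j _; apply: niceM => //; exact: nice_cst.
by apply: torus_integral_ae_eq; apply: ae_cubeW => x; rewrite weak_form_sum.
Qed.

Definition residual_map (c : 'rV[R]_(5 * n)) : 'rV[R]_(5 * n) :=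
  mxvec (\matrix_(k < 5, j < n) basis_residual k c j).

Lemma ip_mxvec (A : 'M[R]_(5, n)) (y : 'rV[R]_(5 * n)) :
  ip (mxvec A) y = \sum_(k < 5) \sum_j coefs k y 0 j * A k j.
Proof.
rewrite /ip (reindex _ (curry_mxvec_bij _ _)) /= pair_bigA.
by apply: eq_bigr => -[k j] _ /=; rewrite mxvecE coefsE inord_val mulrC.
Qed.

Lemma ip_residual_map c y : K c -> ip (residual_map c) y = \sum_(k < 5) residual k c (coefs k y).
Proof.
move=> Kc; rewrite ip_mxvec; apply: eq_bigr => k _; rewrite residual_sum//.
by apply: eq_bigr => j _; rewrite mxE.
Qed.

Lemma coefs_lin k (x y : 'rV[R]_(5 * n)) t : coefs k (x + t *: y) = coefs k x + t *: coefs k y.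
Proof. by apply/rowP => j; rewrite !(coefsE, mxE). Qed.

Lemma combD (v w : 'rV[R]_n) t x : comb b (v + t *: w) x = comb b v x + t * comb b w x.
Proof. by rewrite -combZ -big_split; apply: eq_bigr => j _; rewrite !mxE mulrDl. Qed.

Lemma comb_gradD (v w : 'rV[R]_n) t x : comb_grad (v + t *: w) x = comb_grad v x + t *:
    comb_grad w x.
Proof.
rewrite /comb_grad scaler_sumr -big_split; apply: eq_bigr => j _ /=.
by rewrite !mxE scalerDl scalerA.
Qed.

Lemma trial_set_closed : closed K.
Proof.
rewrite (_ : K = (\bigcap_(i in [set: 'I_(5 * n)]) [set c : 'rV[R]_(5 * n) | `|c 0 i| <= Rb]) `&`
   \bigcap_(x in [set: 'rV[R]_d]) [set c : 'rV[R]_(5 * n) | ka <= comb b (coefs 2 c) x]);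
       last first.
  apply/seteqP; split=> c; first by move=> [h1 h2]; split=> i _; [exact: h1|exact: h2].
  by move=> [h1 h2]; split=> i; [exact: h1|exact: h2].
apply: closedI; apply: closed_bigI => i _.
  apply: (@preimage_closed _ _ (fun c : 'rV[R]_(5 * n) => `|c 0 i|) [set y | y <= Rb]).
    move=> c _; apply: (continuous_comp (@coord_continuous R _ _ 0 i c)).
    exact: norm_continuous.
  exact: closed_le.
apply: (@preimage_closed _ _ (fun c : 'rV[R]_(5 * n) => comb b (coefs 2 c) i) [set y | ka <= y]).
  move=> c _; rewrite /comb; apply: continuous_sumr => j; apply: cont_mul; last exact: cont_cst.
  move=> c'; rewrite (_ : (fun c => _) = fun c : 'rV[R]_(5 * n) => c 0 (mxvec_index (inord 2) j)).
    exact: coord_continuous.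
  by apply/funext => z; rewrite coefsE.
exact: closed_ge.
Qed.

Lemma trial_set_convex x y t : K x -> K y -> 0 < t -> t <= 1 -> K (x + t *: (y - x)).
Proof.
move=> [bx tx] [yb ty] t0 t1; split=> [i|z].
  rewrite !mxE (_ : _ + _ = (1 - t) * x 0 i + t * y 0 i); last by ring.
  apply: le_trans (ler_normD _ _) _; rewrite !normrM (gtr0_norm t0).
  rewrite (@ger0_norm _ (1 - t)) ?subr_ge0//.
  rewrite (_ : Rb = (1 - t) * Rb + t * Rb); last by ring.
  by apply: lerD; apply: ler_wpM2l => //; rewrite ?subr_ge0// ltW.
rewrite coefs_lin combD (_ : coefs 2 (y - x) = coefs 2 y + (-1) *: coefs 2 x); last first.
  by rewrite -coefs_lin scaleN1r.
rewrite combD (_ : _ + _ = (1 - t) * comb b (coefs 2 x) z + t * comb b (coefs 2 y) z); last by ring.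
rewrite (_ : ka = (1 - t) * ka + t * ka); last by ring.
by apply: lerD; apply: ler_wpM2l => //; rewrite ?subr_ge0// ltW.
Qed.

Lemma scheme_vi : K !=set0 ->
  exists2 c, K c & forall y, K y -> 0 <= ip (residual_map c) (y - c).
Proof.
move=> K0; apply: (variational_inequality (B := Rb)) => //.
- exact: trial_set_closed.
- by move=> x i [h _].
- exact: trial_set_convex.
move=> c i e Kc e0; case/mxvec_indexP: i => k j.
have [r r0 H] := ufam_torus_integral_cont (ufam_weak_form k j) Kc e0.
exists r => // c' Kc' cc'; have := H c' Kc' cc'.
by rewrite !mxvecE !mxE.
Qed.

End OnK.
Hypotheses (gamma_rho_gt0 : 0 < gamma_rho) (gamma_eta_gt0 : 0 < gamma_eta)
  (tau_gt0 : 0 < tau) (hM : admissible_splitting P M).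

(** * Entropy bound and a priori estimates *)

Section Entropy.
Variables (cs : 'rV[R]_(5 * n)) (a k0 C0 : R).
Hypotheses (cs0 : comb b (coefs 0 cs) = rho0) (cs1 : coefs 1 cs = 0)
  (cs2 : comb b (coefs 2 cs) = fun=> a) (cs3 : comb b (coefs 3 cs) = eta0) (cs4 : coefs 4 cs = 0)
  (k0_gt0 : 0 < k0)
  (coer : forall z th, 0 < th -> k0 * (normsq z ^+ 2 + th + th `^ (- qexp P)) - C0 <=
    psi P z th - th * e_pot P z th + a * e_pot P z th).

(** The old entropy together with the old gradient energies: what the pointwise inequality retains
    of time level n. *)
Let D x := psi P (rho0 x, eta0 x) (theta0 x) - theta0 x * e_pot P (rho0 x, eta0 x) (theta0 x)
  + a * e_pot P (rho0 x, eta0 x) (theta0 x)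
  + gamma_rho / 2 * dot (comb_grad (coefs 0 cs) x) (comb_grad (coefs 0 cs) x)
  + gamma_eta / 2 * dot (comb_grad (coefs 3 cs) x) (comb_grad (coefs 3 cs) x).

Lemma nice_comb_grad c i : nice (fun x => comb_grad c x i 0).
Proof.
apply: (@nice_eq _ _ (fun x => \sum_j c 0 j * grad (b j) x i 0)).
  by apply: ae_cubeW => x; rewrite comb_gradE.
apply: nice_sum => j _; apply: niceM; first exact: nice_cst.
exact: (nice_grad d_gt0 i (Vb j)).
Qed.

Lemma nice_dot m (F G : 'rV[R]_d -> 'cV[R]_m) : (forall i, nice (fun x => F x i 0)) ->
  (forall i, nice (fun x => G x i 0)) -> nice (fun x => dot (F x) (G x)).
Proof.
move=> nF nG; apply: (@nice_eq _ _ (fun x => \sum_i F x i 0 * G x i 0)).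
  by apply: ae_cubeW => x; apply: eq_bigr => i _; rewrite big_ord1.
by apply: nice_sum => i _; exact: niceM.
Qed.

Lemma nice_initial_entropy : nice D.
Proof.
have [cr _ _] := hrho0; have [ct _ _] := htheta0; have [ce _ _] := heta0.
have cl : continuous (fun x => ln (theta0 x)).
  by apply: cont_comp => // x; exact: continuous_ln.
have ne := nice_continuous cont_e0; have nt := nice_continuous ct.
apply: niceD; last by apply: niceM; [exact: nice_cst|apply: nice_dot => i; exact: nice_comb_grad].
apply: niceD; last by apply: niceM; [exact: nice_cst|apply: nice_dot => i; exact: nice_comb_grad].
apply: niceD; last by apply: niceM => //; exact: nice_cst.
apply: niceB; last exact: niceM.
apply: niceD; last by apply: niceM => //; apply: nice_continuous; exact: cont_eval2.
apply: niceB; last by apply: nice_continuous; exact: cont_eval2.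
apply: niceB; last first.
  by apply: niceM; [exact: nice_cst|apply: nice_continuous; exact: cont_powR].
apply: niceB; first exact: nice_continuous.
apply: niceM; first by apply: niceM => //; exact: nice_cst.
by apply: niceB; [exact: nice_continuous|exact: nice_cst].
Qed.

Definition entropy_weight (c : 'rV[R]_(5 * n)) x : R :=
  normsq (comb b (coefs 0 c) x, comb b (coefs 3 c) x) ^+ 2 + comb b (coefs 2 c) x
  + comb b (coefs 2 c) x `^ (- qexp P).

Lemma nice_entropy_weight Rb ka c : 0 <= Rb -> 0 < ka -> trial_set Rb ka c ->
    nice (entropy_weight c).
Proof.
move=> Rb0 ka0 Kc; have q1 := q_gt1 hP.
have nl l : nice (comb b (coefs l c)) by exact: fe_nice (fe_comb Vb _).
apply: niceD; last first.
  apply: (ufam_nice (ufam_theta_powR Rb0 ka0 _) Kc); lra.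
apply: niceD => //.
apply: (@nice_eq _ _ (fun x => (comb b (coefs 0 c) x * comb b (coefs 0 c) x +
    comb b (coefs 3 c) x * comb b (coefs 3 c) x) * (comb b (coefs 0 c) x * comb b (coefs 0 c) x +
    comb b (coefs 3 c) x * comb b (coefs 3 c) x))).
  by apply: ae_cubeW => x; rewrite /normsq /= -!expr2.
by apply: niceM; apply: niceD; exact: niceM.
Qed.

Lemma coefs_sub k x y : coefs k (x - y) = coefs k x + (-1) *: coefs k y.
Proof. by rewrite -coefs_lin scaleN1r. Qed.

Lemma comb_grad_cst_eq0 : ae_cube (fun x => comb_grad (coefs 2 cs) x = 0).
Proof.
apply: ae_cube1 (grad_comb (coefs 2 cs)) => x <-; rewrite cs2.
by apply/matrixP => i j; rewrite !mxE derive_cst.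
Qed.

(** The five residuals tested with c - cs integrate the right-hand side of [entropy_pointwise]: the
    potentials are unchanged because they vanish in cs, and the temperature of cs, being constant,
    has zero gradient almost everywhere. The resulting bound contains neither Rb nor ka. *)
Lemma entropy_bound Rb ka c : 0 <= Rb -> 0 < ka -> trial_set Rb ka c ->
  ip (residual_map c) (c - cs) <= 0 -> I (entropy_weight c) <= (C0 + I D) / k0.
Proof.
move=> Rb0 ka0 Kc; rewrite (ip_residual_map Rb0 ka0)//.
rewrite !big_ord_recr big_ord0 /= add0r /residual.
have nt l := nice_weak_form Rb0 ka0 l (coefs l (c - cs)) Kc.
have nt01 := niceD (nt 0%N) (nt 1%N); have nt02 := niceD nt01 (nt 2%N).
have nt03 := niceD nt02 (nt 3%N); have nt04 := niceD nt03 (nt 4%N).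
rewrite -(torus_integralD (nt 0%N) (nt 1%N)) -(torus_integralD nt01 (nt 2%N)) -(torus_integralD
    nt02 (nt 3%N)) -(torus_integralD nt03 (nt 4%N)).
have nQ := nice_entropy_weight Rb0 ka0 Kc; have nD := nice_initial_entropy.
have nkQ := niceM (nice_cst d k0) nQ.
have nQC := niceB nkQ (nice_cst d C0); have nQD := niceB nQC nD.
move=> le0; rewrite ler_pdivlMr//.
have E : I (fun x => k0 * entropy_weight c x - C0 - D x) = k0 * I (entropy_weight c) - C0 - I D.
  by rewrite torus_integralB// torus_integralB// ?torus_integralZ// ?torus_integral_cst//;
      exact: nice_cst.
suff : I (fun x => tau^-1 * (k0 * entropy_weight c x - C0 - D x)) <= 0.
  by rewrite torus_integralZ// pmulr_rle0 ?invr_gt0// E => h; lra.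
apply: le_trans le0; apply: torus_integral_le => //.
  by apply: niceM => //; exact: nice_cst.
apply: ae_cube1 comb_grad_cst_eq0 => x lg0.
have th_gt0 : 0 < comb b (coefs 2 c) x by apply: lt_le_trans (Kc.2 x).
have symL : (Lh x)^T = Lh x by exact: (mob_symmetric hL).
have posL (zeta : 'cV[R]_(d + d + 1)) : 0 <= (zeta^T *m Lh x *m zeta) 0 0.
  have /andP[+ _] := mob_elliptic hL (rho0 x, eta0 x) zeta (theta0_gt0 x).
  apply: le_trans; rewrite mulr_ge0 ?sqr_ge0// ltW//; exact: lambda0_gt0 hL.
have main := @entropy_pointwise R d P hP M hM (Lh x) symL posL tau gamma_rho gamma_eta a
  tau_gt0 gamma_rho_gt0 gamma_eta_gt0 (rho0 x) (eta0 x) (theta0 x)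
  (comb b (coefs 0 c) x) (comb b (coefs 3 c) x) (comb b (coefs 2 c) x)
  (comb b (coefs 1 c) x) (comb b (coefs 4 c) x) (comb_grad (coefs 0 cs) x) (comb_grad (coefs 3
      cs) x)
  (comb_grad (coefs 0 c) x) (comb_grad (coefs 3 c) x) (comb_grad (coefs 1 c) x) (comb_grad
      (coefs 2 c) x)
  (theta0_gt0 x) th_gt0; cbv zeta in main.
have lc0 y : comb b (0 : 'rV[R]_n) y = 0.
  by rewrite /comb big1// => j _; rewrite mxE mul0r.
have lgz y : comb_grad (0 : 'rV[R]_n) y = 0.
  by rewrite /comb_grad big1// => j _; rewrite mxE scale0r.
rewrite !coefs_sub cs1 cs4 !scaler0 !addr0 !combD !comb_gradD lg0 scaler0 addr0.
rewrite cs0 cs2 cs3 !mulN1r !scaleN1r /= (dot0l (comb_grad (coefs 4 c) x)) addr0.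
apply: le_trans main; rewrite ler_pM2l ?invr_gt0//.
have := coer (comb b (coefs 0 c) x, comb b (coefs 3 c) x) th_gt0.
rewrite /entropy_weight /D; lra.
Qed.

End Entropy.
Hypotheses (bfree : forall c : 'rV[R]_n, (forall x, \sum_i c 0 i * b i x = 0) -> c = 0)
  (bspan : forall u, V u -> exists c : 'rV[R]_n, forall x, u x = \sum_i c 0 i * b i x).

(** R0 and m0 are fixed before Rb and ka. Since 1 + [entropy_weight] dominates |rho|, theta and
    |eta| pointwise, equivalence of norms bounds their coefficients; the bound on theta from above
    then feeds the bound from below. *)
Lemma apriori_bounds (C3 : R) : exists R0 m0 : R, [/\ 0 <= R0, 0 < m0 &
  forall Rb ka c, 0 <= Rb -> 0 < ka -> trial_set Rb ka c -> I (entropy_weight c) <= C3 ->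
    [/\ forall j, `|coefs 0 c 0 j| <= R0, forall j, `|coefs 2 c 0 j| <= R0,
        forall j, `|coefs 3 c 0 j| <= R0 & forall x, m0 <= comb b (coefs 2 c) x]].
Proof.
have [al al0 Hal] := comb_coercive Vb bfree; have [Cb Cb0 HCb] := comb_bound Vb.
pose R0 := (1 + `|C3|) / al.
have R00 : 0 <= R0 by rewrite divr_ge0 ?addr_ge0// ltW.
have B0 : 0 < Cb * R0 + 1 by rewrite ltr_wpDl// mulr_ge0// ltW.
have [m0 m00 Hm0] := fe_lower_bound T d_gt0 C3 (q_ge_dim hP) B0.
exists R0, m0; split=> // Rb ka c Rb0 ka0 Kc IQ.
have th_gt0 x : 0 < comb b (coefs 2 c) x by apply: lt_le_trans (Kc.2 x).
have nQ := nice_entropy_weight Rb0 ka0 Kc.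
have p0 x : 0 <= comb b (coefs 2 c) x `^ (- qexp P) by apply: powR_ge0.
have bnd (v : 'rV[R]_n) : (forall x, `|comb b v x| <= 1 + entropy_weight c x) ->
    forall j, `|v 0 j| <= R0.
  move=> H j; rewrite ler_pdivlMr// mulrC; apply: le_trans (Hal v j) _.
  have n1 := nice_cst d 1.
  apply: (@le_trans _ _ (I (fun x => 1 + entropy_weight c x))).
    by apply: torus_integral_le; [exact: nice_abs_comb|exact: niceD|exact: ae_cubeW].
  by rewrite torus_integralD// torus_integral_cst lerD2l (le_trans IQ)// ler_norm.
have b2 : forall j, `|coefs 2 c 0 j| <= R0.
  apply: bnd => x; rewrite gtr0_norm// /entropy_weight.
  have := sqr_ge0 (normsq (comb b (coefs 0 c) x, comb b (coefs 3 c) x)).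
  by have := p0 x; lra.
split=> //.
- apply: bnd => x; have := le_1_quartic (comb b (coefs 0 c) x) (comb b (coefs 3 c) x).
  by rewrite /entropy_weight /normsq /=; have := p0 x; have := th_gt0 x; lra.
- apply: bnd => x; have := le_1_quartic (comb b (coefs 3 c) x) (comb b (coefs 0 c) x).
  by rewrite /entropy_weight /normsq /= addrC; have := p0 x; have := th_gt0 x; lra.
apply: Hm0 => //.
- exact: fe_comb.
- move=> x; apply: le_trans (ler_norm _) _.
  by apply: le_trans (HCb _ _ R00 b2 x) _; rewrite lerDl.
apply: le_trans IQ; apply: torus_integral_le => //.
  by apply: nice_continuous; apply: cont_powR => //; exact: K_theta_cont.
apply: ae_cubeW => x; rewrite /entropy_weight lerDr addr_ge0 ?sqr_ge0//; exact: ltW.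
Qed.

(** Both c + t delta_i and c - t delta_i are admissible competitors for a small t > 0: t is limited
    by the distance of c_i to the box and by the margin s of theta. Other coordinates of c may still
    lie on the boundary of the box. *)
Lemma interior_coord_eq0 Rb ka c i s : 0 <= Rb -> 0 < ka -> trial_set Rb ka c ->
  (forall y, trial_set Rb ka y -> 0 <= ip (residual_map c) (y - c)) ->
  `|c 0 i| < Rb -> 0 < s -> (forall x, ka + s <= comb b (coefs 2 c) x) -> residual_map c 0 i = 0.
Proof.
move=> Rb0 ka0 Kc vi ci s0 th; have [Cb Cb0 HCb] := comb_bound Vb.
pose y : 'rV[R]_(5 * n) := delta_mx 0 i.
pose t := Num.min (Rb - `|c 0 i|) (s / Cb).
have t0 : 0 < t by rewrite lt_min subr_gt0 ci divr_gt0.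
have t1 : t <= Rb - `|c 0 i| by rewrite ge_min lexx.
have t2 : t * Cb <= s by rewrite -ler_pdivlMr// ge_min lexx orbT.
have Kt u : `|u| = t -> trial_set Rb ka (c + u *: y).
  move=> ut; split=> [l|x].
    rewrite !mxE; have [->|li] := eqVneq l i; last by rewrite mulr0 addr0; exact: Kc.1.
    by rewrite mulr1; apply: le_trans (ler_normD _ _) _; rewrite ut; lra.
  rewrite coefs_lin combD; have yb j : `|coefs 2 y 0 j| <= 1.
    by rewrite coefsE mxE; case: (_ && _); rewrite ?normr1 ?normr0.
  have := HCb _ 1 ler01 yb x; rewrite mulr1 => yC.
  have : `|u * comb b (coefs 2 y) x| <= s.
    by rewrite normrM ut; apply: le_trans t2; rewrite ler_pM2l.
  by rewrite ler_norml => /andP[h1 _]; have := th x; lra.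
have ipy : ip (residual_map c) y = residual_map c 0 i.
  rewrite /ip (bigD1 i)//= mxE !eqxx mulr1 big1 ?addr0// => l /negPf li.
  by rewrite mxE eqxx li mulr0.
have := vi _ (Kt t (gtr0_norm t0)); have := vi _ (Kt (- t) (etrans (normrN _) (gtr0_norm t0))).
rewrite !(addrC c) !addrK !ipZr ipy mulNr oppr_ge0 pmulr_rle0// pmulr_rge0// => h1 h2.
by apply/eqP; rewrite eq_le h1.
Qed.

Lemma coefs_exist (v : nat -> 'rV[R]_n) : exists c : 'rV[R]_(5 * n),
  (forall k, (k < 5)%N -> coefs k c = v k) /\
  forall B, (forall k j, (k < 5)%N -> `|v k 0 j| <= B) -> forall i, `|c 0 i| <= B.
Proof.
exists (mxvec (\matrix_(k < 5) v k)); split=> [k k5|B HB i].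
  by rewrite /coefs mxvecK rowK inordK.
by case/mxvec_indexP: i => k j; rewrite mxvecE mxE; exact: HB.
Qed.

Lemma dual_bound R0 m0 (G : 'rV[R]_(5 * n) -> 'rV[R]_d -> R) g l :
  0 <= R0 -> 0 < m0 -> ufam (trial_set R0 m0) G ->
  exists2 C : R, 0 <= C & forall c j, trial_set R0 m0 c ->
    `|I (fun x => G c x * b j x + g * dot (comb_grad (coefs l c) x) (grad (b j) x))| <= C.
Proof.
move=> R00 m00 uG.
have /choice[B HB] : forall j, exists B, 0 <= B /\ forall c, trial_set R0 m0 c ->
    `|I (fun x => G c x * b j x + g * dot (comb_grad (coefs l c) x) (grad (b j) x))| <= B.
  move=> j.
  have H : ufam (trial_set R0 m0) (fun (c : 'rV[R]_(5 * n)) (x : 'rV[R]_d) =>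
      G c x * b j x + g * dot (comb_grad (coefs l c) x) (grad (b j) x)).
    apply: ufam_add.
      by apply: ufam_mul => //; apply: ufam_cst; exact: fe_nice (Vb j).
    apply: ufam_scale; apply: ufam_dot => i; first exact: ufam_comb_grad.
    by apply: ufam_cst; exact: (nice_grad d_gt0 i (Vb j)).
  by have [B B0 HB] := ufam_torus_integral_bounded H; exists B.
exists (\sum_j B j) => [|c j Kc]; first by apply: sumr_ge0 => j _; exact: (HB j).1.
apply: le_trans ((HB j).2 c Kc) _; rewrite (bigD1 j)//= lerDl.
by apply: sumr_ge0 => i _; exact: (HB i).1.
Qed.

Lemma potential_eq (G f v : 'rV[R]_d -> R) (F W : 'rV[R]_d -> 'cV[R]_d) g : nice G -> nice f ->
  nice v -> (forall i, nice (fun x => F x i 0)) -> (forall i, nice (fun x => W x i 0)) ->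
  I (fun x => (G x - f x) / tau * v x + dot ((g / tau) *: F x) (W x)) = 0 ->
  I (fun x => f x * v x) = I (fun x => G x * v x + g * dot (F x) (W x)).
Proof.
move=> nG nf nv nF nW.
have nd : nice (fun x => g * dot (F x) (W x)).
  by apply: niceM; [exact: nice_cst|exact: nice_dot].
have n1 := niceM nf nv; have n2 := niceD (niceM nG nv) nd.
rewrite (_ : I _ = I (fun x => tau^-1 * (G x * v x + g * dot (F x) (W x) - f x * v x))).
  rewrite torus_integralZ ?torus_integralB//; last exact: niceB.
  by move/eqP; rewrite mulf_eq0 invr_eq0 gt_eqF//= subr_eq0 => /eqP <-.
by apply: torus_integral_ae_eq; apply: ae_cubeW => x; rewrite dotZl; field; rewrite gt_eqF.
Qed.

Lemma chemical_potential_bound R0 m0 : 0 <= R0 -> 0 < m0 -> exists2 R1 : R, 0 <= R1 &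
  forall Rb ka c, 0 <= Rb -> 0 < ka -> trial_set Rb ka c ->
    (forall j, `|coefs 0 c 0 j| <= R0) -> (forall j, `|coefs 2 c 0 j| <= R0) ->
    (forall j, `|coefs 3 c 0 j| <= R0) -> (forall x, m0 <= comb b (coefs 2 c) x) ->
    (forall j, basis_residual 0 c j = 0) -> (forall j, basis_residual 3 c j = 0) ->
    forall j, `|coefs 1 c 0 j| <= R1 /\ `|coefs 4 c 0 j| <= R1.
Proof.
move=> R00 m00.
have uG Rb ka : 0 <= Rb -> 0 < ka -> ufam (trial_set Rb ka) Grho by move=> *; exact: ufam_Grho.
have uH Rb ka : 0 <= Rb -> 0 < ka -> ufam (trial_set Rb ka) Geta by move=> *; exact: ufam_Geta.
have [C1 C10 HC1] := dual_bound gamma_rho 0 R00 m00 (uG _ _ R00 m00).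
have [C2 C20 HC2] := dual_bound gamma_eta 3 R00 m00 (uH _ _ R00 m00).
have [R1 R10 H1] := comb_bound_of_dual Vb bfree (addr_ge0 C10 C20).
exists R1 => // Rb ka c Rb0 ka0 Kc b0 b2 b3 th E0 E3.
(* [Grho], [Geta] and the gradients of rho and eta do not see the rows of the potentials. With these
   set to zero, c' lies in the fixed set [trial_set R0 m0], so the moments of the potentials are
   bounded independently of Rb and ka. *)
have [c' [bc' Hc']] := coefs_exist (fun k => if (k == 1%N) || (k == 4%N) then 0 else coefs k c).
have e0 := bc' 0%N isT; have e2 := bc' 2%N isT; have e3 := bc' 3%N isT; rewrite /= in e0 e2 e3.
have K' : trial_set R0 m0 c'.
  split; last by move=> x; rewrite e2.
  by apply: Hc' => -[|[|[|[|[|k]]]]] j _ //=; rewrite mxE normr0.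
have nl l : nice (comb b (coefs l c)) by exact: fe_nice (fe_comb Vb _).
have nb i : nice (b i) by exact: fe_nice (Vb i).
have ng i l : nice (fun x => grad (b i) x l 0) by exact: (nice_grad d_gt0 l (Vb i)).
have nG := ufam_nice (uG _ _ Rb0 ka0) Kc; have nH := ufam_nice (uH _ _ Rb0 ka0) Kc.
move=> j; split; apply: H1 => i.
  rewrite (potential_eq nG (nl 1%N) (nb i) (nice_comb_grad (coefs 0 c)) (ng i) (E0 i)).
  have := HC1 _ i K'; rewrite /Grho e0 e2 e3 => h; apply: le_trans h _.
  by rewrite lerDl.
rewrite (potential_eq nH (nl 4%N) (nb i) (nice_comb_grad (coefs 3 c)) (ng i) (E3 i)).
have := HC2 _ i K'; rewrite /Geta e0 e2 e3 => h; apply: le_trans h _.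
by rewrite lerDr.
Qed.

Lemma scheme_zero : exists Rb ka c, [/\ 0 <= Rb, 0 < ka, trial_set Rb ka c & residual_map c = 0].
Proof.
have [a [k0 [C0 [a0 k00 coer]]]] := entropy_coercive hP.
have [vr Hr] := bspan hrho0; have [vt Ht] := bspan (fe_const T a); have [ve He] := bspan heta0.
have [cs [Hcs _]] := coefs_exist (fun k => match k with 0 => vr | 2 => vt | 3 => ve | _ => 0 end).
have cs0 : comb b (coefs 0 cs) = rho0 by apply/funext => x; rewrite Hcs// Hr.
have cs2 : comb b (coefs 2 cs) = fun=> a by apply/funext => x; rewrite Hcs//; exact: esym (Ht x).
have cs3 : comb b (coefs 3 cs) = eta0 by apply/funext => x; rewrite Hcs// He.
have ebound := entropy_bound cs0 (Hcs 1%N isT) cs2 cs3 (Hcs 4%N isT) k00 coer.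
set C3 := (_ / k0) in ebound.
have [R0 [m0 [R00 m00 ap]]] := apriori_bounds C3.
have [R1 R10 mub] := chemical_potential_bound R00 m00.
pose S := \sum_i `|cs 0 i|; have S0 : 0 <= S by apply: sumr_ge0.
(* S and a make the comparison state admissible. The summand 1 makes the bounds R0 and R1 strict in
   the box, and the factor 1/2 leaves theta a margin ka above its lower bound. *)
pose Rb := R0 + R1 + S + 1; pose ka := Num.min m0 a / 2.
have Rb0 : 0 <= Rb by rewrite /Rb !addr_ge0.
have ka0 : 0 < ka by rewrite divr_gt0// lt_min m00.
have mm : Num.min m0 a <= m0 by rewrite ge_min lexx.
have ma : Num.min m0 a <= a by rewrite ge_min lexx orbT.
have kam : ka + ka <= m0 by rewrite /ka; lra.
have kaa : ka + ka <= a by rewrite /ka; lra.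
have Kcs : trial_set Rb ka cs.
  split=> [i|x]; last by rewrite cs2; lra.
  have : `|cs 0 i| <= S by rewrite /S (bigD1 i)//= lerDl sumr_ge0.
  by rewrite /Rb; lra.
have [c Kc vi] := scheme_vi Rb0 ka0 (ex_intro _ cs Kcs).
have [b0 b2 b3 th] : [/\ forall j, `|coefs 0 c 0 j| <= R0, forall j, `|coefs 2 c 0 j| <= R0,
    forall j, `|coefs 3 c 0 j| <= R0 & forall x, m0 <= comb b (coefs 2 c) x].
  apply: (ap Rb ka) => //; apply: ebound Rb0 ka0 Kc _.
  by have := vi _ Kcs; rewrite -opprB ipNr oppr_ge0.
have thk x : ka + ka <= comb b (coefs 2 c) x by apply: le_trans (th x).
(* Used twice: first for rows 0 and 3, whose vanishing yields the bounds on the potentials, then,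
   with these bounds, for all rows. *)
have zero k j : (k < 5)%N -> `|coefs k c 0 j| <= R0 + R1 -> basis_residual k c j = 0.
  move=> k5 bk; have := @interior_coord_eq0 Rb ka c (mxvec_index (inord k) j) ka Rb0 ka0 Kc vi.
  rewrite mxvecE mxE inordK// -coefsE; apply => //.
  by apply: le_lt_trans bk _; rewrite /Rb; lra.
have w v : v <= R0 -> v <= R0 + R1 by move=> h; lra.
have z0 j : basis_residual 0 c j = 0 by apply: zero => //; exact: w.
have z3 j : basis_residual 3 c j = 0 by apply: zero => //; exact: w.
have bm := mub _ _ _ Rb0 ka0 Kc b0 b2 b3 th z0 z3.
have w1 v : v <= R1 -> v <= R0 + R1 by move=> h; lra.
exists Rb, ka, c; split => //; apply/rowP => i; case/mxvec_indexP: i => k j.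
rewrite mxvecE !mxE; apply: zero; first exact: ltn_ord.
case: k => -[|[|[|[|[|k]]]]] // ? /=; try exact: w.
- by apply: w1; exact: (bm j).1.
- by apply: w1; exact: (bm j).2.
Qed.

Lemma L2v_grad_comb (F F' : 'rV[R]_d -> 'cV[R]_d) u : ae_cube (fun x => F x = F' x) ->
  L2v F (grad (comb b u)) = I (fun x => dot (F' x) (comb_grad u x)).
Proof.
by move=> FF; apply: torus_integral_ae_eq; apply: ae_cube2 FF (grad_comb u) => x -> ->.
Qed.

Lemma scheme_solved Rb ka c : 0 <= Rb -> 0 < ka -> trial_set Rb ka c -> residual_map c = 0 ->
  discrete_step P M gamma_rho gamma_eta L T tau rho0 theta0 eta0 (comb b (coefs 0 c))
    (comb b (coefs 1 c)) (comb b (coefs 2 c)) (comb b (coefs 3 c)) (comb b (coefs 4 c)).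
Proof.
move=> Rb0 ka0 Kc Fc0.
have Jz k v : (k < 5)%N -> residual k c v = 0.
  move=> k5; rewrite (residual_sum Rb0 ka0)// big1// => j _.
  have := congr1 (fun M : 'rV[R]_(5 * n) => M 0 (mxvec_index (inord k) j)) Fc0.
  by rewrite mxvecE !mxE inordK// => ->; rewrite mulr0.
have nf k : nice (weak_source k c).
  by have H : ufam (trial_set Rb ka) (weak_source k);
      [exact: ufam_weak_source|exact: (ufam_nice H Kc)].
have nF k i : nice (fun x => weak_flux k c x i 0).
  pose f (c : 'rV[R]_(5 * n)) (x : 'rV[R]_d) := weak_flux k c x i 0.
  by have H : ufam (trial_set Rb ka) f; [exact: ufam_weak_flux|exact: (ufam_nice H Kc)].
have nl v : nice (comb b v) by exact: fe_nice (fe_comb Vb v).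
have nG : nice (Grho c).
  by have H : ufam (trial_set Rb ka) Grho; [exact: ufam_Grho|exact: (ufam_nice H Kc)].
have nH : nice (Geta c).
  by have H : ufam (trial_set Rb ka) Geta; [exact: ufam_Geta|exact: (ufam_nice H Kc)].
have span u : V u -> exists v, u = comb b v.
  by move=> /bspan[v Hv]; exists v; apply/funext.
have g1 := grad_comb (coefs 1 c); have g2 := grad_comb (coefs 2 c).
have potential k m g G v : nice G -> residual k c v = I (fun x =>
    (G x - comb b (coefs m c) x) / tau * comb b v x
    + dot ((g / tau) *: comb_grad (coefs k c) x) (comb_grad v x)) -> (k < 5)%N ->
    L2 (comb b (coefs m c)) (comb b v) = g * L2v (grad (comb b (coefs k c))) (grad (comb b v))
        + L2 G (comb b v).
  move=> nG' Jk k5; have := potential_eq nG' (nl (coefs m c)) (nl v) (nice_comb_grad (coefs k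
      c)) (nice_comb_grad v).
  move=> /(_ g); rewrite -Jk Jz// => /(_ erefl); rewrite -/(L2 _ _) => ->.
  have nd := nice_dot (nice_comb_grad (coefs k c)) (nice_comb_grad v).
  rewrite (L2v_grad_comb v (grad_comb (coefs k c))) addrC -torus_integralZ// torus_integralD//;
      first exact: niceM.
  by apply: niceM => //; exact: nice_cst.
move=> v zeta xi w chi /span[v' ->] /span[zeta' ->] /span[xi' ->] /span[w' ->] /span[chi' ->].
split.
- rewrite (@L2v_grad_comb _ (weak_flux 1 c)); last by apply: ae_cube2 g1 g2 => x -> ->.
  rewrite -(Jz 1%N v')// /residual torus_integralD//; first exact: niceM.
  by apply: nice_dot => i; [exact: nF|exact: nice_comb_grad].
- exact: (@potential 0%N 1%N).
- rewrite (@L2v_grad_comb _ (fun x => - weak_flux 2 c x)); last first.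
    by apply: ae_cube2 g1 g2 => x -> ->; rewrite /weak_flux opprK.
  (* The energy balance was put into [weak_source] and [weak_flux] with the opposite sign. *)
  apply: oppr_inj; rewrite oppr0 -(Jz 2%N xi')// /residual.
  have n1 := niceM (nf 2%N) (nl xi').
  have n2 : nice (fun x => dot (weak_flux 2 c x) (comb_grad xi' x)).
    by apply: nice_dot => i; [exact: nF|exact: nice_comb_grad].
  rewrite torus_integralD// opprD -!torus_integralN; first last.
  + apply: nice_eq (niceN n1); apply: ae_cubeW => x.
    by rewrite /= mulNr opprK.
  + by apply: nice_eq (niceN n2); apply: ae_cubeW => x; rewrite dotNl.
  congr (_ + _); apply: torus_integral_ae_eq; apply: ae_cubeW => x.
    by rewrite /= mulNr.
  by rewrite dotNl opprK.
- have nd : nice (fun x => (comb b (coefs 3 c) x - eta0 x) / tau).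
    apply: niceM; last exact: nice_cst.
    by apply: niceB => //; exact: fe_nice heta0.
  have n4 : nice (fun x => flux4 (Lh x) (comb_grad (coefs 1 c) x) (comb_grad (coefs 2 c) x)
      (comb b (coefs 4 c) x)).
    by apply: nice_eq (niceB (nf 4%N) nd); apply: ae_cubeW => x; rewrite /= addrAC subrr add0r.
  rewrite -(Jz 4%N w')// /residual /L2.
  transitivity (I (fun x => (comb b (coefs 3 c) x - eta0 x) / tau * comb b w' x) +
      I (fun x => flux4 (Lh x) (comb_grad (coefs 1 c) x) (comb_grad (coefs 2 c) x) (comb b
          (coefs 4 c) x) * comb b w' x)).
    by congr (_ + _); apply: torus_integral_ae_eq; apply: ae_cube2 g1 g2 => x -> ->.
  rewrite -torus_integralD; [|exact: niceM|exact: niceM].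
  by apply: torus_integral_ae_eq; apply: ae_cubeW => x; rewrite /= dot0l addr0 [RHS]mulrDl.
- exact: (@potential 3%N 4%N).
Qed.

End Scheme.

Theorem theorem3p10 (R : realType) (d : nat) (hd : (1 <= d <= 3)%N)
    (P : potential R) (hP : admissible_potential d P)
    (gamma_rho gamma_eta : R) (hgrho : 0 < gamma_rho) (hgeta : 0 < gamma_eta)
    (M : R) (hM : admissible_splitting P M)
    (lambda0 lambda1 : R) (L : R * R -> R -> 'M[R]_(d + d + 1))
    (hL : admissible_mobility lambda0 lambda1 L)
    (H : set R) (Th : R -> mesh R d)
    (hTsr : shape_regular H Th) (hTqu : quasi_uniform H Th)
    (h : R) (hH : H h) (hh : 0 < h)
    (tau : R) (htau : 0 < tau)
    (rho0 theta0 eta0 : 'rV[R]_d -> R)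
    (hrho0 : fe_space (Th h) rho0) (htheta0 : fe_space (Th h) theta0)
    (heta0 : fe_space (Th h) eta0)
    (htheta0_gt0 : forall x, 0 < theta0 x) :
  exists rho1 murho1 theta1 eta1 mueta1 : 'rV[R]_d -> R,
    [/\ fe_space (Th h) rho1, fe_space (Th h) murho1, fe_space (Th h) theta1,
        fe_space (Th h) eta1 & fe_space (Th h) mueta1] /\
    (forall x, 0 < theta1 x) /\
    discrete_step P M gamma_rho gamma_eta L (Th h) tau
      rho0 theta0 eta0 rho1 murho1 theta1 eta1 mueta1.
Proof.
have d_gt0 : (0 < d)%N by have /andP[] := hd.
have [n [b [Vb bfree bspan]]] := fe_basis (Th h).
have [Rb [ka [c [Rb0 ka0 Kc Fc0]]]] := scheme_zero d_gt0 hP hL hrho0 htheta0 heta0 htheta0_gt0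
  Vb hgrho hgeta htau hM bfree bspan.
exists (comb b (coefs 0 c)), (comb b (coefs 1 c)), (comb b (coefs 2 c)), (comb b (coefs 3 c)),
    (comb b (coefs 4 c)).
split; first by split; exact: fe_comb.
split; first by move=> x; apply: lt_le_trans ka0 (Kc.2 x).
exact: (scheme_solved d_gt0 hP hL hrho0 htheta0 heta0 htheta0_gt0 Vb htau bspan
  Rb0 ka0 Kc Fc0).
Qed.
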